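(* Suppose the conditions (Data Generating Process), (Quasi-Uniform Partition), (Local Basis) and (Approximation Error) stated in the context hold, and that $\frac{\log n}{nh^d}=o(1)$. Then, for $\mathbf{x}\in\mathcal{X}$, $$\mathbb{E}[\widehat{\partial^{\mathbf{q}}\mu}_0(\mathbf{x})\,|\,\mathbf{X}]-\partial^{\mathbf{q}}\mu(\mathbf{x})=\widehat{\boldsymbol{\gamma}}_{\mathbf{q},0}(\mathbf{x})'\mathbb{E}_n[\boldsymbol{\Pi}_0(\mathbf{x}_i)\mu(\mathbf{x}_i)]-\partial^{\mathbf{q}}\mu(\mathbf{x})$$ $$=\mathscr{B}_{m,\mathbf{q}}(\mathbf{x})-\widehat{\boldsymbol{\gamma}}_{\mathbf{q},0}(\mathbf{x})'\mathbb{E}_n[\boldsymbol{\Pi}_0(\mathbf{x}_i)\mathscr{B}_{m,\mathbf{0}}(\mathbf{x}_i)]+O_{\mathbb{P}}(h^{m+\varrho-[\mathbf{q}]}).$$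
   Context: **Notation.** All limits are as $n\to\infty$. $d\ge 1$ is fixed. For a multi-index $\mathbf{q}=(q_1,\dots,q_d)\in\mathbb{Z}_+^d$, $[\mathbf{q}]=\sum_j q_j$ and $\partial^{\mathbf{q}}g=\partial^{[\mathbf{q}]}g/\partial x_1^{q_1}\cdots\partial x_d^{q_d}$ (at boundary points of a closed set, derivatives are limits from within the set). $\|\cdot\|$ is the Euclidean norm. $a_n\lesssim b_n$ means $\limsup_n|a_n/b_n|<\infty$; $a_n\gtrsim b_n$ means $b_n\lesssim a_n$; $a_n=O_{\mathbb{P}}(b_n)$ means $\limsup_{\epsilon\to\infty}\limsup_n\mathbb{P}[|a_n/b_n|\ge\epsilon]=0$. $\mathbb{E}_n[g(\mathbf{x}_i)]=\frac1n\sum_{i=1}^n g(\mathbf{x}_i)$. $\mathrm{clo}$ is closure, $\mathrm{diam}$ is diameter. $\mathbf{X}=[\mathbf{x}_1,\dots,\mathbf{x}_n]'$. **Model.** $y_i=\mu(\mathbf{x}_i)+\varepsilon_i$, $\mathbb{E}[\varepsilon_i|\mathbf{x}_i]=0$, $\mathbb{E}[\varepsilon_i^2|\mathbf{x}_i]=\sigma^2(\mathbf{x}_i)$, $y_i$ scalar, $\mathbf{x}_i\in\mathcal{X}\subset\mathbb{R}^d$. A multi-index $\mathbf{q}$ is fixed. **Partition and basis.** For each $n$, $\Delta=\{\delta_l:1\le l\le\bar\kappa\}$ is a nonrandom collection of open, disjoint polyhedral subsets of $\mathcal{X}$, the closure of whose union is $\mathcal{X}$; $h=\max\{\mathrm{diam}(\delta):\delta\in\Delta\}$.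 For $\mathbf{x}\in\mathcal{X}$, $\delta_{\mathbf{x}}$ is the element of $\Delta$ whose closure contains $\mathbf{x}$ and $h_{\mathbf{x}}=\mathrm{diam}(\delta_{\mathbf{x}})$. $m\in\mathbb{Z}_+$ is a fixed order and $\mathbf{p}(\mathbf{x})=\mathbf{p}(\mathbf{x};\Delta,m)=(p_1(\mathbf{x}),\dots,p_K(\mathbf{x}))'$ is a vector of $K$ basis functions, with linear span $\mathcal{S}_{\Delta,m}$. A function is active on $\delta\in\Delta$ if it is not identically zero on $\delta$. **(Data Generating Process)** (a) $\{(y_i,\mathbf{x}_i')\}_{i=1}^n$ are i.i.d. from the model; $\mathbf{x}_i$ has compact connected support $\mathcal{X}$ and an absolutely continuous distribution function; its density $f$ and the conditional variance $\sigma^2$ are bounded away from zero and continuous. (b) $\mu$ is $S$-times continuously differentiable, $S\ge[\mathbf{q}]$, and all $\partial^{\boldsymbol{\alpha}}\mu$ with $[\boldsymbol{\alpha}]=S$ are Hölder continuous with exponent $\varrho>0$. **(Quasi-Uniform Partition)** The ratio of the sizes of inscribed and circumscribed balls of each $\delta\in\Delta$ is bounded away from zero uniformly in $\delta\in\Delta$; $\max_{\delta\in\Delta}\mathrm{diam}(\delta)/\min_{\delta\in\Delta}\mathrm{diam}(\delta)\lesssim1$; and $h=o(1)$. **(Local Basis)** (a) For each $k$, the union $\mathcal{H}_k$ of elements of $\Delta$ on which $p_k$ is active is connected; for all $k$, the number of elements of $\mathcal{H}_k$ and the number of basis functions active on $\mathcal{H}_k$ are bounded by a constant. (b) For any $\mathbf{a}=(a_1,\dots,a_K)'\in\mathbb{R}^K$,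 $\mathbf{a}'\int_{\mathcal{H}_k}\mathbf{p}(\mathbf{x})\mathbf{p}(\mathbf{x})'d\mathbf{x}\,\mathbf{a}\gtrsim a_k^2h^d$, $k=1,\dots,K$. (c) $[\mathbf{q}]<m$, and for an integer $\varsigma\in[[\mathbf{q}],m)$: for all $\boldsymbol{\alpha}$ with $[\boldsymbol{\alpha}]\le\varsigma$, $h^{-[\boldsymbol{\alpha}]}\lesssim\inf_{\delta\in\Delta}\inf_{\mathbf{x}\in\mathrm{clo}(\delta)}\|\partial^{\boldsymbol{\alpha}}\mathbf{p}(\mathbf{x})\|\le\sup_{\delta\in\Delta}\sup_{\mathbf{x}\in\mathrm{clo}(\delta)}\|\partial^{\boldsymbol{\alpha}}\mathbf{p}(\mathbf{x})\|\lesssim h^{-[\boldsymbol{\alpha}]}$, and for $[\boldsymbol{\alpha}]=\varsigma+1$, $\sup_{\delta\in\Delta}\sup_{\mathbf{x}\in\mathrm{clo}(\delta)}\|\partial^{\boldsymbol{\alpha}}\mathbf{p}(\mathbf{x})\|\lesssim h^{-\varsigma-1}$. **(Approximation Error)** $S\ge m$. There is $s^*\in\mathcal{S}_{\Delta,m}$ such that for all $\boldsymbol{\alpha}$ with $[\boldsymbol{\alpha}]\le\varsigma$, with $\mathscr{B}_{m,\boldsymbol{\alpha}}(\mathbf{x})=-\sum_{\mathbf{u}\in\Lambda_m}\partial^{\mathbf{u}}\mu(\mathbf{x})\,h_{\mathbf{x}}^{m-[\boldsymbol{\alpha}]}B_{\mathbf{u},\boldsymbol{\alpha}}(\mathbf{x})$,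 one has $\sup_{\mathbf{x}\in\mathcal{X}}|\partial^{\boldsymbol{\alpha}}\mu(\mathbf{x})-\partial^{\boldsymbol{\alpha}}s^*(\mathbf{x})+\mathscr{B}_{m,\boldsymbol{\alpha}}(\mathbf{x})|\lesssim h^{m+\varrho-[\boldsymbol{\alpha}]}$ and $\sup_{\delta\in\Delta}\sup_{\mathbf{x}_1,\mathbf{x}_2\in\mathrm{clo}(\delta)}\frac{|B_{\mathbf{u},\boldsymbol{\alpha}}(\mathbf{x}_1)-B_{\mathbf{u},\boldsymbol{\alpha}}(\mathbf{x}_2)|}{\|\mathbf{x}_1-\mathbf{x}_2\|}\lesssim h^{-1}$, where $B_{\mathbf{u},\boldsymbol{\alpha}}$ are known functions bounded uniformly over $n$, and $\Lambda_m$ is a multi-index set depending on the basis with $[\mathbf{u}]=m$ for all $\mathbf{u}\in\Lambda_m$. **Estimator.** $\widehat{\partial^{\mathbf{q}}\mu}_0(\mathbf{x})=\widehat{\boldsymbol{\gamma}}_{\mathbf{q},0}(\mathbf{x})'\mathbb{E}_n[\boldsymbol{\Pi}_0(\mathbf{x}_i)y_i]$ with $\widehat{\boldsymbol{\gamma}}_{\mathbf{q},0}(\mathbf{x})'=\partial^{\mathbf{q}}\mathbf{p}(\mathbf{x})'\mathbb{E}_n[\mathbf{p}(\mathbf{x}_i)\mathbf{p}(\mathbf{x}_i)']^{-1}$ and $\boldsymbol{\Pi}_0(\mathbf{x}_i)=\mathbf{p}(\mathbf{x}_i)$ (the least squares series estimator; the inverse exists with probability approaching one). *)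

(* Defs.v *)
From HB Require Import structures.
From mathcomp Require Import all_boot all_order all_algebra finmap.
From mathcomp Require Import all_classical all_reals all_analysis.

Set Implicit Arguments.
Unset Strict Implicit.
Unset Printing Implicit Defensive.

Import Order.TTheory GRing.Theory Num.Theory numFieldNormedType.Exports.

Local Open Scope classical_set_scope.
Local Open Scope ring_scope.

Section rV_measurable.
Context (R : realType) (n : nat).
Definition rV_coord (i : 'I_n) (v : 'rV[R]_n) : R := v ord0 i.
Let rV0 : g_sigma_preimage rV_coord set0. Proof. exact: sigma_algebra0. Qed.
Let rVC A : g_sigma_preimage rV_coord A -> g_sigma_preimage rV_coord (~` A).
Proof. exact: sigma_algebraC. Qed.
Let rVU (F : (set _)^nat) : (forall i, g_sigma_preimage rV_coord (F i)) ->
  g_sigma_preimage rV_coord (\bigcup_i F i).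
Proof. exact: sigma_algebra_bigcup. Qed.
HB.instance Definition _ := @isMeasurable.Build default_measure_display
  'rV[R]_n (g_sigma_preimage rV_coord) rV0 rVC rVU.
End rV_measurable.

Lemma measurable_coord (R : realType) (n : nat) (i : 'I_n) :
  measurable_fun setT (@rV_coord R n i).
Proof.
move=> _ Y mY; rewrite setTI; apply: sub_sigma_algebra => /=.
rewrite -bigcup_seq/=; exists i => /=; first by rewrite mem_index_enum.
by exists Y => //; rewrite setTI.
Qed.

Lemma measurable_fun_rV (R : realType) d (T : measurableType d) (n : nat)
    (f : T -> 'rV[R]_n) :
  (forall i, measurable_fun setT (fun x => f x ord0 i)) ->
  measurable_fun setT f.
Proof.
move=> mf.
suff h : @measurable _ 'rV[R]_n `<=` [set A | d.-measurable (f @^-1` A)].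
  by move=> _ A mA; rewrite setTI; exact: h.
apply: smallest_sub.
  split => /=.
  - by rewrite preimage_set0.
  - by move=> A mA; rewrite setTD preimage_setC; exact: measurableC.
  - by move=> F mF; rewrite preimage_bigcup; exact: bigcupT_measurable.
rewrite -bigcup_seq => A /= [i _ [B mB <-]]; rewrite setTI.
by rewrite /= -comp_preimage -[X in measurable X]setTI; exact: mf.
Qed.

Section lebesgue_step.
Context (R : realType) (n : nat).
Definition rV_cons (z : measurableTypeR R * 'rV[R]_n) : 'rV[R]_n.+1 :=
  \row_i oapp (z.2 ord0) z.1 (unlift ord0 i).

Lemma measurable_rV_cons : measurable_fun setT rV_cons.
Proof.
apply: measurable_fun_rV => i.
rewrite (_ : (fun x => _) = (fun x : measurableTypeR R * 'rV[R]_n =>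
    oapp (x.2 ord0) x.1 (unlift ord0 i))); last first.
  by apply/funext => x; rewrite mxE.
case: unliftP => [j _|_] /=; last exact: measurable_fst.
exact: (measurableT_comp (@measurable_coord R n j) measurable_snd).
Qed.

Definition lebesgue_rVS (m : {sigma_finite_measure set 'rV[R]_n -> \bar R}) :=
  pushforward (lebesgue_measure \x m)%E rV_cons.

Section measure.
Variable m : {sigma_finite_measure set 'rV[R]_n -> \bar R}.

Let m_0 : lebesgue_rVS m set0 = 0%E.
Proof. by rewrite /lebesgue_rVS /pushforward preimage_set0 measure0. Qed.

Let m_ge0 A : (0 <= lebesgue_rVS m A)%E.
Proof. by rewrite /lebesgue_rVS /pushforward; exact: measure_ge0. Qed.

Let m_sigma_additive : semi_sigma_additive (lebesgue_rVS m).
Proof.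
move=> F mF tF mUF; rewrite /lebesgue_rVS /pushforward preimage_bigcup.
apply: measure_semi_sigma_additive.
- by move=> i; rewrite -[X in measurable X]setTI; exact: measurable_rV_cons.
- apply/trivIsetP => /= i j _ _ ij; rewrite -preimage_setI.
  by move/trivIsetP : tF => /(_ _ _ _ _ ij) ->//; rewrite preimage_set0.
- by rewrite -preimage_bigcup -[X in measurable X]setTI; exact: measurable_rV_cons.
Qed.

HB.instance Definition _ :=
  isMeasure.Build _ _ _ (lebesgue_rVS m) m_0 m_ge0 m_sigma_additive.

Let sf : sigma_finite setT (lebesgue_rVS m).
Proof.
have /sigma_finiteP[G [TG ndG mG]] := sigma_finiteT (@lebesgue_measure R).
have /sigma_finiteP[H [TH ndH mH]] := sigma_finiteT m.
pose F k := G k `*` H k.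
have FT : setT = \bigcup_k F k.
  rewrite -setXTT TG TH predeqE => -[x y]; split.
    move=> [/= [k _ Gkx] [l _ Hly]]; exists (maxn k l) => //; split.
    - by move: x Gkx; exact/subsetPset/ndG/leq_maxl.
    - by move: y Hly; exact/subsetPset/ndH/leq_maxr.
  by move=> [k _ []/= ? ?]; split; exists k.
have mF k : measurable (F k) /\ ((lebesgue_measure \x m) (F k) < +oo)%E.
  have [? ?] := mG k; have [? ?] := mH k.
  split; first exact: measurableX.
  by rewrite product_measure1E// lte_mul_pinfty// ge0_fin_numE.
pose u (v : 'rV[R]_n.+1)   : measurableTypeR R * 'rV[R]_n := (v ord0 ord0, \row_j v ord0 (lift ord0 j)).
have mu : measurable_fun setT u.
  apply: measurable_fun_pair; first exact: measurable_coord.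
  apply: measurable_fun_rV => i.
  rewrite (_ : (fun x => _) = rV_coord (lift ord0 i)); last first.
    by apply/funext => x; rewrite mxE.
  exact: measurable_coord.
have uK : cancel rV_cons u.
  move=> [a v]; rewrite /u /rV_cons !mxE unlift_none /=; congr pair.
  by apply/rowP => j; rewrite !mxE liftK.
exists (fun k => u @^-1` F k).
  by rewrite -preimage_bigcup -FT preimage_setT.
move=> k; have [mFk Foo] := mF k; split.
  by rewrite -[X in measurable X]setTI; exact: mu.
rewrite /= /lebesgue_rVS /pushforward -comp_preimage.
by rewrite (_ : u \o rV_cons = id) //; apply/funext.
Qed.

HB.instance Definition _ := Measure_isSigmaFinite.Build _ _ _ (lebesgue_rVS m) sf.
End measure.
End lebesgue_step.

(* n-dimensional Lebesgue measure on the product sigma-algebra of 'rV[R]_n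
   (the library has it for n = 1 only), as the iterated product measure. *)
Fixpoint lebesgue_rV (R : realType) (n : nat) :
    {sigma_finite_measure set 'rV[R]_n -> \bar R} :=
  match n with
  | 0 => dirac (0 : 'rV[R]_0)
  | n'.+1 => lebesgue_rVS (lebesgue_rV R n')
  end.

Lemma lebesgue_rV_box (R : realType) (n : nat) (a b : 'I_n -> R) :
  (forall i, a i <= b i) ->
  lebesgue_rV R n [set v | forall i, v ord0 i \in `]a i, b i]] =
  (\prod_(i < n) (b i - a i))%:E.
Proof.
elim: n a b => [|n IH] a b ab.
  by rewrite /= big_ord0 diracE mem_set // => -[].
rewrite big_ord_recl.
set A := (X in lebesgue_rV R n.+1 X).
set B : set (measurableTypeR R * 'rV[R]_n) := [set` `]a ord0, b ord0]] `*`
   [set v : 'rV[R]_n | forall i, v ord0 i \in `]a (lift ord0 i), b (lift ord0 i)]].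
have AB : @rV_cons R n @^-1` A = B.
  apply/seteqP; split => [[x v] /= H|[x v] /= [Hx Hv] i].
    split; first by have := H ord0; rewrite mxE unlift_none.
    by move=> i; have := H (lift ord0 i); rewrite mxE liftK.
  rewrite mxE; case: unliftP => [j ->|->] /=; last exact: Hx.
  exact: Hv.
transitivity ((lebesgue_measure \x lebesgue_rV R n)%E B); first by rewrite -AB.
rewrite product_measure1E //=.
- have /= -> := IH (a \o lift ord0) (b \o lift ord0) (fun i => ab (lift ord0 i)).
  rewrite lebesgue_measure_itv /= lte_fin.
  case: ltgtP (ab ord0) => [_|//|->] _; first by rewrite -EFinB -EFinM.
  by rewrite subrr mul0r mul0e.
- rewrite [X in measurable X](_ : _ = \bigcap_(i in [set: 'I_n])
     (rV_coord i @^-1` [set` `]a (lift ord0 i), b (lift ord0 i)]])); last first.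
    by apply/seteqP; split => v /= H i => [_|]; exact: H.
  apply: fin_bigcap_measurable => // i _.
  by rewrite -[X in measurable X]setTI; exact: measurable_coord.
Qed.

Section geometry.
Context (R : realType) (d : nat).
Local Notation pt := 'rV[R]_d.

(* The library norm on matrices is the sup norm. *)
Definition enorm {m n : nat} (A : 'M[R]_(m, n)) : R :=
  Num.sqrt (\sum_i \sum_j A i j ^+ 2).

Definition diam (A : set pt) : R := sup [set enorm (x - y) | x in A & y in A].

Definition inradius (A : set pt) : R :=
  sup [set r | exists c, [set x | enorm (x - c) < r] `<=` A].

Definition circumradius (A : set pt) : R :=
  inf [set r | exists c, A `<=` [set x | enorm (x - c) <= r]].

Definition convex_polyhedron (s : seq (pt * R)) : set pt :=
  [set x | forall ab, ab \in s -> \sum_j ab.1 ord0 j * x ord0 j <= ab.2].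

(* Convexity of the cells is not required. *)
Definition open_polyhedral (A : set pt) : Prop :=
  A !=set0 /\ exists ss : seq (seq (pt * R)),
    A = (\bigcup_(s in [set` ss]) convex_polyhedron s)°.

Record polyhedral_partition (X : set pt) (k : nat) (D : 'I_k -> set pt) :
    Prop := PolyhedralPartition {
  cells_polyhedral : forall l, open_polyhedral (D l) ;
  cells_disjoint : trivIset setT D ;
  cells_cover : closure (\bigcup_l D l) = X }.

(* The cell whose closure contains x. When x lies on several cell boundaries
   one cell is picked; the choice only depends on the set of candidates, so it
   is a Borel function of x. *)
Definition cell (k : nat) (D : 'I_k -> set pt) (x : pt) : set pt :=
  oapp D set0 [pick l | `[< closure (D l) x >]].

Definition mesh (k : nat) (D : 'I_k -> set pt) : R :=
  \big[Num.max/0]_(l < k) diam (D l).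

End geometry.

Definition mindex (d : nat) := {ffun 'I_d -> nat}.

Definition mdeg (d : nat) (alpha : mindex d) : nat := (\sum_j alpha j)%N.

Definition mi0 (d : nat) : mindex d := [ffun=> 0%N].

Section derivatives.
Context (R : realType) (d : nat).
Local Notation pt := 'rV[R]_d.

Definition partial (j : 'I_d) (g : pt -> R) : pt -> R :=
  fun x => 'D_(delta_mx ord0 j) g x.

Definition mpartial (alpha : mindex d) (g : pt -> R) : pt -> R :=
  foldr (fun j => iter (alpha j) (partial j)) g (enum 'I_d).

(* Value at x, possibly a boundary point of the open set U, of the derivative
   of order alpha: its limit from within U. For alpha = 0 this is the one-sided
   value of g itself. *)
Definition dlim (U : set pt) (alpha : mindex d) (g : pt -> R) (x : pt) : R :=
  lim (mpartial alpha g v @[v --> within U (nbhs x)]).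

Fixpoint Ck (r : nat) (U : set pt) (g : pt -> R) : Prop :=
  if r is r'.+1 then
    forall j, (forall x, U x -> derivable g x (delta_mx ord0 j)) /\
              Ck r' U (partial j g)
  else forall x, U x -> {for x, continuous g}.

(* r times continuously differentiable on the closure of the open set U *)
Definition Ck_closure (r : nat) (U : set pt) (g : pt -> R) : Prop :=
  Ck r U g /\ forall alpha, (mdeg alpha <= r)%N -> forall x, closure U x ->
    cvg (mpartial alpha g v @[v --> within U (nbhs x)]).

(* For functions that are smooth only cell by cell. *)
Definition dcell (k : nat) (D : 'I_k -> set pt) (alpha : mindex d)
    (g : pt -> R) (x : pt) : R := dlim (cell D x) alpha g x.

End derivatives.

Section probability.
Context (R : realType) (d0 : measure_display) (Omega : measurableType d0).
Context (P : probability Omega R).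

(* W is a version of the conditional expectation of Z given the sigma-algebra
   G, in the generalized sense that only requires Z to be integrable on each
   set of a countable cover by elements of G. The inverse random Gram matrix
   makes this necessary: the estimator need not be integrable. *)
Definition cond_expectation (G : set (set Omega)) (Z W : Omega -> R) : Prop :=
  [/\ forall A, measurable A -> G (W @^-1` A),
      exists F : (set Omega)^nat, [/\ forall k, G (F k), \bigcup_k F k = setT &
        forall k, P.-integrable (F k) (EFin \o Z)]
    & forall A, G A -> P.-integrable A (EFin \o Z) ->
        P.-integrable A (EFin \o W) /\
        (\int[P]_(w in A) (Z w)%:E = \int[P]_(w in A) (W w)%:E)%E].

Definition sigma_of d' (T : measurableType d') (Z : Omega -> T) :
    set (set Omega) := preimage_set_system setT Z measurable.

Definition sigma_first d' (T : measurableType d') (Z : nat -> Omega -> T)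
    (n : nat) : set (set Omega) := <<s \bigcup_(i in `I_n) sigma_of (Z i) >>.

Definition iid d' (T : measurableType d') (Z : nat -> Omega -> T) : Prop :=
  (forall (s : seq nat) (A : nat -> set T), uniq s ->
     (forall i, measurable (A i)) ->
     P (\bigcap_(i in [set` s]) (Z i @^-1` A i)) =
     (\prod_(i <- s) P (Z i @^-1` A i))%E) /\
  (forall i j A, measurable A -> P (Z i @^-1` A) = P (Z j @^-1` A)).

Definition dist_support (n : nat) (Z : Omega -> 'rV[R]_n) : set 'rV[R]_n :=
  [set v | forall U, open U -> U v -> (0 < P (Z @^-1` U))%E].

Definition bigO_in_prob (a : nat -> Omega -> R) (b : nat -> R) : Prop :=
  limf_esup (fun e : R =>
    limn_esup (fun n => P [set w | e <= `|a n w / b n|])) (pinfty_nbhs R) = 0%E.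

End probability.

Section model.
Context (R : realType) (d : nat).
Local Notation pt := 'rV[R]_d.

Section data.
Context (d0 : measure_display) (Omega : measurableType d0).
Context (P : probability Omega R).

Record data_generating_process (X : set pt) (mu sigma2 f : pt -> R)
    (S : nat) (rho : R) (q : mindex d)
    (x : nat -> {RV P >-> pt}) (y eps : nat -> {RV P >-> R}) :
    Prop := DataGeneratingProcess {
  dgp_model : forall i w, y i w = mu (x i w) + eps i w ;
  dgp_regressor : forall i w, X (x i w) ;
  dgp_mean : forall i,
    cond_expectation P (sigma_of (x i)) (eps i) (cst 0) ;
  dgp_variance : forall i, cond_expectation P (sigma_of (x i))
    (fun w => eps i w ^+ 2) (fun w => sigma2 (x i w)) ;
  dgp_iid : iid P (fun i w => (y i w, x i w)) ;
  dgp_compact : compact X ;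
  dgp_connected : connected X ;
  dgp_support : forall i, dist_support P (x i) = X ;
  dgp_density_measurable : measurable_fun setT f ;
  dgp_density_ge0 : forall v, 0 <= f v ;
  dgp_density : forall i A, measurable A ->
    P (x i @^-1` A) = (\int[lebesgue_rV R d]_(v in A) (f v)%:E)%E ;
  dgp_density_bound : exists2 c : R, 0 < c & forall v, X v -> c <= f v ;
  dgp_density_continuous : {within X, continuous f} ;
  dgp_variance_bound : exists2 c : R, 0 < c & forall v, X v -> c <= sigma2 v ;
  dgp_variance_continuous : {within X, continuous sigma2} ;
  dgp_mu_continuous : {within X, continuous mu} ;
  dgp_mu_smooth : Ck_closure S X° mu ;
  dgp_smoothness : (mdeg q <= S)%N ;
  dgp_rho : 0 < rho ;
  dgp_mu_holder : exists C : R, forall alpha, mdeg alpha = S ->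
    forall u v, X u -> X v ->
    `|dlim X° alpha mu u - dlim X° alpha mu v| <= C * enorm (u - v) `^ rho }.

End data.

Record quasi_uniform (kappa : nat -> nat)
    (Delta : forall n, 'I_(kappa n) -> set pt) : Prop := QuasiUniform {
  qu_shape : exists2 c : R, 0 < c &
    forall n l, c * circumradius (Delta n l) <= inradius (Delta n l) ;
  qu_ratio : exists C : R, \forall n \near \oo,
    forall l l', diam (Delta n l) <= C * diam (Delta n l') ;
  qu_mesh : (fun n => mesh (Delta n)) @ \oo --> (0 : R) }.

Definition active (g : pt -> R) (A : set pt) : bool :=
  `[< exists2 v, A v & g v != 0 >].

Definition active_region (k : nat) (D : 'I_k -> set pt) (g : pt -> R) :
    set pt := \bigcup_(l in [set l | active g (D l)]) D l.

Definition basis_vec (k K : nat) (D : 'I_k -> set pt)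
    (p : 'I_K -> pt -> R) (alpha : mindex d) (x : pt) : 'cV[R]_K :=
  \col_k dcell D alpha (p k) x.

Record local_basis (kappa : nat -> nat)
    (Delta : forall n, 'I_(kappa n) -> set pt) (m varsigma : nat)
    (K : nat -> nat) (p : forall n, 'I_(K n) -> pt -> R) (q : mindex d) :
    Prop := LocalBasis {
  lb_smooth : forall n l k, Ck_closure varsigma.+1 (Delta n l) (p n k) ;
  (* The cells are open and disjoint: connectedness is that of the closure. *)
  lb_connected : forall n k,
    connected (closure (active_region (Delta n) (p n k))) ;
  lb_count : exists N, forall n k,
    (#|[pred l | active (p n k) (Delta n l)]| <= N)%N /\
    (#|[pred j | [exists l, active (p n k) (Delta n l) &&
                            active (p n j) (Delta n l)]]| <= N)%N ;
  lb_gram : exists2 c : R, 0 < c & \forall n \near \oo,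
    forall k (a : 'cV[R]_(K n)),
    c * (a k ord0 ^+ 2 * mesh (Delta n) ^+ d) <=
    (a^T *m (\matrix_(i, j) \int[lebesgue_rV R d]_(v in
        active_region (Delta n) (p n k)) (p n i v * p n j v)) *m a) ord0 ord0 ;
  lb_order : (mdeg q < m)%N ;
  lb_varsigma : (mdeg q <= varsigma < m)%N ;
  lb_lower : forall alpha, (mdeg alpha <= varsigma)%N ->
    exists2 c : R, 0 < c & \forall n \near \oo,
    forall l (v : pt), closure (Delta n l) v ->
    c * mesh (Delta n) ^- mdeg alpha <=
    enorm (\col_k dlim (Delta n l) alpha (p n k) v) ;
  lb_upper : forall alpha, (mdeg alpha <= varsigma.+1)%N ->
    exists C : R, \forall n \near \oo,
    forall l (v : pt), closure (Delta n l) v ->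
    enorm (\col_k dlim (Delta n l) alpha (p n k) v) <=
    C * mesh (Delta n) ^- mdeg alpha }.

Definition lead_bias (X : set pt) (mu : pt -> R) (m k : nat)
    (D : 'I_k -> set pt) (Lambda : {fset mindex d})
    (B : mindex d -> mindex d -> pt -> R) (alpha : mindex d) (x : pt) : R :=
  - \sum_(u <- Lambda) dlim X° u mu x *
      diam (cell D x) ^+ (m - mdeg alpha) * dcell D (mi0 d) (B u alpha) x.

Definition in_span (K : nat) (p : 'I_K -> pt -> R) (s : pt -> R) : Prop :=
  exists b : 'I_K -> R, s = fun v => \sum_k b k * p k v.

Record approximation_error (X : set pt) (mu : pt -> R) (S : nat) (rho : R)
    (kappa : nat -> nat) (Delta : forall n, 'I_(kappa n) -> set pt)
    (m varsigma : nat) (K : nat -> nat) (p : forall n, 'I_(K n) -> pt -> R)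
    (Lambda : nat -> {fset mindex d})
    (B : nat -> mindex d -> mindex d -> pt -> R) :
    Prop := ApproximationError {
  ae_smoothness : (m <= S)%N ;
  ae_Lambda : forall n (u : mindex d), u \in Lambda n -> mdeg u = m ;
  ae_approx : exists s : nat -> pt -> R, (forall n, in_span (p n) (s n)) /\
    forall alpha, (mdeg alpha <= varsigma)%N ->
    exists C : R, \forall n \near \oo, forall v, X v ->
    `|dlim X° alpha mu v - dcell (Delta n) alpha (s n) v +
      lead_bias X mu m (Delta n) (Lambda n) (B n) alpha v| <=
    C * mesh (Delta n) `^ (m%:R + rho - (mdeg alpha)%:R) ;
  (* B_{u,alpha} may jump across cell boundaries, as the basis may; at boundary
     points it is read, like the basis, through its limits within a cell. *)
  ae_B_continuous : forall n (u alpha : mindex d), u \in Lambda n ->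
    (mdeg alpha <= varsigma)%N -> forall l, Ck_closure 0 (Delta n l) (B n u alpha) ;
  ae_B_bounded : exists C : R, forall n (u alpha : mindex d), u \in Lambda n ->
    (mdeg alpha <= varsigma)%N -> forall l (v : pt), closure (Delta n l) v ->
    `|dlim (Delta n l) (mi0 d) (B n u alpha) v| <= C ;
  ae_B_lipschitz : exists C : R, \forall n \near \oo, forall u alpha : mindex d,
    u \in Lambda n -> (mdeg alpha <= varsigma)%N -> forall l (v1 v2 : pt),
    closure (Delta n l) v1 -> closure (Delta n l) v2 ->
    `|dlim (Delta n l) (mi0 d) (B n u alpha) v1 -
      dlim (Delta n l) (mi0 d) (B n u alpha) v2| <=
    C * (mesh (Delta n))^-1 * enorm (v1 - v2) }.

Definition emp_mean (V : lmodType R) (n : nat) (g : nat -> V) : V :=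
  n%:R^-1 *: \sum_(i < n) g i.

Section estimator.
Context (k K : nat) (D : 'I_k -> set pt) (p : 'I_K -> pt -> R).
Context (q : mindex d) (n : nat) (xs : nat -> pt).

Definition Pi0 (v : pt) : 'cV[R]_K := basis_vec D p (mi0 d) v.

(* [invmx] is total: it returns its argument when it is singular. *)
Definition gamma_hat0 (v : pt) : 'rV[R]_K :=
  (basis_vec D p q v)^T *m invmx (emp_mean n (fun i => Pi0 (xs i) *m (Pi0 (xs i))^T)).

(* gamma_hat0(v)' E_n[Pi0(x_i) g_i]; the estimator is the case g_i = y_i *)
Definition series_fit0 (v : pt) (g : nat -> R) : R :=
  (gamma_hat0 v *m emp_mean n (fun i => g i *: Pi0 (xs i))) ord0 ord0.

End estimator.

End model.

(* Main.v *)
Require Import Defs.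
From HB Require Import structures.
From mathcomp Require Import all_boot all_order all_algebra finmap.
From mathcomp Require Import all_classical all_reals all_analysis.
From mathcomp Require Import measurable_realfun ring lra.

Set Implicit Arguments.
Unset Strict Implicit.
Unset Printing Implicit Defensive.

Import Order.TTheory GRing.Theory Num.Theory numFieldNormedType.Exports.

Local Open Scope classical_set_scope.
Local Open Scope ring_scope.

(** The first assertion holds because the fit is a linear combination of the
    responses y_i whose weights are functions of the regressors. Since the pairs
    (y_i, x_i) are independent, the noise eps_i has conditional mean zero given
    all of x_0, ..., x_(n-1), and it disappears. The weights involve the inverse
    of a random matrix and need not be integrable, so the argument is carried
    out on the events where they are bounded by k, which exhaust the sample
    space as k grows ([cond_expectation_sum]).

    For the second assertion, let s be the spline that approximates mu. Least
    squares reproduces s, so the quantity to bound is the fit, at x0, of the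
    approximation error r = mu - s + bias, which is O(h^(m + rho)) at every
    regressor, minus the error of order q at x0 itself
    ([oracle_decomposition]). It remains to see that fitting r costs no more
    than the factor h^(-[q]) of the derivatives of the basis.

    Write the fit as the mean of z_i r_i, where z_i = sum_k a_k p_k(x_i) and a
    solves the normal equations G a = g with right-hand side the derivatives of
    the basis at x0. The matrix G is banded, since p_k and p_l only interact
    when they share a cell, coercive with a constant of order h^d, and g is
    supported near x0; so a decays exponentially away from x0 at the scale h.
    This decay is obtained without estimating entries of the inverse: for
    w_k = exp (theta dist (k, x0) / h) with theta small, the ratios w_l / w_k
    are close to 1 within the band, hence the equations satisfied by w_k a_k
    are a small perturbation of the original ones and remain coercive
    ([weighted_solution_bound]). Cauchy-Schwarz with these weights then bounds
    the fit by the supremum of |r| and the mean of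
    exp (- 2 theta dist (x_i, x0) / h) over the sample ([weighted_fit_bound]),
    whose expectation is O(h^d) because the density is bounded
    ([exponential_moment]). All powers of h except h^(m + rho - [q]) cancel.

    The band has bounded geometric width because a connected union of N cells
    extends over at most N mesh sizes in each coordinate
    ([active_region_extent]). The coercivity of the expected Gram matrix is the
    sum of the local lower bounds ([popgram_coercive]). It passes to the
    empirical matrix because, by an exponential inequality and a union bound
    over O(h^(-2 d)) entries, all entries deviate by at most a small multiple of
    h^d when ln n / (n h^d) tends to 0 ([mean_deviation], [basis_dimension]),
    and in a banded matrix this is also a small perturbation of the quadratic
    form ([sparse_form_bound]). *)

(** * Events generated by an i.i.d. sample *)

Section pull_out.
Context d d' (T : measurableType d) (T' : measurableType d') (R : realType).
Context (P : {measure set T -> \bar R}).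
Local Open Scope ereal_scope.
Import HBNNSimple.

Lemma pull_out_nnsfun (phi : T -> T') (z : T -> R) (g : {nnsfun T' >-> R}) :
  measurable_fun setT phi -> measurable_fun setT z -> (forall t, 0 <= z t)%R ->
  \int[P]_t (g (phi t) * z t)%:E =
  \sum_(r \in range g) r%:E * \int[P]_(t in phi @^-1` (g @^-1` [set r])) (z t)%:E.
Proof.
move=> mphi mz z0.
have mA r : measurable (phi @^-1` (g @^-1` [set r])).
  by rewrite -[X in measurable X]setTI; exact: mphi.
have mr r : measurable_fun setT
    ((EFin \o z) \_ (phi @^-1` (g @^-1` [set r]))).
  apply/(measurable_restrictT (EFin \o z) (mA r)).
  by apply/measurable_EFinP; apply: measurable_funTS.
transitivity (\int[P]_t (\sum_(r \in range g)
   (r%:E * ((EFin \o z) \_ (phi @^-1` (g @^-1` [set r]))) t))).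
  apply: eq_integral => t _.
  rewrite fimfunE mulrC mulr_fsumr -?fsumEFin//.
  apply: eq_fsbigr => r _; rewrite /patch.
  rewrite indicE; case: ifPn => tr.
    rewrite (_ : phi t \in g @^-1` [set r]); last by move: tr; rewrite !inE.
    by rewrite mulr1 mulrC EFinM.
  rewrite (_ : phi t \in g @^-1` [set r] = false) ?mulr0 ?mule0//.
  by apply/negbTE; apply: contra tr; rewrite !inE.
rewrite ge0_integral_fsum//; last 2 first.
- by move=> r; apply: measurable_funeM; exact: mr.
- move=> r t _; rewrite /patch; case: ifPn; last by rewrite mule0.
  rewrite inE /= => gr; rewrite mule_ge0// lee_fin//.
  by rewrite -gr.
apply: eq_fsbigr => r; rewrite inE => -[t _ gtr].
rewrite ge0_integralZl//; last 2 first.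
- by move=> u _; apply: erestrict_ge0 => v _ /=; rewrite lee_fin.
- by rewrite lee_fin -gtr.
by rewrite -integral_mkcond.
Qed.

(** By linearity when xi is simple, then by monotone approximation. The equal
    integrals over the events of phi say that z1 and z2 have the same
    conditional expectation given phi, so this is the rule that factors known
    given phi can be taken out, for nonnegative integrands that need not be
    integrable. *)
Lemma pull_out (phi : T -> T') (z1 z2 : T -> R) (xi : T' -> R) :
  measurable_fun setT phi -> measurable_fun setT z1 -> measurable_fun setT z2 ->
  (forall t, 0 <= z1 t)%R -> (forall t, 0 <= z2 t)%R ->
  (forall A, measurable A -> \int[P]_(t in phi @^-1` A) (z1 t)%:E =
     \int[P]_(t in phi @^-1` A) (z2 t)%:E) ->
  measurable_fun setT xi -> (forall t, 0 <= xi t)%R ->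
  \int[P]_t (xi (phi t) * z1 t)%:E = \int[P]_t (xi (phi t) * z2 t)%:E.
Proof.
move=> mphi mz1 mz2 z10 z20 z12 mxi xi0.
have mxi' : measurable_fun setT (EFin \o xi) by exact/measurable_EFinP.
pose f_ := nnsfun_approx measurableT mxi'.
have key (z : T -> R) : measurable_fun setT z -> (forall t, 0 <= z t)%R ->
    \int[P]_t (xi (phi t) * z t)%:E =
    limn (fun n => \int[P]_t (f_ n (phi t) * z t)%:E).
  move=> mz z0; rewrite -monotone_convergence//.
  - apply: eq_integral => y _; apply/esym/cvg_lim => //.
    rewrite EFinM.
    under eq_fun do rewrite EFinM.
    apply: cvgeZr => //.
    apply: (cvg_nnsfun_approx measurableT mxi') => // x _.
    by rewrite /= lee_fin.
  - move=> n; apply/measurable_EFinP; apply: measurable_funM => //.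
    by apply: measurableT_comp => //; exact: measurable_funP.
  - by move=> n x _; rewrite lee_fin mulr_ge0.
  - move=> t _ m n mn; rewrite lee_fin ler_wpM2r//.
    by exact/lefP/nd_nnsfun_approx.
rewrite (key z1)// (key z2)//; congr (limn _); apply/funext => n.
rewrite !pull_out_nnsfun//; apply: eq_fsbigr => r _; congr (_ * _).
by apply: z12.
Qed.

End pull_out.

Section dynkin.
Context d (T : measurableType d) (R : realType) (P : {measure set T -> \bar R}).
Local Open Scope ereal_scope.

(** The events over which the two integrals agree form a lambda-system:
    finiteness of the total integral allows subtraction for differences, and
    monotone convergence handles increasing unions. *)
Lemma eq_integral_sigma (G : set (set T)) (z1 z2 : T -> R) :
  setI_closed G -> G setT -> G `<=` measurable ->
  measurable_fun setT z1 -> measurable_fun setT z2 ->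
  (forall t, 0 <= z1 t)%R -> (forall t, 0 <= z2 t)%R ->
  \int[P]_t (z1 t)%:E < +oo ->
  (forall A, G A -> \int[P]_(t in A) (z1 t)%:E = \int[P]_(t in A) (z2 t)%:E) ->
  forall A, <<s G >> A ->
    measurable A /\ \int[P]_(t in A) (z1 t)%:E = \int[P]_(t in A) (z2 t)%:E.
Proof.
move=> IG GT Gm mz1 mz2 z10 z20 fin1 z12.
have mE (z : T -> R) D : measurable_fun setT z -> measurable_fun D (EFin \o z).
  by move=> mz; apply/measurable_EFinP; exact: measurable_funTS.
have E0 (z : T -> R) (D : set T) : (forall t, 0 <= z t)%R ->
    forall t, D t -> 0 <= (z t)%:E.
  by move=> z0 t _; rewrite lee_fin.
have fin A : measurable A -> \int[P]_(t in A) (z1 t)%:E < +oo.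
  move=> mA; apply: le_lt_trans fin1; apply: ge0_subset_integral => //.
  - exact: (mE z1).
  - exact: E0.
move=> A; apply: (@lambda_system_subset _ _ IG setT
  [set A | measurable A /\ \int[P]_(t in A) (z1 t)%:E = \int[P]_(t in A) (z2 t)%:E]) => //.
- split => //.
  + by split => //; exact: z12.
  + move=> B C CB [mB eB] [mC eC]; have mBC := measurableD mB mC; split => //.
    have dec (z : T -> R) : measurable_fun setT z -> (forall t, 0 <= z t)%R ->
      \int[P]_(t in B) (z t)%:E =
      \int[P]_(t in C) (z t)%:E + \int[P]_(t in B `\` C) (z t)%:E.
      move=> mz z0; rewrite -ge0_integral_setU//; last 3 first.
      * exact: (mE z).
      * exact: E0.
      * by rewrite disj_set2E; apply/eqP; rewrite setDIK.
      by rewrite setDUK.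
    have fC : \int[P]_(t in C) (z2 t)%:E \is a fin_num.
      by rewrite -eC ge0_fin_numE ?fin// integral_ge0//; exact: E0.
    rewrite -(addeK (\int[P]_(t in B `\` C) (z1 t)%:E) fC).
    rewrite -(addeK (\int[P]_(t in B `\` C) (z2 t)%:E) fC).
    congr (_ - _); rewrite addeC -{1}eC -(dec z1)// eB (dec z2)//.
    by rewrite addeC.
  + move=> F ndF HF; have mF i := (HF i).1.
    split; first exact: bigcupT_measurable.
    have cv (z : T -> R) : measurable_fun setT z -> (forall t, 0 <= z t)%R ->
      \int[P]_(t in F i) (z t)%:E @[i --> \oo] --> \int[P]_(t in \bigcup_i F i) (z t)%:E.
      move=> mz z0; apply: ge0_nondecreasing_set_cvg_integral => //.
      * by move=> i; exact: (mE z).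
      * by move=> i; exact: E0.
    have c2 := cv _ mz2 z20; move: (cv _ mz1 z10).
    under eq_fun do rewrite (HF _).2.
    move=> c1; exact: (cvg_unique _ c1 c2).
- by move=> B GB; split; [exact: Gm|exact: z12].
Qed.

End dynkin.

Section independence.
Context d (T : measurableType d) (R : realType) (P : probability T R).
Local Open Scope ereal_scope.

(** Independence says that the indicator of E and the constant P E have the
    same integral over every event of Z, so functions of Z can be taken out of
    both. *)
Lemma indep_integral d' (T' : measurableType d') (E : set T) (Z : T -> T')
    (g : T' -> R) :
  measurable E -> measurable_fun setT Z ->
  (forall B, measurable B -> P (E `&` Z @^-1` B) = P E * P (Z @^-1` B)) ->
  measurable_fun setT g -> (forall t, 0 <= g t)%R ->
  \int[P]_(t in E) (g (Z t))%:E = P E * \int[P]_t (g (Z t))%:E.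
Proof.
move=> mE mZ ind mg g0.
have PE0 : (0 <= fine (P E))%R by rewrite fine_ge0.
have mgZ : measurable_fun setT (EFin \o (g \o Z)).
  by apply/measurable_EFinP; exact: measurableT_comp.
have := @pull_out _ _ _ _ _ P Z (\1_E) (cst (fine (P E))) g mZ.
move=> /(_ _ _ _ _ _ mg g0) H.
transitivity (\int[P]_t (g (Z t) * \1_E t)%:E).
  rewrite integral_mkcond; apply: eq_integral => t _.
  rewrite /patch indicE; case: ifPn => _; first by rewrite mulr1.
  by rewrite mulr0.
rewrite H //.
- rewrite -[X in X * _](@fineK _ (P E)) ?fin_num_measure//.
  rewrite -ge0_integralZl//; last by move=> t _ /=; rewrite lee_fin.
  by apply: eq_integral => t _; rewrite mulrC EFinM.
- move=> B mB.
  have mZB : measurable (Z @^-1` B) by rewrite -[X in measurable X]setTI; exact: mZ.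
  rewrite integral_indic//; transitivity (P E * P (Z @^-1` B)); first exact: ind.
  by under [RHS]eq_integral do rewrite /= fineK ?fin_num_measure//; rewrite integral_cst.
Qed.

End independence.

Section sigma_first.
Context d (T : measurableType d) (R : realType) (P : probability T R).
Context d' (T' : measurableType d') (Z : nat -> T -> T').
Hypothesis mZ : forall i, measurable_fun setT (Z i).
Local Open Scope ereal_scope.

Definition cylinder (s : seq nat) (B : nat -> set T') : set T :=
  \bigcap_(i in [set` s]) (Z i @^-1` B i).

Lemma measurable_cylinder s B : (forall i, measurable (B i)) ->
  measurable (cylinder s B).
Proof.
move=> mB; apply: fin_bigcap_measurable => // i _.
by rewrite -[X in measurable X]setTI; exact: mZ.
Qed.

Lemma cylinder_cons i s B :
  cylinder (i :: s) B = cylinder s B `&` Z i @^-1` B i.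
Proof.
apply/seteqP; split => [t H|t [H Hi] j /=].
  split; last by apply: H => /=; rewrite inE eqxx.
  by move=> j js; apply: H => /=; rewrite inE (_ : j \in s)// orbT.
by rewrite inE => /orP[/eqP ->//|js]; exact: H.
Qed.

Lemma perm_cylinder s s' B : s =i s' -> cylinder s B = cylinder s' B.
Proof.
by move=> ss'; rewrite /cylinder; apply: eq_bigcapl; split => i /=; rewrite ss'.
Qed.

Lemma iid_cylinderI s i B C : iid P Z -> uniq (i :: s) ->
  (forall i, measurable (B i)) -> measurable C ->
  P (cylinder s B `&` Z i @^-1` C) = P (cylinder s B) * P (Z i @^-1` C).
Proof.
move=> [indep _] /= /andP[nis us] mB mC.
pose B' j := if j == i then C else B j.
have mB' j : measurable (B' j) by rewrite /B'; case: ifP.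
have -> : cylinder s B `&` Z i @^-1` C = cylinder (i :: s) B'.
  rewrite cylinder_cons /B' eqxx; congr (_ `&` _).
  apply: eq_bigcapr => j /= js; case: eqP => [ji|//].
  by move: nis; rewrite -ji js.
rewrite /cylinder indep//; last by rewrite /= nis.
rewrite indep// big_cons muleC /B' eqxx; congr (_ * _).
rewrite big_seq_cond [RHS]big_seq_cond; apply: eq_bigr => j; rewrite andbT => js.
by case: eqP => [ji|//]; move: nis; rewrite -ji js.
Qed.

Lemma sigma_first_measurable n A : sigma_first Z n A -> measurable A.
Proof.
apply: smallest_sub; first exact: sigma_algebra_measurable.
by move=> B [i _ [C mC <-]]; exact: mZ.
Qed.

(** Cylinders are stable under intersection and generate the sigma-algebra of
    the first n variables. *)
Lemma eq_integral_sigma_first n (z1 z2 : T -> R) :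
  measurable_fun setT z1 -> measurable_fun setT z2 ->
  (forall t, 0 <= z1 t)%R -> (forall t, 0 <= z2 t)%R ->
  \int[P]_t (z1 t)%:E < +oo ->
  (forall B, (forall i, measurable (B i)) ->
     \int[P]_(t in cylinder (iota 0 n) B) (z1 t)%:E =
     \int[P]_(t in cylinder (iota 0 n) B) (z2 t)%:E) ->
  forall A, sigma_first Z n A ->
    \int[P]_(t in A) (z1 t)%:E = \int[P]_(t in A) (z2 t)%:E.
Proof.
move=> mz1 mz2 z10 z20 fin1 z12 A GA.
pose G := [set A | exists2 B, (forall i, measurable (B i)) &
   A = cylinder (iota 0 n) B].
have IG : setI_closed G.
  move=> _ _ [B mB ->] [C mC ->]; exists (fun i => B i `&` C i).
    by move=> i; exact: measurableI.
  apply/seteqP; split => [t [H1 H2] i hi|t H].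
    by split; [exact: H1|exact: H2].
  by split => i hi; have [] := H i hi.
have GT : G setT.
  by exists (fun=> setT) => //; apply/seteqP; split => // t _ i _.
have Gm : G `<=` measurable by move=> _ [B mB ->]; exact: measurable_cylinder.
have G12 B : G B -> \int[P]_(t in B) (z1 t)%:E = \int[P]_(t in B) (z2 t)%:E.
  by move=> [C mC ->]; exact: z12.
apply: (eq_integral_sigma IG GT Gm mz1 mz2 z10 z20 fin1 G12 _).2.
move: A GA; apply: sub_smallest2r => [|B [i /= ni [C mC <-]]]; first exact: smallest_sigma_algebra.
exists (fun j => if j == i then C else setT) => [j|]; first by case: ifP.
rewrite setTI; apply/seteqP; split => [t Ct j jn /=|t /(_ i)/=].
  by case: eqP => [->|].
by rewrite eqxx mem_iota /= add0n; exact.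
Qed.

End sigma_first.

Section product_expectation.
Context d (T : measurableType d) (R : realType) (P : probability T R).
Context d' (T' : measurableType d') (Z : nat -> T -> T').
Hypothesis mZ : forall i, measurable_fun setT (Z i).

(** The sample space with the sigma-algebra generated by the first n variables:
    a measurable function on this type is one that depends on the sample
    through these variables only. *)
Definition firstType (n : nat) :=
  g_sigma_algebraType (\bigcup_(i in `I_n) sigma_of (Z i)).

Lemma measurable_firstType n i : (i < n)%N ->
  measurable_fun setT (Z i : firstType n -> T').
Proof.
move=> ni _ A mA; rewrite setTI; apply: sub_sigma_algebra; exists i => //.
by exists A => //; rewrite setTI.
Qed.

Lemma measurable_id_firstType n : measurable_fun setT (id : T -> firstType n).
Proof. by move=> _ A mA; rewrite setTI; exact: (sigma_first_measurable mZ mA). Qed.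

Hypothesis iidZ : iid P Z.
Local Open Scope ereal_scope.

Lemma iid_integral (psi : T' -> R) i j :
  measurable_fun setT psi -> (forall t, 0 <= psi t)%R ->
  \int[P]_t (psi (Z i t))%:E = \int[P]_t (psi (Z j t))%:E.
Proof.
move=> mpsi psi0.
have push k : \int[P]_t (psi (Z k t))%:E =
    \int[pushforward P (Z k)]_u (psi u)%:E.
  rewrite ge0_integral_pushforward//; first exact/measurable_EFinP.
  by move=> u _; rewrite lee_fin.
rewrite !push; apply: eq_measure_integral => A mA _.
exact: (iidZ.2 i j A mA).
Qed.

(** In the product over n + 1 variables, the last factor can be replaced by its
    mean because it has the same integral as that mean over all events of the
    first n variables. *)
Lemma expectation_prod (psi : T' -> R) c n :
  measurable_fun setT psi -> (forall t, 0 <= psi t)%R ->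
  \int[P]_t (psi (Z 0%N t))%:E = c%:E ->
  \int[P]_t (\prod_(i < n) psi (Z i t))%:E = (c ^+ n)%:E.
Proof.
move=> mpsi psi0 Ec.
have c0 : (0 <= c)%R by rewrite -lee_fin -Ec integral_ge0// => t _; rewrite lee_fin.
have mpsiZ i : measurable_fun setT (fun t => psi (Z i t)) by exact: measurableT_comp.
elim: n => [|n IH].
  rewrite expr0; under eq_integral do rewrite big_ord0.
  rewrite (integral_cst P measurableT 1) mul1e; exact: probability_setT.
pose xi (t : firstType n) := (\prod_(i < n) psi (Z i t))%R.
have mxi : measurable_fun setT xi.
  apply: measurable_prod => i _.
  by apply: measurableT_comp => //; exact: measurable_firstType.
have xi0 t : (0 <= xi t)%R by apply: prodr_ge0 => i _; exact: psi0.
have fin0 : \int[P]_t (psi (Z n t))%:E < +oo.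
  by rewrite (iid_integral n 0)// Ec ltry.
have key : \int[P]_t (xi t * psi (Z n t))%:E = \int[P]_t (xi t * c)%:E.
  apply: (pull_out (phi := (id : T -> firstType n)) (z1 := fun t => psi (Z n t)) (z2 := cst c)) => //.
    exact: measurable_id_firstType.
  move=> A mA; apply: (eq_integral_sigma_first mZ (n := n)) => // B mB.
  have mC := measurable_cylinder mZ (iota 0 n) mB.
  rewrite (@indep_integral _ _ _ P _ _ _ (Z n) psi)//; last first.
    move=> C mC'; apply: iid_cylinderI => //=.
    by rewrite iota_uniq mem_iota /= add0n ltnn.
  by rewrite (iid_integral n 0)// Ec muleC -(integral_cst P mC c%:E).
under eq_integral do rewrite big_ord_recr/=.
rewrite key; under eq_integral do rewrite mulrC EFinM.
rewrite ge0_integralZl//; last 2 first.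
- apply/measurable_EFinP; apply: measurable_prod => i _; exact: mpsiZ.
- by move=> t _; rewrite lee_fin.
by rewrite exprS EFinM; congr (_ * _).
Qed.

End product_expectation.

(** * Exponential inequality *)

(** From (1 - u) exp u <= 1 and 1 / (1 - u) <= 1 + u + 2 u^2, valid for |u| <=
    1/2. *)
Lemma expR_le_quadratic (R : realType) (u : R) :
  `|u| <= 2^-1 -> expR u <= 1 + u + 2 * u ^+ 2.
Proof.
rewrite ler_norml => /andP[u1 u2].
have h : 0 < 1 - u by lra.
have := expR_ge1Dx (- u); rewrite expRN => H.
have e0 := expR_gt0 u.
have : (1 - u) * expR u <= 1 by rewrite -ler_pdivlMr// mul1r.
rewrite mulrC -ler_pdivlMr// mul1r => /le_trans; apply.
rewrite -[X in X <= _]mul1r ler_pdivrMr//.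
have : 0 <= u ^+ 2 * (1 - 2 * u) by apply: mulr_ge0; [exact: sqr_ge0|lra].
rewrite (_ : (1 + u + 2 * u ^+ 2) * (1 - u) = 1 + u ^+ 2 * (1 - 2 * u)); last by ring.
lra.
Qed.

Section bernstein.
Context d (T : measurableType d) (R : realType) (P : probability T R).

Lemma markov_nonneg (g : T -> R) (a : R) :
  measurable_fun setT g -> (forall t, 0 <= g t) -> 0 <= a ->
  (a%:E * P [set t | (a <= g t)%R] <= \int[P]_t (g t)%:E)%E.
Proof.
move=> mg g0 a0.
have mA : measurable [set t | a <= g t].
  rewrite -[X in measurable X]setTI.
  exact: (measurable_fun_le measurableT (measurable_cst a) mg).
rewrite -(integral_cst P mA a%:E).
apply: (@le_trans _ _ (\int[P]_(t in [set t | (a <= g t)%R]) (g t)%:E)%E).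
  apply: ge0_le_integral => //.
  apply/measurable_EFinP; exact: measurable_funTS.
apply: ge0_subset_integral => //; first exact/measurable_EFinP.
by move=> t _; rewrite lee_fin.
Qed.

Lemma integrable_bounded (f : T -> R) (M : R) : measurable_fun setT f ->
  (forall t, `|f t| <= M) -> P.-integrable setT (EFin \o f).
Proof.
move=> mf fM; apply: measurable_bounded_integrable => //.
- by apply: le_lt_trans (ltry 1); rewrite probability_le1.
- exists M; split; first by rewrite num_real.
  by move=> x Mx t _; exact: le_trans (fM t) (ltW Mx).
Qed.

Context d' (T' : measurableType d') (Z : nat -> T -> T').
Hypothesis mZ : forall i, measurable_fun setT (Z i).
Hypothesis iidZ : iid P Z.

(** Markov's inequality for exp (s (phi Z_0 + ... + phi Z_(n-1))), whose mean
    is the n-th power of E exp (s phi) <= exp (s E phi + 2 s^2 E phi^2). The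
    exponent involves the second moment v of phi rather than its bound M; this
    matters for products of basis functions, whose second moment is of the
    order h^d of the volume of a cell. The scale s is left to the caller. *)
Lemma bernstein (phi : T' -> R) (M v s tau : R) (n : nat) :
  measurable_fun setT phi -> (forall u, `|phi u| <= M) ->
  \int[P]_t (phi (Z 0%N t) ^+ 2) <= v -> 0 <= s -> s * M <= 2^-1 ->
  (P [set t | (n%:R * (\int[P]_u phi (Z 0%N u) + tau) <= \sum_(i < n) phi (Z i t))%R]
   <= (expR (- (n%:R * (s * tau - 2 * s ^+ 2 * v))))%:E)%E.
Proof.
move=> mphi phiM hv s0 sM.
set e := \int[P]_u phi (Z 0%N u).
pose psi u := expR (s * phi u).
have mpsi : measurable_fun setT psi.
  by apply: measurableT_comp => //; exact: measurable_funM.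
have psi0 u : 0 <= psi u by exact: expR_ge0.
have mphiZ : measurable_fun setT (fun t => phi (Z 0%N t)) by exact: measurableT_comp.
have sphi u : `|s * phi u| <= 2^-1.
  by rewrite normrM (ger0_norm s0) (le_trans _ sM)// ler_wpM2l.
have i1 := integrable_bounded mphiZ (fun t => phiM (Z 0%N t)).
have i2 : P.-integrable setT (EFin \o (fun t => phi (Z 0%N t) ^+ 2)).
  apply: (@integrable_bounded _ (M ^+ 2)); first exact: measurable_funX.
  move=> t; rewrite normrX ler_sqr ?nnegrE//.
  exact: le_trans (normr_ge0 _) (phiM (Z 0%N t)).
have mpsiZ : measurable_fun setT (fun t => psi (Z 0%N t)) by exact: measurableT_comp.
have i3 : P.-integrable setT (EFin \o (fun t => psi (Z 0%N t))).
  apply: (@integrable_bounded _ (expR 2^-1)) => // t.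
  rewrite ger0_norm// ler_expR.
  exact: le_trans (ler_norm _) (sphi (Z 0%N t)).
pose c := \int[P]_t psi (Z 0%N t).
have Ec : (\int[P]_t (psi (Z 0%N t))%:E = c%:E)%E.
  rewrite /c /Rintegral fineK//; exact: (integrable_fin_num measurableT i3).
have c0 : 0 <= c by apply: Rintegral_ge0 => t _; exact: psi0.
have i6 : P.-integrable setT (EFin \o (fun t => s * phi (Z 0%N t))).
  exact: (integrableZl measurableT s i1).
have i7 : P.-integrable setT
    (EFin \o (fun t => 2 * s ^+ 2 * phi (Z 0%N t) ^+ 2)).
  exact: (integrableZl measurableT (2 * s ^+ 2) i2).
have i4 := integrableD measurableT i6 i7.
have i5 : P.-integrable setT (EFin \o (cst 1)).
  exact: finite_measure_integrable_cst.
have c_le : c <= expR (s * e + 2 * s ^+ 2 * v).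
  apply: le_trans (expR_ge1Dx _).
  apply: (@le_trans _ _ (\int[P]_t
      (1 + (s * phi (Z 0%N t) + 2 * s ^+ 2 * phi (Z 0%N t) ^+ 2)))).
    apply: le_Rintegral => //; first exact: (integrableD measurableT i5 i4).
    move=> t _; rewrite /psi; apply: le_trans (expR_le_quadratic (sphi _)) _.
    by rewrite exprMn -!addrA mulrA.
  rewrite RintegralD// Rintegral_cst// RintegralD// !RintegralZl// -/e.
  rewrite mul1r lerD//.
    by have -> : fine (P setT) = 1 by have -> := @probability_setT _ _ _ P.
  rewrite lerD2l ler_wpM2l//; rewrite mulr_ge0//; exact: sqr_ge0.
have msum : measurable_fun setT (fun t => \prod_(i < n) psi (Z i t)).
  by apply: measurable_prod => i _; exact: measurableT_comp.
have prod0 t : 0 <= \prod_(i < n) psi (Z i t) by apply: prodr_ge0 => i _.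
pose K := expR (s * (n%:R * (e + tau))).
have K0 : 0 < K by exact: expR_gt0.
have := markov_nonneg msum prod0 (ltW K0).
rewrite (expectation_prod mZ iidZ n mpsi psi0 Ec) => H.
have prodE t : \prod_(i < n) psi (Z i t) = expR (s * \sum_(i < n) phi (Z i t)).
  by rewrite mulr_sumr expR_sum.
set A := [set t | _]; set A' := [set t | _] in H.
have AA' : A `<=` A'.
  by move=> t; rewrite /A /A' /= prodE /K ler_expR; exact: ler_wpM2l.
have mA' : measurable A'.
  rewrite -[X in measurable X]setTI.
  exact: (measurable_fun_le measurableT (measurable_cst K) msum).
have mA : measurable A.
  rewrite -[X in measurable X]setTI.
  apply: (measurable_fun_le measurableT (measurable_cst _)) => //.
  by apply: measurable_sum => i; exact: measurableT_comp.
have : (P A <= P A')%E by apply: le_measure => //; rewrite inE.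
move=> /le_trans; apply.
have -> : expR (- (n%:R * (s * tau - 2 * s ^+ 2 * v))) =
    K^-1 * expR (s * e + 2 * s ^+ 2 * v) ^+ n.
  rewrite -expRM_natl /K -expRN -expRD; congr expR; ring.
rewrite EFinM lee_pdivlMl//.
apply: le_trans H _; rewrite lee_fin lerXn2r// nnegrE//; exact: expR_ge0.
Qed.

End bernstein.

(** * Conditional mean of a linear smoother *)

Section posneg.
Context d (T : measurableType d) (R : realType) (P : {measure set T -> \bar R}).
Local Open Scope ereal_scope.

(** Turns a vanishing signed integral into an equality between integrals of
    nonnegative functions, the form in which factors can be taken out and
    generators extended. *)
Lemma integral_eq0_posneg (f : T -> R) (A : set T) : measurable A ->
  P.-integrable A (EFin \o f) ->
  (\int[P]_(t in A) (f t)%:E = 0) <->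
  \int[P]_(t in A) (f^\+%R t)%:E = \int[P]_(t in A) (f^\-%R t)%:E.
Proof.
move=> mA fA.
have fp : P.-integrable A (EFin \o (f^\+)%R) by exact: integrable_funrpos.
have fn : P.-integrable A (EFin \o (f^\-)%R) by exact: integrable_funrneg.
have -> : \int[P]_(t in A) (f t)%:E =
    \int[P]_(t in A) (f^\+%R t)%:E - \int[P]_(t in A) (f^\-%R t)%:E.
  rewrite -integralB_EFin//; apply: eq_integral => t _.
  by rewrite -EFinB -[in LHS](funrposBneg f).
have finn : \int[P]_(t in A) (f^\-%R t)%:E \is a fin_num.
  exact: (integrable_fin_num mA fn).
have finp : \int[P]_(t in A) (f^\+%R t)%:E \is a fin_num.
  exact: (integrable_fin_num mA fp).
split=> [/eqP|->]; last by rewrite subee.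
by rewrite sube_eq ?add0e ?fin_num_adde_defl// => /eqP.
Qed.

End posneg.

Section conditional_mean.
Context d (T : measurableType d) (R : realType) (P : probability T R).
Context d' (T' : measurableType d') (x : nat -> T -> T').
Hypothesis mx : forall i, measurable_fun setT (x i).

Lemma measurable_fun_firstType n (f : firstType x n -> R) :
  measurable_fun setT f -> measurable_fun setT (f : T -> R).
Proof.
move=> mf _ Y mY; rewrite setTI.
apply: (@sigma_first_measurable _ T _ _ x mx n); rewrite -[X in _ X]setTI.
exact: mf.
Qed.

Variables (y eps : nat -> T -> R) (mu : T' -> R).
Hypothesis my : forall i, measurable_fun setT (y i).
Hypothesis meps : forall i, measurable_fun setT (eps i).
Hypothesis mmu : measurable_fun setT mu.
Hypothesis model : forall i t, y i t = mu (x i t) + eps i t.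
Hypothesis iidyx : iid P (fun i t => (y i t, x i t)).
Hypothesis eps_mean : forall i, cond_expectation P (sigma_of (x i)) (eps i) (cst 0).
Hypothesis ieps : forall i, P.-integrable setT (EFin \o eps i).

Let mpair i : measurable_fun setT (fun t => (y i t, x i t)).
Proof. exact: measurable_fun_pair. Qed.

Let epsp i : T -> R := (eps i)^\+.
Let epsn i : T -> R := (eps i)^\-.

Let mepsp i : measurable_fun setT (epsp i).
Proof. exact: measurable_funrpos. Qed.
Let mepsn i : measurable_fun setT (epsn i).
Proof. exact: measurable_funrneg. Qed.
Let epsp0 i t : 0 <= epsp i t. Proof. exact: funrpos_ge0. Qed.
Let epsn0 i t : 0 <= epsn i t. Proof. exact: funrneg_ge0. Qed.
Let iepsp i : P.-integrable setT (EFin \o epsp i).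
Proof. exact: integrable_funrpos. Qed.
Let iepsn i : P.-integrable setT (EFin \o epsn i).
Proof. exact: integrable_funrneg. Qed.

Let eps_pos_neg i B : measurable B ->
  (\int[P]_(t in x i @^-1` B) (epsp i t)%:E =
   \int[P]_(t in x i @^-1` B) (epsn i t)%:E)%E.
Proof.
move=> mB; have mA : measurable (x i @^-1` B).
  by rewrite -[X in measurable X]setTI; exact: mx.
have [_ _ H] := eps_mean i.
have GA : sigma_of (x i) (x i @^-1` B) by exists B => //; rewrite setTI.
have iA : P.-integrable (x i @^-1` B) (EFin \o eps i).
  exact: (integrableS measurableT mA _ (ieps i)).
have [_] := H _ GA iA.
rewrite [RHS]integral0_eq// => /(integral_eq0_posneg mA iA).
exact.
Qed.

(** The noise eps i is a function of the pair (y i, x i), hence independent of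
    the other regressors: what holds on the events of x i extends to the
    cylinders in the first n regressors, and from these to the sigma-algebra
    that they generate. *)
Let eps_pos_neg_first n i A : (i < n)%N -> sigma_first x n A ->
  (\int[P]_(t in A) (epsp i t)%:E = \int[P]_(t in A) (epsn i t)%:E)%E.
Proof.
move=> ni; apply: eq_integral_sigma_first => //.
  by have /integrableP[_] := iepsp i; under eq_integral do rewrite /= ger0_norm//.
move=> B mB.
pose s' := rem i (iota 0 n).
have us : uniq (i :: s').
  by rewrite /= mem_rem_uniqF ?iota_uniq//= rem_uniq// iota_uniq.
have -> : cylinder x (iota 0 n) B = cylinder x s' B `&` x i @^-1` B i.
  rewrite -cylinder_cons; apply: perm_cylinder.
  by apply/perm_mem/perm_to_rem; rewrite mem_iota add0n.
pose Z i t := (y i t, x i t).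
pose B' i := [set: R] `*` B i.
have mB' j : measurable (B' j) by exact: measurableX.
have cylE : cylinder x s' B = cylinder Z s' B'.
  by apply: eq_bigcapr => j _; rewrite /B' /=; apply/seteqP; split=> [t|t []].
have mZ j : measurable_fun setT (Z j) by exact: mpair.
have mCyl : measurable (cylinder x s' B) by exact: measurable_cylinder.
have mxB : measurable (x i @^-1` B i).
  by rewrite -[X in measurable X]setTI; exact: mx.
have key (h : R -> R) : measurable_fun setT h -> (forall u, 0 <= h u) ->
   (\int[P]_(t in cylinder x s' B `&` x i @^-1` B i) (h (eps i t))%:E =
   P (cylinder x s' B) * \int[P]_(t in x i @^-1` B i) (h (eps i t))%:E)%E.
  move=> mh h0.
  pose g (u : R * T') := h (u.1 - mu u.2) * \1_(B i) u.2.
  have gE t : g (Z i t) = h (eps i t) * \1_(x i @^-1` B i) t.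
    by rewrite /g /Z /= model [mu _ + _]addrC addrK.
  have mg : measurable_fun setT g.
    apply: measurable_funM; apply: measurableT_comp => //.
    by apply: measurable_funB => //; exact: measurableT_comp.
  have := @indep_integral _ _ _ P _ _ (cylinder x s' B) (Z i) g mCyl (mZ i).
  rewrite cylE => H; rewrite setIC integral_mkcondl -cylE.
  have rE (D : set T) : (\int[P]_(t in D) (g (Z i t))%:E =
      \int[P]_(t in D) (((fun t => (h (eps i t))%:E) \_ (x i @^-1` B i)) t))%E.
    apply: eq_integral => t _; rewrite gE /patch indicE.
    by case: ifPn; rewrite ?mulr1 ?mulr0.
  rewrite -rE cylE H//.
  - by rewrite rE -integral_mkcond.
  - by move=> C mC; apply: iid_cylinderI.
  - by move=> u; rewrite mulr_ge0// indicE.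
rewrite (key (fun u => Num.max u 0))//; last 2 first.
- exact: measurable_maxr.
- by move=> u; rewrite le_max lexx orbT.
rewrite (key (fun u => Num.max (- u) 0))//; last 2 first.
- exact: measurable_maxr.
- by move=> u; rewrite le_max lexx orbT.
congr (_ * _)%E; exact: (eps_pos_neg i (mB i)).
Qed.

(** For a nonnegative multiplier, take it out of the integrals of the positive
    and of the negative part of the noise; a bounded one becomes nonnegative
    after adding its bound. *)
Lemma integral_bounded_eps n i (xi : firstType x n -> R) M : (i < n)%N ->
  measurable_fun setT xi -> (forall t, `|xi t| <= M) ->
  P.-integrable setT (EFin \o (fun t => xi t * eps i t)) /\
  (\int[P]_t (xi t * eps i t)%:E = 0)%E.
Proof.
move=> ni mxi xiM.
have mxiT := measurable_fun_firstType mxi.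
have ibound (z : T -> R) (w : T -> R) K : P.-integrable setT (EFin \o z) ->
    measurable_fun setT w -> (forall t, `|w t| <= K) ->
    P.-integrable setT (EFin \o (fun t => w t * z t)).
  move=> iz mw wK.
  have mz : measurable_fun setT z.
    by apply/measurable_EFinP; exact: (measurable_int _ iz).
  apply: (le_integrable measurableT _ _ (integrableZl measurableT K iz)).
    by apply/measurable_EFinP; exact: measurable_funM.
  move=> t _; rewrite /= lee_fin !normrM ler_wpM2r//.
  exact: le_trans (wK t) (ler_norm _).
split; first exact: (ibound _ _ M).
have nonneg (w : firstType x n -> R) K : measurable_fun setT w ->
    (forall t, 0 <= w t <= K) -> (\int[P]_t (w t * eps i t)%:E = 0)%E.
  move=> mw w0K.
  have mwT := measurable_fun_firstType mw.
  have wK t : `|w t| <= K by have /andP[w0 ?] := w0K t; rewrite ger0_norm.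
  have : (\int[P]_t (w t * epsp i t)%:E = \int[P]_t (w t * epsn i t)%:E)%E.
    apply: (pull_out (phi := (id : T -> firstType x n))) => //.
    - exact: measurable_id_firstType.
    - by move=> A mA; apply: (eps_pos_neg_first ni).
    - by move=> t; have /andP[] := w0K t.
  move=> H.
  transitivity (\int[P]_t ((w t * epsp i t)%:E - (w t * epsn i t)%:E))%E.
    apply: eq_integral => t _; rewrite -EFinB -mulrBr.
    by rewrite -[in LHS](funrposBneg (eps i)).
  have ip := ibound _ _ K (iepsp i) mwT wK.
  have in_ := ibound _ _ K (iepsn i) mwT wK.
  rewrite integralB_EFin// H subee//.
  exact: (integrable_fin_num measurableT in_).
have M0 : 0 <= M by exact: le_trans (normr_ge0 _) (xiM point).
have e1 := nonneg (fun t => xi t + M) (M + M).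
have e2 := nonneg (cst M) M.
transitivity (\int[P]_t (((xi t + M) * eps i t)%:E - (M * eps i t)%:E))%E.
  by apply: eq_integral => t _; rewrite -EFinB mulrDl addrK.
rewrite integralB_EFin//.
- rewrite e1 ?e2 ?sube0//.
  + by move=> t; rewrite M0 lexx.
  + exact: measurable_funD.
  + move=> t; have := xiM t; rewrite ler_norml => /andP[h1 h2].
    by rewrite -lerBlDr sub0r h1 lerD2r.
- apply: (ibound _ _ (M + M)) => //; first exact: measurable_funD.
  move=> t; apply: le_trans (ler_normD _ _) _.
  by rewrite lerD// ger0_norm.
- exact: (integrableZl measurableT M (ieps i)).
Qed.

(** The weights c i need not be integrable. On the events F k, where the
    weights and the candidate W are bounded by k, the noise integrates to zero
    against every bounded multiplier. An arbitrary event A is exhausted by the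
    A `&` F k; the passage to the limit requires W to be integrable over A as
    soon as Z is, which holds because the integral of |W| = s W, with s the
    sign of W, is that of s Z over each A `&` F k. *)
Lemma cond_expectation_sum n (c : nat -> firstType x n -> R) :
  (forall i, measurable_fun setT (c i)) ->
  cond_expectation P (sigma_first x n)
    (fun t => \sum_(i < n) c i t * y i t)
    (fun t => \sum_(i < n) c i t * mu (x i t)).
Proof.
move=> mc; set Z : T -> R := fun t => _; set W : firstType x n -> R := fun t => _.
have mW : measurable_fun setT W.
  apply: measurable_sum => i; apply: measurable_funM => //.
  by apply: measurableT_comp => //; exact: measurable_firstType.
pose N (t : T) : R := \sum_(i < n) c i t * eps i t.
have ZE t : Z t = W t + N t.
  rewrite /Z /W /N -big_split; apply: eq_bigr => i _ /=.
  by rewrite -mulrDr model.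
pose D (t : firstType x n) := `|W t| + \sum_(i < n) `|c i t|.
have mD : measurable_fun setT D.
  apply: measurable_funD; first exact: measurableT_comp.
  by apply: measurable_sum => i; exact: measurableT_comp.
have mWT := measurable_fun_firstType mW.
have mDT := measurable_fun_firstType mD.
have mcT i := measurable_fun_firstType (mc i).
have mN : measurable_fun setT N.
  by apply: measurable_sum => i; exact: measurable_funM.
have mZT : measurable_fun setT Z.
  by apply: measurable_sum => i; exact: measurable_funM.
have WD t : `|W t| <= D t by rewrite /D lerDl; apply: sumr_ge0.
have cD i t : (i < n)%N -> `|c i t| <= D t.
  move=> ni; rewrite /D (bigD1 (Ordinal ni))//= addrCA lerDl addr_ge0//.
  exact: sumr_ge0.
pose F (k : nat) : set (firstType x n) := [set t | D t <= k%:R].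
have mF k : measurable (F k).
  rewrite -[X in measurable X]setTI.
  exact: (measurable_fun_le measurableT mD (measurable_cst _)).
have sfm A : sigma_first x n A -> (measurable : set (set T)) A.
  exact: (sigma_first_measurable mx).
have mFT k := sfm _ (mF k).
have FT : \bigcup_k F k = setT.
  apply/seteqP; split => // t _.
  exists (Num.truncn (D t)).+1 => //; rewrite /F /=.
  by apply/ltW; exact: truncnS_gt.
have ndF : nondecreasing_seq F.
  move=> i j ij; rewrite subsetEset => t; rewrite /F /= => /le_trans; apply.
  by rewrite ler_nat.
(* bounded measurable multipliers supported in F k annihilate the noise *)
have ann k (w : firstType x n -> R) : measurable_fun setT w ->
    (forall t, `|w t| <= \1_(F k) t) ->
    P.-integrable setT (EFin \o (fun t : T => w t * N t)) /\
    (\int[P]_t (w t * N t)%:E = 0)%E.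
  move=> mw wF.
  have ci i : (i < n)%N ->
      P.-integrable setT (EFin \o (fun t : T => (w t * c i t) * eps i t)) /\
      (\int[P]_t ((w t * c i t) * eps i t)%:E = 0)%E.
    move=> ni; apply: (@integral_bounded_eps n i (fun t => w t * c i t) k%:R ni).
      exact: measurable_funM.
    move=> t; rewrite normrM; have := wF t; rewrite indicE.
    case: (boolP (t \in F k)) => [|_]; last first.
      by rewrite normr_le0 => /eqP ->; rewrite normr0 mul0r.
    rewrite inE => Ft w1; rewrite -[leRHS]mul1r ler_pM//.
    exact: le_trans (cD i t ni) Ft.
  have E (t : T) : (w t * N t)%:E =
      (\sum_(i < n) (EFin \o (fun t : T => (w t * c i t) * eps i t)%R) t)%E.
    have /= -> := sumEFin (index_enum 'I_n) xpredT
      (fun i => w t * c i t * eps i t).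
    congr EFin; rewrite mulr_sumr.
    by apply: eq_bigr => i _; rewrite mulrA.
  have -> : EFin \o (fun t : T => w t * N t) =
      (fun t : T => \sum_(i < n) (EFin \o (fun t : T => (w t * c i t) * eps i t)%R) t)%E.
    by apply/funext => t /=; rewrite E.
  split.
    by apply: integrable_sum => // i _; apply: (ci i (ltn_ord i)).1.
  under eq_integral do rewrite E.
  rewrite integral_sum//; last first.
    by move=> i; exact: (ci i (ltn_ord i)).1.
  by rewrite big1// => i _; exact: (ci i (ltn_ord i)).2.
have NF k A : sigma_first x n A -> P.-integrable (A `&` F k) (EFin \o N) /\
    forall s : firstType x n -> R, measurable_fun setT s -> (forall t, `|s t| <= 1) ->
    P.-integrable (A `&` F k) (EFin \o (fun t : T => s t * N t)) /\
    (\int[P]_(t in A `&` F k) (s t * N t)%:E = 0)%E.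
  move=> GA.
  have mAF : measurable (A `&` F k : set (firstType x n)) by exact: measurableI.
  have mAFT := sfm _ mAF.
  have main s : measurable_fun setT (s : firstType x n -> R) ->
    (forall t, `|s t| <= 1) ->
    P.-integrable (A `&` F k) (EFin \o (fun t : T => s t * N t)) /\
    (\int[P]_(t in A `&` F k) (s t * N t)%:E = 0)%E.
    move=> ms s1.
    have E : (fun t : T => (\1_(A `&` F k) t * s t) * N t)%R =
        (fun t : T => s t * N t) \_ (A `&` F k).
      apply/funext => t; rewrite /patch indicE; case: ifPn => _.
        by rewrite mul1r.
      by rewrite !mul0r.
    have [] := ann k (fun t => \1_(A `&` F k) t * s t).
    - by apply: measurable_funM => //; exact: measurable_indic.
    - move=> t; rewrite normrM -[leRHS]mulr1 ler_pM//.
      rewrite !indicE normr_nat ler_nat.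
      case: (boolP (t \in A `&` F k)) => //; rewrite inE => -[_ Ft].
      by rewrite mem_set.
    - rewrite E => h1 h2; split.
        apply/(integrable_mkcond _ mAFT).
        apply: eq_integrable h1 => // t _.
        by rewrite /= /patch; case: ifPn.
      rewrite integral_mkcond -[RHS]h2; apply: eq_integral => t _.
      have := congr1 (fun f => f t) E => /= ->.
      by rewrite /patch; case: ifPn.
  split => //.
  have [] := main (cst 1) (measurable_cst _) _.
    by move=> t; rewrite normr1.
  by move=> h _; apply: eq_integrable h => // t _ /=; rewrite mul1r.
split.
- by move=> A mA; have := mW measurableT _ mA; rewrite setTI.
- exists F; split => // k; have [iN _] := NF k setT (@measurableT _ (firstType x n)).
  rewrite setTI in iN.
  have iW : P.-integrable (F k) (EFin \o W).
    apply: (le_integrable (mFT k) _ _ (finite_measure_integrable_cst P (k%:R : R) (mFT k))).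
      by apply/measurable_EFinP; exact: measurable_funTS.
    move=> t Ft; rewrite /= lee_fin (ger0_norm (ler0n _ k)); exact: le_trans (WD t) Ft.
  by apply: eq_integrable (integrableD (mFT k) iW iN) => // t _; rewrite /= ZE.
- move=> A GA iZ; have mA := sfm _ GA.
  have mAF k : measurable (A `&` F k : set T) by exact: measurableI.
  have AFT : \bigcup_k (A `&` F k) = A by rewrite -setI_bigcupr FT setIT.
  have ndAF : nondecreasing_seq (fun k => A `&` F k).
    by move=> i j ij; rewrite subsetEset; apply: setIS; rewrite -subsetEset; exact: ndF.
  have lim_le (g : T -> R) (b : \bar R) : measurable_fun setT g ->
      (forall t, 0 <= g t) ->
      (forall k, \int[P]_(t in A `&` F k) (g t)%:E <= b)%E ->
      (\int[P]_(t in A) (g t)%:E <= b)%E.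
    move=> mg g0 gb.
    have cv : (\int[P]_(t in A `&` F k) (g t)%:E @[k --> \oo] -->
        \int[P]_(t in \bigcup_k (A `&` F k)) (g t)%:E)%E.
      apply: ge0_nondecreasing_set_cvg_integral => //.
      - by move=> k; apply/measurable_EFinP; exact: measurable_funTS.
      - by move=> k t _; rewrite lee_fin.
    rewrite -AFT -(cvg_lim _ cv)//; apply: lime_le; first by apply/cvg_ex; eexists; exact: cv.
    by apply: nearW => k; exact: gb.
  pose s (t : firstType x n) : R := 2 * \1_[set u | 0 <= W u] t - 1.
  have ms : measurable_fun setT s.
    apply: measurable_funB => //; apply: measurable_funM => //.
    apply: measurable_indic; rewrite -[X in measurable X]setTI.
    exact: (measurable_fun_le measurableT (measurable_cst _) mW).
  have sW t : s t * W t = `|W t| /\ `|s t| = 1.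
    rewrite /s indicE; have [W0|W0] := leP 0 (W t).
      rewrite mem_set//= mulr1 (_ : 2 - 1 = 1 :> R); last by ring.
      by rewrite mul1r ger0_norm// normr1.
    rewrite memNset/=; last by apply/negP; rewrite -ltNge.
    by rewrite mulr0 sub0r mulN1r normrN1 ltr0_norm.
  have iZk k : P.-integrable (A `&` F k) (EFin \o Z).
    exact: (integrableS mA (mAF k) (@subIsetl _ _ _) iZ).
  have msT := measurable_fun_firstType ms.
  have isZ k : P.-integrable (A `&` F k) (EFin \o (fun t : T => s t * Z t)).
    apply: (le_integrable (mAF k) _ _ (iZk k)).
      apply/measurable_EFinP; apply: measurable_funTS; exact: measurable_funM.
    by move=> t _; rewrite /= lee_fin normrM (sW t).2 mul1r.
  have Wle : (\int[P]_(t in A) `|W t|%:E <= \int[P]_(t in A) `|Z t|%:E)%E.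
    apply: lim_le => // [|k]; first exact: measurableT_comp.
    have [isN sN0] := (NF k A GA).2 s ms (fun t => eq_ind_r (fun r => r <= 1) (lexx 1) (sW t).2).
    have -> : (\int[P]_(t in A `&` F k) `|W t|%:E =
        \int[P]_(t in A `&` F k) ((s t * Z t)%:E - (s t * N t)%:E))%E.
      apply: eq_integral => t _; rewrite -EFinB -mulrBr ZE addrK.
      by rewrite (sW t).1.
    rewrite integralB_EFin// sN0 sube0.
    apply: (@le_trans _ _ (\int[P]_(t in A `&` F k) `|Z t|%:E)%E).
      apply: le_integral => //; first exact: integrable_norm.
      move=> t _; rewrite lee_fin; apply: le_trans (ler_norm _) _.
      by rewrite normrM (sW t).2 mul1r.
    apply: ge0_subset_integral => //.
      by apply/measurable_EFinP; apply: measurable_funTS; exact: measurableT_comp.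
  have iW : P.-integrable A (EFin \o W).
    apply/integrableP; split; first by apply/measurable_EFinP; exact: measurable_funTS.
    by apply: le_lt_trans Wle _; have /integrableP[] := iZ.
  split=> //.
  have iN : P.-integrable A (EFin \o N).
    apply: eq_integrable (integrableB mA iZ iW) => // t _.
    by rewrite /= -EFinB ZE (addrC (W t)) addrK.
  have N0 : (\int[P]_(t in A) (N t)%:E = 0)%E.
    apply/(integral_eq0_posneg mA iN).
    have Nk k : (\int[P]_(t in A `&` F k) (N^\+ t)%:E =
        \int[P]_(t in A `&` F k) (N^\- t)%:E)%E.
      apply/(integral_eq0_posneg (mAF k) (NF k A GA).1).
      have [|_] := (NF k A GA).2 (cst 1) (measurable_cst _).
        by move=> t; rewrite normr1.
      by move=> <-; apply: eq_integral => t _; rewrite /cst mul1r.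
    apply/eqP; rewrite eq_le; apply/andP; split; apply: lim_le => //.
    - exact: measurable_funrpos.
    - move=> k; rewrite Nk; apply: ge0_subset_integral => //.
        by apply/measurable_EFinP; apply: measurable_funTS; exact: measurable_funrneg.
      by move=> t _; rewrite lee_fin funrneg_ge0.
    - exact: measurable_funrneg.
    - move=> k; rewrite -Nk; apply: ge0_subset_integral => //.
        by apply/measurable_EFinP; apply: measurable_funTS; exact: measurable_funrpos.
      by move=> t _; rewrite lee_fin funrpos_ge0.
  transitivity (\int[P]_(t in A) ((W t)%:E + (N t)%:E)%E)%E.
    by apply: eq_integral => t _; rewrite -EFinD ZE.
  rewrite integralD_EFin// N0 adde0//.
Qed.

End conditional_mean.

Section variance.
Context d (T : measurableType d) (R : realType) (P : probability T R).

(** The square of eps is only known to be integrable over the members of a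
    countable cover by events of Z. Made disjoint inside that sigma-algebra,
    the cover carries the bound C on the conditional variance over to the whole
    space, and |u| <= 1 + u^2. *)
Lemma cond_variance_integrable d' (T' : measurableType d') (Z : T -> T')
    (eps s2 : T -> R) (C : R) :
  measurable_fun setT Z -> measurable_fun setT eps ->
  cond_expectation P (sigma_of Z) (fun t => eps t ^+ 2) s2 ->
  (forall t, 0 <= s2 t <= C) ->
  P.-integrable setT (EFin \o eps).
Proof.
move=> mZ meps [ms2 [F [GF FT iF]] Heq] s2C.
have /choice[B HB] : forall k, exists B, measurable B /\ Z @^-1` B = F k.
  by move=> k; have [B mB <-] := GF k; exists B; rewrite setTI.
pose D k := Z @^-1` (seqDU B k).
have mseq k : measurable (seqDU B k).
  by apply: measurableD; [exact: (HB k).1|apply: bigsetU_measurable => i _; exact: (HB i).1].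
have GD k : sigma_of Z (D k) by exists (seqDU B k); rewrite ?setTI.
have mD k : measurable (D k) by rewrite -[X in measurable X]setTI; exact: mZ.
have tD : trivIset setT D.
  apply/trivIsetP => /= i j _ _ ij; rewrite -preimage_setI.
  by move/trivIsetP : (@trivIset_seqDU _ B) => /(_ i j I I ij) ->; rewrite preimage_set0.
have DT : \bigcup_k D k = setT.
  rewrite -preimage_bigcup -seqDU_bigcup_eq preimage_bigcup -FT.
  by apply: eq_bigcupr => k _; exact: (HB k).2.
have meps2 : measurable_fun setT (fun t => eps t ^+ 2) by exact: measurable_funX.
have ms2T : measurable_fun setT s2.
  move=> _ A mA; rewrite setTI; have [A' mA' <-] := ms2 A mA.
  exact: mZ.
have iD k : P.-integrable (D k) (EFin \o (fun t => eps t ^+ 2)).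
  have mF : measurable (F k) by rewrite -(HB k).2 -[X in measurable X]setTI; apply: mZ => //; exact: (HB k).1.
  apply: (integrableS mF (mD k) _ (iF k)).
  by rewrite -(HB k).2; apply: preimage_subset; exact: subset_seqDU.
have big (g : T -> R) : measurable_fun setT g -> (forall t, 0 <= g t) ->
   (\int[P]_t (g t)%:E = \sum_(k <oo) \int[P]_(t in D k) (g t)%:E)%E.
  move=> mg g0; rewrite -DT ge0_integral_bigcup//.
  - by rewrite DT; exact/measurable_EFinP.
  - by move=> t _; rewrite lee_fin.
have eps2C : (\int[P]_t (eps t ^+ 2)%:E <= C%:E)%E.
  rewrite big//; last by move=> t; exact: sqr_ge0.
  under eq_eseriesr => k _ do rewrite (Heq _ (GD k) (iD k)).2.
  rewrite -big//; last by move=> t; have /andP[] := s2C t.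
  rewrite (_ : C%:E = \int[P]_t (cst C%:E t))%E; last first.
    by rewrite integral_cst// -[LHS]mule1; congr (_ * _)%E; rewrite [RHS]probability_setT.
  apply: ge0_le_integral => //.
  - by move=> t _; rewrite lee_fin; have /andP[] := s2C t.
  - exact/measurable_EFinP.
  - by move=> t _; rewrite lee_fin; have /andP[] := s2C t.
apply/integrableP; split; first exact/measurable_EFinP.
apply: (@le_lt_trans _ _ (\int[P]_t (cst 1%:E t + (eps t ^+ 2)%:E))%E).
  apply: ge0_le_integral => //.
  - by apply/measurable_EFinP; apply: measurableT_comp.
  - by apply/measurable_EFinP; exact: measurable_funD.
  - move=> t _; rewrite /= lee_fin -real_normK ?num_real//.
    have := normr_ge0 (eps t); set u := `|eps t| => u0.
    have : 0 <= (u - 2^-1) ^+ 2 by exact: sqr_ge0.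
    rewrite sqrrB; lra.
rewrite ge0_integralD//; last 2 first.
- by move=> t _; rewrite lee_fin sqr_ge0.
- exact/measurable_EFinP.
rewrite integral_cst// mul1e lte_add_pinfty//.
- by rewrite [ltLHS]probability_setT ltry.
- exact: le_lt_trans eps2C (ltry _).
Qed.

End variance.

(** * Borel measurability on row vectors *)

Section rV_borel.
Context (R : realType) (d : nat).
Local Notation pt := 'rV[R]_d.

Lemma rV_ballP (x y : pt) (e : R) : 0 < e ->
  ball x e y <-> forall j, `|x ord0 j - y ord0 j| < e.
Proof.
move=> e0; split=> [[_ H] j|H]; first exact: H.
by split => // i j; rewrite (ord1 i); exact: H.
Qed.

Lemma measurable_rV_ball (x : pt) (e : R) : 0 < e -> measurable (ball x e).
Proof.
move=> e0; rewrite [X in measurable X](_ : _ = \bigcap_(j in [set: 'I_d])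
   (rV_coord j @^-1` ball (x ord0 j) e)).
  apply: fin_bigcap_measurable => // j _.
  rewrite -[X in measurable X]setTI; apply: measurable_coord => //.
  exact: measurable_ball.
apply/seteqP; split => v.
  by move=> /(rV_ballP _ _ e0) H j _; exact: H.
by move=> H; apply/(rV_ballP _ _ e0) => j; exact: H.
Qed.

(** An open set is the union of the balls with rational centre and radius 1 /
    (m + 1) that it contains, and balls of the sup norm are boxes. *)
Lemma measurable_rV_open (U : set pt) : open U -> measurable U.
Proof.
move=> oU.
pose B (u : 'rV[rat]_d * nat) : set pt :=
  let b := ball (map_mx ratr u.1 : pt) (u.2.+1%:R^-1 : R) in
  if `[< b `<=` U >] then b else set0.
have mB u : measurable (B u).
  by rewrite /B; case: ifP => // _; apply: measurable_rV_ball.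
suff -> : U = \bigcup_u B u by apply: countable_bigcupT_measurable.
apply/seteqP; split => v.
  2: by move=> [u _]; rewrite /B; case: ifP => // /asboolP; exact.
move=> Uv; have /nbhs_ballP[e /= e0 eU] : nbhs v U by exact: open_nbhs_nbhs.
pose k := (Num.truncn (2 / e)).
have k0 : 0 < (k.+1%:R^-1 : R) by [].
have ke : k.+1%:R^-1 + k.+1%:R^-1 < e.
  have h1 : 2 / e < k.+1%:R by exact: truncnS_gt.
  rewrite (_ : _ + _ = 2 / k.+1%:R); last by ring.
  by rewrite ltr_pdivrMr// mulrC -ltr_pdivrMr.
move: k0 ke; set r : R := k.+1%:R^-1 => k0 ke.
have /choice[q Hq] : forall j, exists q : rat,
    `|v ord0 j - ratr q| < r.
  move=> j; have : v ord0 j - r < v ord0 j + r by lra.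
  move/rat_in_itvoo => [q]; rewrite in_itv /= => /andP[q1 q2]; exists q.
  rewrite ltr_norml; apply/andP; split; lra.
exists (\row_j q j, k) => //; rewrite /B /= -/r.
case: ifPn => [_|/asboolPn nsub].
  apply/rV_ballP => // j; rewrite !mxE distrC; exact: Hq.
exfalso; apply: nsub => w /(rV_ballP _ _ k0) Hw; apply: eU.
apply/rV_ballP => // j; have := Hw j; rewrite !mxE => H.
apply: le_lt_trans ke; rewrite (_ : v ord0 j - w ord0 j =
  (v ord0 j - ratr (q j)) + (ratr (q j) - w ord0 j)); last by ring.
by rewrite (le_trans (ler_normD _ _))// lerD// ltW.
Qed.

Lemma measurable_rV_closed (U : set pt) : closed U -> measurable U.
Proof.
move=> cU; rewrite -(setCK U); apply: measurableC; apply: measurable_rV_open.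
exact: closed_openC.
Qed.

(** Open rays generate the Borel sets of the line. *)
Lemma measurable_fun_superlevel (D : set pt) (g : pt -> R) : measurable D ->
  (forall a, exists2 V, open V & D `&` [set v | a < g v] = D `&` V) ->
  measurable_fun D g.
Proof.
move=> mD H; apply: (measurability _ (RGenOInfty.measurableE R)).
move=> _ [_ [a ->] <-].
have [V oO HO] := H a.
rewrite [X in measurable X](_ : _ = D `&` V).
  by apply: measurableI => //; exact: measurable_rV_open.
rewrite -HO; congr (_ `&` _); apply/seteqP; split => v /=;
  by rewrite in_itv /= andbT.
Qed.

Lemma measurable_fun_within_continuous (D : set pt) (g : pt -> R) :
  closed D -> {within D, continuous g} -> measurable_fun D g.
Proof.
move=> cD cg; apply: measurable_fun_superlevel; first exact: measurable_rV_closed.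
move=> a; have := (continuousP _).1 cg [set r | a < r] (@open_gt R a).
move=> /(open_subspaceP D (g @^-1` [set r | a < r])) [V oV HV].
exists V => //.
by rewrite setIC [RHS]setIC HV.
Qed.

(** The limit at v exceeds a exactly if phi stays above some b > a on a trace
    of a neighbourhood of v; these neighbourhoods form an open set. *)
Lemma measurable_fun_lim_within (U : set pt) (phi : pt -> R) :
  (forall v, closure U v -> cvg (phi u @[u --> within U (nbhs v)])) ->
  measurable_fun (closure U) (fun v => lim (phi u @[u --> within U (nbhs v)])).
Proof.
move=> cphi; apply: measurable_fun_superlevel.
  by apply: measurable_rV_closed; exact: closed_closure.
move=> a; pose L (v : pt) : R := lim (phi u @[u --> within U (nbhs v)]).
pose good (V : set pt) := open V /\
  exists2 b, a < b & forall u, V u -> U u -> b <= phi u.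
exists (\bigcup_(V in good) V); first by apply: bigcup_open => V [].
have pF v : closure U v -> ProperFilter (within U (nbhs v)).
  by move=> clv; apply: within_nbhs_proper; exact: clv.
apply/seteqP; split => v [clv].
- rewrite /= -/(L v) => aL; split => //.
  have FF := pF _ clv.
  pose b := (a + L v) / 2.
  have ab : a < b by rewrite /b; lra.
  have bL : b < L v by rewrite /b; lra.
  have : \forall u \near within U (nbhs v), b <= phi u.
    apply: (cvgr_ge _ (cphi v clv)) => //.
  rewrite /within /= => /nbhs_interior; rewrite nbhsE /= => -[V [oO Ov] sub].
  exists V => //; split => //; exists b => // u Ou Uu.
  exact: (interior_subset (sub _ Ou)).
- move=> [V [oO [b ab Hb]] Ov]; split => //=.
  have FF := pF _ clv.
  apply: lt_le_trans ab _.
  apply: limr_ge; first exact: cphi.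
  have : nbhs v V by exact: open_nbhs_nbhs.
  by apply: filterS => u Ou Uu; exact: Hb.
Qed.

End rV_borel.

(** * Linearity and limits of one-sided derivatives *)

Lemma cvg_big_sum (R : realType) (T : Type) (F : set_system T) {FF : Filter F}
    (I : Type) (s : seq I) (f : I -> T -> R) (a : I -> R) :
  (forall k, f k u @[u --> F] --> a k) ->
  (\sum_(k <- s) f k u) @[u --> F] --> \sum_(k <- s) a k.
Proof.
move=> fa; elim: s => [|k s IH].
  by under eq_fun do rewrite big_nil; rewrite big_nil; exact: cvg_cst.
under eq_fun do rewrite big_cons.
by rewrite big_cons; apply: cvgD; [exact: fa|exact: IH].
Qed.

Section derivatives_lin.
Context (R : realType) (d : nat).
Local Notation pt := 'rV[R]_d.

(** The directions of differentiation with multiplicity: induction on the order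
    of a derivative becomes induction on a list. *)
Definition mseq (alpha : mindex d) : seq 'I_d :=
  flatten [seq nseq (alpha j) j | j <- enum 'I_d].

Lemma size_mseq alpha : size (mseq alpha) = mdeg alpha.
Proof.
rewrite size_flatten /shape -map_comp sumnE big_map /mdeg big_enum /=.
by apply: eq_bigr => j _; rewrite size_nseq.
Qed.

Lemma mpartial_foldr alpha (g : pt -> R) :
  mpartial alpha g = foldr (@partial R d) g (mseq alpha).
Proof.
rewrite /mpartial /mseq; elim: (enum 'I_d) => //= j s ->.
by rewrite foldr_cat; elim: (alpha j) => //= n ->.
Qed.

Lemma partial_lin (U : set pt) (K : nat) (b : 'I_K -> R) (g : 'I_K -> pt -> R)
    (G : pt -> R) (j : 'I_d) : open U ->
  (forall k u, U u -> derivable (g k) u (delta_mx ord0 j)) ->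
  (forall u, U u -> G u = \sum_k b k * g k u) ->
  forall u, U u -> partial j G u = \sum_k b k * partial j (g k) u.
Proof.
move=> oU dg GE u Uu; rewrite /partial.
pose h k : pt -> R := b k \*: g k.
have dh k : derivable (h k) u (delta_mx ord0 j) by apply: derivableZ; exact: dg.
rewrite (@near_eq_derive _ _ _ G (\sum_k h k)); last first.
  have : nbhs u U by exact: open_nbhs_nbhs.
  by apply: filterS => v Uv; rewrite GE// fct_sumE.
rewrite derive_sum//; apply: eq_bigr => k _.
by rewrite /h deriveZ//; exact: dg.
Qed.

(** The induction removes the innermost derivative, so that the functions being
    differentiated change and the open set does not. *)
Lemma foldr_partial_lin (U : set pt) (K : nat) (b : 'I_K -> R) (s : seq 'I_d)
    (r : nat) (g : 'I_K -> pt -> R) (G : pt -> R) : open U ->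
  (size s <= r)%N -> (forall k, Ck r U (g k)) ->
  (forall u, U u -> G u = \sum_k b k * g k u) ->
  forall u, U u ->
    foldr (@partial R d) G s u = \sum_k b k * foldr (@partial R d) (g k) s u.
Proof.
move=> oU; elim/last_ind: s r g G => [|s j IH] r g G //=.
rewrite size_rcons; case: r => // r sr Cg GE u Uu; rewrite foldr_rcons.
under eq_bigr do rewrite foldr_rcons.
apply: (IH r) => //; first by move=> k; have [] := Cg k j.
apply: partial_lin => // k v Uv; have [H _] := Cg k j; exact: H.
Qed.

Lemma dlim_cvg (U : set pt) r (g : pt -> R) alpha v : Ck_closure r U g ->
  (mdeg alpha <= r)%N -> closure U v ->
  mpartial alpha g u @[u --> within U (nbhs v)] --> dlim U alpha g v.
Proof. by move=> [_ H] ar clv; exact: H. Qed.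

Lemma dlim_lin (U : set pt) (K : nat) (b : 'I_K -> R) (alpha : mindex d)
    (r : nat) (g : 'I_K -> pt -> R) (G : pt -> R) v : open U ->
  (mdeg alpha <= r)%N -> (forall k, Ck_closure r U (g k)) ->
  (forall u, U u -> G u = \sum_k b k * g k u) ->
  closure U v ->
  dlim U alpha G v = \sum_k b k * dlim U alpha (g k) v.
Proof.
move=> oU ar Cg GE clv.
have FF : ProperFilter (within U (nbhs v)).
  by apply: within_nbhs_proper; exact: clv.
apply: cvg_lim => //.
have cv : (\sum_k b k * mpartial alpha (g k) u) @[u --> within U (nbhs v)] -->
    \sum_k b k * dlim U alpha (g k) v.
  apply: cvg_big_sum => k; apply: cvgMr; exact: dlim_cvg (Cg k) ar clv.
apply: cvg_trans cv; apply: near_eq_cvg.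
have : \forall u \near within U (nbhs v), U u by exact: withinT.
apply: filterS => u Uu.
rewrite mpartial_foldr (foldr_partial_lin (r := r) oU _ (fun k => (Cg k).1) GE)//.
  by apply: eq_bigr => k _; rewrite mpartial_foldr.
by rewrite size_mseq.
Qed.

Lemma dlim_eq0 (U : set pt) (alpha : mindex d) (G : pt -> R) v : open U ->
  (forall u, U u -> G u = 0) -> closure U v -> dlim U alpha G v = 0.
Proof.
move=> oU G0 clv.
rewrite (@dlim_lin U 0 (fun=> 0) alpha (mdeg alpha) (fun _ _ => 0))//.
- by rewrite big_ord0.
- by case.
- by move=> u Uu; rewrite big_ord0 G0.
Qed.

Lemma mpartial0 (g : pt -> R) : mpartial (mi0 d) g = g.
Proof. by rewrite /mpartial; elim: (enum 'I_d) => //= j s ->; rewrite ffunE. Qed.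

Lemma mdeg0 : mdeg (mi0 d) = 0%N.
Proof. by rewrite /mdeg big1// => j _; rewrite ffunE. Qed.

(** Convergence within D restricts to convergence within U. *)
Lemma dlim0_within (D U : set pt) (g : pt -> R) v : {within D, continuous g} ->
  U `<=` D -> D v -> closure U v -> dlim U (mi0 d) g v = g v.
Proof.
move=> cg UD Dv clv; rewrite /dlim mpartial0.
have FF : ProperFilter (within U (nbhs v)).
  by apply: within_nbhs_proper; exact: clv.
apply: cvg_lim => //.
have /subspace_continuousP/(_ v Dv) := cg.
apply: cvg_trans; apply: cvg_app => A.
move=> H; apply: (@filterS _ (nbhs v) _ (fun u => D u -> A u) _ _ H).
by move=> u DA Uu; apply: DA; exact: UD.
Qed.

(** Existence of the limit at an interior point already forces continuity
    there, since the point itself takes part in the limit. *)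
Lemma dlim0_interior (U : set pt) r (g : pt -> R) v : open U -> U v ->
  Ck_closure r U g -> dlim U (mi0 d) g v = g v.
Proof.
move=> oU Uv Cg.
have m0r : (mdeg (mi0 d) <= r)%N by rewrite mdeg0.
have := dlim_cvg Cg m0r (subset_closure Uv); rewrite mpartial0 => cv.
apply/eqP; rewrite -subr_eq0 -normr_eq0 eq_le normr_ge0 andbT.
apply/ler_addgt0Pr => e e0; rewrite add0r; apply: ltW.
have /cvgrPdist_lt/(_ e e0) := cv.
by rewrite /within /= => /nbhs_singleton; apply.
Qed.

End derivatives_lin.

(** * Cells of a polyhedral partition *)

Section cells.
Context (R : realType) (d k : nat) (X : set 'rV[R]_d) (D : 'I_k -> set 'rV[R]_d).
Local Notation pt := 'rV[R]_d.
Hypothesis HD : polyhedral_partition X D.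

Lemma cell_open l : open (D l).
Proof.
have [_ [ss ->]] := cells_polyhedral HD l; exact: open_interior.
Qed.

Lemma closure_cell_sub l : closure (D l) `<=` X.
Proof. by rewrite -(cells_cover HD); apply: closure_subset; exact: bigcup_sup. Qed.

Lemma cell_sub l : D l `<=` X.
Proof. by move=> v Dv; apply: closure_cell_sub; exact: subset_closure Dv. Qed.

Lemma support_closed : closed X.
Proof. by rewrite -(cells_cover HD); exact: closed_closure. Qed.

Lemma support_closure_interior : X `<=` closure X°.
Proof.
rewrite -{1}(cells_cover HD); apply: closure_subset => v [l _ Dv].
have := @cell_sub l; rewrite (open_subsetE _ (@cell_open l)); exact.
Qed.

Lemma supportE : X = \bigcup_l closure (D l).
Proof.
apply/seteqP; split; last by move=> v [l _]; exact: closure_cell_sub.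
rewrite -{1}(cells_cover HD) => v clv.
have cl : closed (\bigcup_(l in [set: 'I_k]) closure (D l)).
  by apply: closed_bigcup => [|l _]; [exact: finite_finset|exact: closed_closure].
rewrite ((closure_id _).1 cl); apply: closure_subset clv => u [l _ Du].
by exists l => //; exact: subset_closure.
Qed.

Lemma cellP v : X v -> exists2 l, closure (D l) v & cell D v = D l.
Proof.
rewrite supportE => -[l _ clv]; rewrite /cell.
case: pickP => [l' /asboolP ?|/(_ l)/asboolP//]; by exists l'.
Qed.

Lemma closure_cell_disjoint l l' v : D l v -> closure (D l') v -> l = l'.
Proof.
move=> Dv clv; apply/eqP/negPn/negP => ll'.
have [u [Du Du']] := clv _ (open_nbhs_nbhs (conj (@cell_open l) Dv)).
have /trivIsetP/(_ l l' I I ll') := cells_disjoint HD.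
by move/seteqP => [/(_ u) + _]; apply.
Qed.

Lemma cell_in l v : D l v -> cell D v = D l.
Proof.
move=> Dv; have [l' clv ->] := cellP (cell_sub Dv).
by rewrite (closure_cell_disjoint Dv clv).
Qed.

(** The cell chosen at v depends on v only through the set of all cells whose
    closure contains v. There are finitely many such sets, each attained on a
    measurable set of points, over which the function is a fixed F (D l). *)
Lemma measurable_cellwise (F : set pt -> pt -> R) :
  (forall l, measurable_fun (closure (D l)) (F (D l))) ->
  measurable_fun X (fun v => F (cell D v) v).
Proof.
move=> mF _ Y mY.
pose sig v : {set 'I_k} := [set l | `[< closure (D l) v >]]%SET.
have mcl l : measurable (closure (D l)).
  by apply: measurable_rV_closed; exact: closed_closure.
have msig A : measurable [set v | sig v = A].
  rewrite [X in measurable X](_ : _ = \bigcap_(l in [set: 'I_k])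
      (if l \in A then closure (D l) else ~` closure (D l))).
    apply: fin_bigcap_measurable => // l _; case: ifP => // _.
    exact: measurableC.
  apply/seteqP; split => v.
    move=> <- l _; rewrite inE; case: asboolP => //.
  move=> H; apply/setP => l; have := H l I; rewrite inE.
  by case: ifP => lA; case: asboolP.
pose idx (A : {set 'I_k}) := [pick l in A].
have cellE v : cell D v = oapp D set0 (idx (sig v)).
  rewrite /cell /idx; congr oapp; apply: eq_pick => l.
  by rewrite inE.
rewrite [X in measurable X](_ : _ = \bigcup_(A in [set: {set 'I_k}])
  (if idx A is Some l then
     [set v | sig v = A] `&` (closure (D l) `&` F (D l) @^-1` Y) else set0)).
  apply: fin_bigcup_measurable => // A _; case: (idx A) => // l.
  by apply: measurableI => //; exact: mF.
apply/seteqP; split => v.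
- move=> [Xv Fv]; exists (sig v) => //.
  move: Fv; rewrite /preimage /= cellE /idx; case: pickP => [l|].
    by rewrite inE => /asboolP clv Fv; split.
  have [l clv _] := cellP Xv.
  by move=> /(_ l); rewrite inE => /asboolP.
- move=> [A _]; case E : (idx A) => [l|//] [sA [clv Fv]].
  split; first exact: closure_cell_sub clv.
  by rewrite /preimage /= cellE sA E.
Qed.

Lemma measurable_dcell r alpha (g : pt -> R) :
  (forall l, Ck_closure r (D l) g) -> (mdeg alpha <= r)%N ->
  measurable_fun X (dcell D alpha g).
Proof.
move=> Cg ar; apply: (@measurable_cellwise (fun U v => dlim U alpha g v)) => l.
apply: measurable_fun_lim_within => v clv.
by apply/cvg_ex; exists (dlim (D l) alpha g v); exact: dlim_cvg (Cg l) ar clv.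
Qed.

Lemma measurable_diam_cell : measurable_fun X (fun v => diam (cell D v)).
Proof.
by apply: (@measurable_cellwise (fun U _ => diam U)) => l; exact: measurable_cst.
Qed.

Lemma measurable_dlim_interior r alpha (g : pt -> R) :
  Ck_closure r X° g -> (mdeg alpha <= r)%N ->
  measurable_fun X (dlim X° alpha g).
Proof.
move=> Cg ar.
have : measurable_fun (closure X°) (dlim X° alpha g).
  apply: measurable_fun_lim_within => v clv.
  by apply/cvg_ex; exists (dlim X° alpha g v); exact: dlim_cvg Cg ar clv.
apply: measurable_funS; last exact: support_closure_interior.
by apply: measurable_rV_closed; exact: closed_closure.
Qed.

Lemma measurable_lead_bias (mu : pt -> R) (S m : nat)
    (Lambda : {fset mindex d}) (B : mindex d -> mindex d -> pt -> R) alpha :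
  Ck_closure S X° mu -> (m <= S)%N ->
  (forall u, u \in Lambda -> mdeg u = m) ->
  (forall u, u \in Lambda -> forall l, Ck_closure 0 (D l) (B u alpha)) ->
  measurable_fun X (lead_bias X mu m D Lambda B alpha).
Proof.
move=> Cmu mS Lm CB.
have -> : lead_bias X mu m D Lambda B alpha = (fun v => - \sum_(u <- Lambda)
  (if u \in Lambda then dlim X° u mu v * diam (cell D v) ^+ (m - mdeg alpha) *
   dcell D (mi0 d) (B u alpha) v else 0)).
  apply/funext => v; rewrite /lead_bias; congr (- _); rewrite big_seq [RHS]big_seq.
  by apply: eq_bigr => u ->.
apply: measurableT_comp => //; apply: measurable_sum => u.
case: (boolP (u \in Lambda)) => [uL|_]; last exact: measurable_cst.
apply: measurable_funM.
  apply: measurable_funM.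
    by apply: measurable_dlim_interior Cmu _; rewrite Lm.
  by apply: measurable_funX; exact: measurable_diam_cell.
apply: (@measurable_dcell 0); last by rewrite mdeg0.
exact: CB.
Qed.

End cells.

(** * Conditional mean of the series estimator *)

Section measurable_matrix.
Context d (T : measurableType d) (R : realType).

Definition measurable_mx m n (A : T -> 'M[R]_(m, n)) :=
  forall i j, measurable_fun setT (fun t => A t i j).

Lemma measurable_inv (f : T -> R) : measurable_fun setT f ->
  measurable_fun setT (fun t => (f t)^-1).
Proof.
move=> mf.
rewrite (_ : (fun t => _) = (fun t => f t * (`|f t| `^ (-1)) ^+ 2)).
  apply: measurable_funM => //; apply: measurable_funX.
  apply: (measurableT_comp (measurable_powR _)).
  exact: measurableT_comp.
apply/funext => t; rewrite powR_inv1// exprVn real_normK ?num_real//.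
have [->|f0] := eqVneq (f t) 0; first by rewrite invr0 mul0r.
by rewrite expr2 invfM mulrA mulfV// mul1r.
Qed.

Lemma measurable_mulmx m n r (A : T -> 'M[R]_(m, n)) (B : T -> 'M[R]_(n, r)) :
  measurable_mx A -> measurable_mx B -> measurable_mx (fun t => A t *m B t).
Proof.
move=> mA mB i j; under eq_fun do rewrite mxE.
by apply: measurable_sum => k; exact: measurable_funM.
Qed.

Lemma measurable_det n (A : T -> 'M[R]_n) : measurable_mx A ->
  measurable_fun setT (fun t => \det (A t)).
Proof.
move=> mA; rewrite /determinant; apply: measurable_sum => s.
apply: measurable_funM; first exact: measurable_cst.
by apply: measurable_prod => i _; exact: mA.
Qed.

(** Cramer's formula where the determinant does not vanish; invmx is the
    identity on singular matrices. *)
Lemma measurable_invmx n (A : T -> 'M[R]_n) : measurable_mx A ->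
  measurable_mx (fun t => invmx (A t)).
Proof.
move=> mA i j.
have mdet := measurable_det mA.
have mE : measurable [set t | \det (A t) == 0].
  rewrite [X in measurable X](_ : _ = (fun t => \det (A t)) @^-1` [set 0]).
    by rewrite -[X in measurable X]setTI; apply: mdet.
  by apply/seteqP; split => t /= /eqP.
rewrite (_ : (fun t => _) = (fun t => \1_[set t | \det (A t) == 0] t * A t i j +
  (1 - \1_[set t | \det (A t) == 0] t) * ((\det (A t))^-1 * \adj (A t) i j))).
  have mI : measurable_fun setT (\1_[set t | \det (A t) == 0] : T -> R).
    exact: measurable_indic.
  apply: measurable_funD; first exact: measurable_funM.
  apply: measurable_funM; first exact: measurable_funB.
  apply: measurable_funM; first exact: measurable_inv.
  under eq_fun do rewrite mxE /cofactor.
  apply: measurable_funM; first exact: measurable_cst.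
  apply: measurable_det => a b; under eq_fun do rewrite !mxE; exact: mA.
apply/funext => t; rewrite /invmx unitmxE unitfE indicE.
have [d0|d0] := eqVneq (\det (A t)) 0.
  rewrite mem_set /=; last exact/eqP.
  by rewrite subrr mul1r mul0r addr0.
rewrite memNset /=; last by apply/negP.
by rewrite subr0 mul1r mul0r add0r mxE.
Qed.

End measurable_matrix.

Section estimator_condexp.
Context (R : realType) (d : nat) d0 (Omega : measurableType d0)
  (P : probability Omega R).
Local Notation pt := 'rV[R]_d.

Definition fit_weight (k K : nat) (D : 'I_k -> set pt) (p : 'I_K -> pt -> R)
    (q : mindex d) (n : nat) (xs : nat -> pt) (v : pt) (i : nat) : R :=
  n%:R^-1 * (gamma_hat0 D p q n xs v *m Pi0 D p (xs i)) ord0 ord0.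

Lemma series_fit0E k K D p q n xs v g :
  @series_fit0 R d k K D p q n xs v g =
  \sum_(i < n) fit_weight D p q n xs v i * g i.
Proof.
rewrite /series_fit0 /emp_mean -scalemxAr mxE mulmx_sumr summxE mulr_sumr.
apply: eq_bigr => i _; rewrite -scalemxAr mxE /fit_weight.
by rewrite -mulrA; congr (_ * _); rewrite mulrC.
Qed.

Context (X : set pt) (k K : nat) (D : 'I_k -> set pt) (p : 'I_K -> pt -> R).
Hypothesis HD : polyhedral_partition X D.
Variable r : nat.
Hypothesis Cp : forall l j, Ck_closure r (D l) (p j).
Variable x : nat -> Omega -> pt.
Hypothesis mx : forall i, measurable_fun setT (x i).
Hypothesis xX : forall i w, X (x i w).

Lemma measurable_fit_weight n q v i : (i < n)%N ->
  measurable_fun setT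
    ((fun w => fit_weight D p q n (fun i => x i w) v i) : firstType x n -> R).
Proof.
move=> ni.
have mPi j : (j < n)%N -> measurable_mx
    ((fun w => Pi0 D p (x j w)) : firstType x n -> 'cV[R]_K).
  move=> jn a b; rewrite (_ : (fun w => _) =
    (fun w => dcell D (mi0 d) (p a) (x j w))); last first.
    by apply/funext => w; rewrite mxE.
  apply: (@measurable_comp _ _ _ _ _ _ X (dcell D (mi0 d) (p a))).
  - exact: measurable_rV_closed (support_closed HD).
  - by move=> _ [w _ <-]; exact: xX.
  - by apply: (measurable_dcell HD (r := r)) => //; rewrite mdeg0.
  - exact: measurable_firstType.
rewrite /fit_weight; apply: measurable_funM; first exact: measurable_cst.
apply: measurable_mulmx; last exact: mPi.
rewrite /gamma_hat0; apply: measurable_mulmx.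
  by move=> a b; exact: measurable_cst.
apply: measurable_invmx => a b.
rewrite (_ : (fun w => _) = (fun w => n%:R^-1 *
    \sum_(j < n) (Pi0 D p (x j w) *m (Pi0 D p (x j w))^T) a b)); last first.
  by apply/funext => w; rewrite /emp_mean mxE summxE.
apply: measurable_funM; first exact: measurable_cst.
apply: measurable_sum => j; apply: measurable_mulmx; first exact: mPi.
move=> a' b'; rewrite (_ : (fun w => _) = (fun w => Pi0 D p (x j w) b' a')).
  exact: mPi.
by apply/funext => w; rewrite mxE.
Qed.

End estimator_condexp.

(** The fit is linear in the responses, with weights that are functions of the
    regressors, and the noise is integrable because its conditional variance is
    bounded on the compact support. *)
Lemma series_fit_cond_expectation (R : realType) (d0 : measure_display)
    (Omega : measurableType d0) (P : probability Omega R)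
    (d : nat) (q : mindex d)
    (X : set 'rV[R]_d) (mu sigma2 f : 'rV[R]_d -> R) (S : nat) (rho : R)
    (x : nat -> {RV P >-> 'rV[R]_d}) (y eps : nat -> {RV P >-> R})
    (k K r : nat) (D : 'I_k -> set 'rV[R]_d) (p : 'I_K -> 'rV[R]_d -> R) :
  data_generating_process X mu sigma2 f S rho q x y eps ->
  polyhedral_partition X D ->
  (forall l j, Ck_closure r (D l) (p j)) ->
  forall n x0,
  cond_expectation P (sigma_first x n)
    (fun w => series_fit0 D p q n (fun i => x i w) x0 (fun i => y i w))
    (fun w => series_fit0 D p q n (fun i => x i w) x0 (fun i => mu (x i w))).
Proof.
move=> dgp HD Cp n x0.
have cX := support_closed HD.
have mX := measurable_rV_closed cX.
have mxi i : measurable_fun setT (x i) by exact: measurable_funPT.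
(* mu is only continuous on X; extended by 0 it is measurable everywhere and
   the model is unchanged *)
pose mu' := mu \_ X.
have mmu' : measurable_fun setT mu'.
  apply/(measurable_restrictT _ mX).
  exact: measurable_fun_within_continuous cX (dgp_mu_continuous dgp).
have mu'E i w : mu' (x i w) = mu (x i w).
  by rewrite /mu' patchE mem_set//; exact: dgp_regressor dgp i w.
have [C HC] : exists C, forall v, X v -> sigma2 v <= C.
  have [X0|X0] := pselect (X !=set0); last first.
    by exists 0 => v Xv; exfalso; apply: X0; exists v.
  have [c Xc HC] := compact_EVT_max X0 (dgp_compact dgp) (dgp_variance_continuous dgp).
  by exists (sigma2 c) => v Xv; apply: HC; rewrite inE.
have ieps i : P.-integrable setT (EFin \o eps i).
  apply: (@cond_variance_integrable _ _ _ P _ _ (x i) (eps i)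
    (fun w => sigma2 (x i w)) C) => //.
  - exact: dgp_variance dgp i.
  - move=> w; have Xw := dgp_regressor dgp i w; rewrite HC// andbT.
    by have [c c0 /(_ _ Xw)] := dgp_variance_bound dgp; apply: le_trans; exact: ltW.
pose c (i : nat) (w : firstType x n) : R :=
  if (i < n)%N then fit_weight D p q n (fun i => x i w) x0 i else 0.
have mc i : measurable_fun setT (c i).
  rewrite /c; case: (boolP (i < n)%N) => [ni|_]; last exact: measurable_cst.
  apply: (measurable_fit_weight HD Cp) => //.
  exact: dgp_regressor dgp.
have := @cond_expectation_sum _ _ _ P _ _ x mxi y eps mu' _ _ mmu' _ (dgp_iid dgp)
  (dgp_mean dgp) ieps n c mc.
rewrite (_ : (fun t => \sum_(i < n) c i t * y i t) =
    (fun w => series_fit0 D p q n (fun i => x i w) x0 (fun i => y i w))); last first.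
  apply/funext => w; rewrite series_fit0E; apply: eq_bigr => i _.
  by rewrite /c ltn_ord.
rewrite (_ : (fun t => \sum_(i < n) c i t * mu' (x i t)) =
    (fun w => series_fit0 D p q n (fun i => x i w) x0 (fun i => mu (x i w)))); last first.
  apply/funext => w; rewrite series_fit0E; apply: eq_bigr => i _.
  by rewrite /c ltn_ord mu'E.
apply => [i|i|i w]; try exact: measurable_funPT.
by rewrite mu'E; exact: dgp_model dgp i w.
Qed.

(** * Exponentially weighted normal equations *)

Section weighted_gram.
Context (R : realFieldType).

Lemma sum_cauchy_schwarz (I : finType) (f g : I -> R) :
  (\sum_i f i * g i) ^+ 2 <= (\sum_i f i ^+ 2) * (\sum_i g i ^+ 2).
Proof.
have : 0 <= \sum_i \sum_j (f i * g j - f j * g i) ^+ 2.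
  by apply: sumr_ge0 => i _; apply: sumr_ge0 => j _; exact: sqr_ge0.
have -> : \sum_i \sum_j (f i * g j - f j * g i) ^+ 2 =
    2 * ((\sum_i f i ^+ 2) * (\sum_i g i ^+ 2) - (\sum_i f i * g i) ^+ 2).
  transitivity (\sum_i \sum_j (f i ^+ 2 * g j ^+ 2) +
    \sum_i \sum_j (g i ^+ 2 * f j ^+ 2) -
    2 * \sum_i \sum_j ((f i * g i) * (f j * g j))).
    rewrite mulr_sumr -sumrN -!big_split /=; apply: eq_bigr => i _.
    rewrite mulr_sumr -sumrN -!big_split /=; apply: eq_bigr => j _.
    by ring.
  rewrite -!big_distrlr/= expr2; ring.
by rewrite pmulr_rge0// subr_ge0.
Qed.

(** Cauchy-Schwarz against the indicator of the support of z. *)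
Lemma sum_sparse_sqr (K N : nat) (z : 'I_K -> R) :
  (#|[pred k | z k != 0%R]| <= N)%N ->
  (\sum_k `|z k|) ^+ 2 <= N%:R * \sum_k z k ^+ 2.
Proof.
move=> zN.
have -> : \sum_k `|z k| = \sum_k `|z k| * (z k != 0)%:R.
  apply: eq_bigr => k _; have [->|_] := eqVneq (z k) 0.
    by rewrite normr0 mul0r.
  by rewrite mulr1.
apply: le_trans (sum_cauchy_schwarz _ _) _; rewrite mulrC.
apply: ler_pM.
- by apply: sumr_ge0 => k _; exact: sqr_ge0.
- by apply: sumr_ge0 => k _; exact: sqr_ge0.
- rewrite (_ : \sum_i _ = #|[pred k | z k != 0]|%:R) ?ler_nat//.
  rewrite -sum1_card natr_sum [RHS]big_mkcond /=; apply: eq_bigr => k _.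
  by rewrite inE; case: (z k != 0); rewrite /= ?expr1n ?expr0n.
- by apply: ler_sum => k _; rewrite real_normK ?num_real.
Qed.

Variables (n K N : nat) (A : 'I_n -> 'I_K -> R).
Definition emean (f : 'I_n -> R) : R := n%:R^-1 * \sum_i f i.
Definition gram k l := emean (fun i => A i k * A i l).

Lemma emean_le f g : (forall i, f i <= g i) -> emean f <= emean g.
Proof. by move=> fg; apply: ler_wpM2l => //; apply: ler_sum => i _; exact: fg. Qed.

Lemma emean_ge0 f : (forall i, 0 <= f i) -> 0 <= emean f.
Proof. by move=> f0; rewrite mulr_ge0// sumr_ge0. Qed.

Lemma emeanZ a f : emean (fun i => a * f i) = a * emean f.
Proof. by rewrite /emean -mulr_sumr mulrCA. Qed.

Lemma emean_sum (I : finType) (f : I -> 'I_n -> R) :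
  emean (fun i => \sum_k f k i) = \sum_k emean (f k).
Proof. by rewrite /emean exchange_big mulr_sumr. Qed.

Lemma emean_cauchy_schwarz f g :
  (emean (fun i => f i * g i)) ^+ 2 <=
  emean (fun i => f i ^+ 2) * emean (fun i => g i ^+ 2).
Proof.
rewrite /emean exprMn [leRHS]mulrACA -expr2.
by apply: ler_wpM2l; [exact: sqr_ge0|exact: sum_cauchy_schwarz].
Qed.

Hypothesis cnt : forall i, (#|[pred k | A i k != 0%R]| <= N)%N.

Lemma emean_sparse (b : 'I_K -> R) :
  emean (fun i => (\sum_k `|b k * A i k|) ^+ 2) <=
  N%:R * \sum_k b k ^+ 2 * gram k k.
Proof.
apply: le_trans (_ : emean (fun i => N%:R * \sum_k (b k * A i k) ^+ 2) <= _).
  apply: emean_le => i; apply: sum_sparse_sqr; apply: leq_trans (cnt i).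
  apply: subset_leq_card; apply/fintype.subsetP => k; rewrite !inE.
  by apply: contra => /eqP ->; rewrite mulr0.
rewrite emeanZ ler_wpM2l// emean_sum; apply: ler_sum => k _.
rewrite /gram -emeanZ; apply: emean_le => i.
by rewrite exprMn expr2.
Qed.

(** The weights w of the coefficients and u of the sample points play the same
    role; e bounds their ratios across one active region, and their values
    around the target. H stands for h^d. *)
Variables (c H C2 eta e : R) (w : 'I_K -> R) (u : 'I_n -> R) (a g : 'I_K -> R).
Hypotheses (c0 : 0 < c) (H0 : 0 < H) (C20 : 0 <= C2) (eta0 : 0 <= eta) (e0 : 0 <= e).
Hypothesis coercive : forall b : 'I_K -> R,
  c * H * (\sum_k b k ^+ 2) <= \sum_k \sum_l b k * gram k l * b l.
Hypothesis diag : forall k, gram k k <= C2 * H.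
Hypothesis w0 : forall k, 0 < w k.
Hypothesis ratio : forall i k l, A i k != 0 -> A i l != 0 ->
  `|w l / w k - 1| <= eta.
Hypothesis small : 2 * (eta * N%:R * C2) <= c.
Hypothesis u0 : forall i, 0 < u i.
Hypothesis uw : forall i k, A i k != 0 -> u i <= e * w k.
Hypothesis gw : forall k, g k != 0 -> w k <= e.
Hypothesis sol : forall l, \sum_k a k * gram k l = g l.

Let b k := w k * a k.
Let S := \sum_k b k ^+ 2.
Let S0 : 0 <= S. Proof. by apply: sumr_ge0 => k _; exact: sqr_ge0. Qed.

Let energy : emean (fun i => (\sum_k `|b k * A i k|) ^+ 2) <= N%:R * (C2 * H * S).
Proof.
apply: le_trans (emean_sparse b) _; rewrite ler_wpM2l// /S mulr_sumr.
by apply: ler_sum => k _; rewrite mulrC ler_wpM2r ?sqr_ge0.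
Qed.

(** In terms of b k = w k * a k, testing the weighted equations with b itself
    gives the quadratic form of the Gram matrix at b, up to a perturbation with
    coefficients w l / w k - 1. These are at most eta wherever two basis
    functions overlap, so the perturbation is at most eta N C2 H S and is
    absorbed by half of the coercive term. *)
Lemma weighted_solution_bound : (c * H) ^+ 2 * S <= 4 * e ^+ 2 * \sum_k g k ^+ 2.
Proof.
have [->|Sn0] := eqVneq S 0.
  rewrite mulr0 mulr_ge0// ?mulr_ge0 ?sqr_ge0//.
  by apply: sumr_ge0 => k _; exact: sqr_ge0.
have Sp : 0 < S by rewrite lt_neqAle eq_sym Sn0.
pose F := \sum_l b l * (w l * g l).
have FE : F = \sum_k \sum_l b k * gram k l * b l +
    emean (fun i => \sum_k \sum_l (w l / w k - 1) * (b k * A i k) * (b l * A i l)).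
  rewrite emean_sum -big_split /=.
  transitivity (\sum_k \sum_l (w l / w k) * (b k * gram k l * b l)).
    rewrite exchange_big; apply: eq_bigr => l _ /=.
    rewrite -sol !mulr_sumr; apply: eq_bigr => k _ /=.
    rewrite /b; have := w0 k; rewrite lt_neqAle eq_sym => /andP[wk _].
    by field.
  apply: eq_bigr => k _; rewrite emean_sum -big_split /=; apply: eq_bigr => l _.
  rewrite /gram (_ : (fun i => _ * (_ * A i k) * _) =
    (fun i => (w l / w k - 1) * b k * b l * (A i k * A i l))); last first.
    by apply/funext => i; ring.
  rewrite emeanZ; ring.
have F_ge : c * H * S <= 2 * F.
  have pert : - (eta * (N%:R * (C2 * H * S))) <=
    emean (fun i => \sum_k \sum_l (w l / w k - 1) * (b k * A i k) * (b l * A i l)).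
    apply: le_trans (_ : emean (fun i => (- eta) * (\sum_k `|b k * A i k|) ^+ 2) <= _).
      by rewrite emeanZ mulNr lerN2 ler_wpM2l.
    apply: emean_le => i; rewrite expr2 mulr_suml mulr_sumr; apply: ler_sum => k _.
    rewrite mulr_sumr mulr_sumr; apply: ler_sum => l _.
    have [Ak|Ak] := eqVneq (A i k) 0; first by rewrite Ak !(mulr0, mul0r, normr0).
    have [Al|Al] := eqVneq (A i l) 0; first by rewrite Al !(mulr0, mul0r, normr0).
    rewrite mulNr -normrM lerNl -mulrA.
    apply: le_trans (ler_norm _) _; rewrite normrN (normrM (w l / w k - 1)) ler_wpM2r//.
    exact: ratio Ak Al.
  have := coercive b; rewrite -/S => co.
  have : 2 * (eta * N%:R * C2) * (H * S) <= c * (H * S).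
    by rewrite ler_wpM2r// mulr_ge0// ltW.
  rewrite FE; lra.
have F2 : F ^+ 2 <= S * (e ^+ 2 * \sum_k g k ^+ 2).
  apply: le_trans (sum_cauchy_schwarz _ _) _; rewrite ler_wpM2l//.
  rewrite mulr_sumr; apply: ler_sum => k _; rewrite exprMn.
  have [->|gk] := eqVneq (g k) 0; first by rewrite expr0n !mulr0.
  rewrite ler_wpM2r ?sqr_ge0// ler_sqr ?nnegrE ?gw//; exact: ltW.
have : (c * H * S) ^+ 2 <= (2 * F) ^+ 2.
  by rewrite ler_sqr ?nnegrE// ?(le_trans _ F_ge)// !mulr_ge0// ltW.
rewrite (_ : (c * H * S) ^+ 2 = S * ((c * H) ^+ 2 * S)); last by ring.
rewrite [leRHS]exprMn => h.
have : S * ((c * H) ^+ 2 * S) <= S * (4 * e ^+ 2 * \sum_k g k ^+ 2).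
  apply: le_trans h _; rewrite (_ : S * _ = 2 ^+ 2 * (S * (e ^+ 2 * \sum_k g k ^+ 2))).
    by rewrite ler_wpM2l// sqr_ge0.
  by ring.
by rewrite ler_pM2l.
Qed.

(** The left-hand sum is the mean of z i * r i with z i = sum_k a k * A i k.
    Cauchy-Schwarz between u i * z i * r i and 1 / u i splits it; the first
    mean is controlled by the weighted coefficients b, because u i <= e * w k
    whenever A i k is nonzero. *)
Lemma weighted_fit_bound (r : 'I_n -> R) (rho : R) : (forall i, `|r i| <= rho) ->
  (\sum_k a k * emean (fun i => A i k * r i)) ^+ 2 * (c ^+ 2 * H) <=
  4 * e ^+ 4 * N%:R * C2 * rho ^+ 2 * (\sum_k g k ^+ 2) * emean (fun i => (u i)^-1 ^+ 2).
Proof.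
move=> rrho.
pose z i := \sum_k a k * A i k.
have -> : \sum_k a k * emean (fun i => A i k * r i) = emean (fun i => z i * r i).
  rewrite (_ : (fun i => z i * r i) = (fun i => \sum_k a k * (A i k * r i))); last first.
    by apply/funext => i; rewrite mulr_suml; apply: eq_bigr => k _; rewrite mulrA.
  by rewrite emean_sum; apply: eq_bigr => k _; rewrite emeanZ.
set V := emean (fun i => (u i)^-1 ^+ 2).
have V0 : 0 <= V by apply: emean_ge0 => i; exact: sqr_ge0.
have h1 : emean (fun i => z i * r i) ^+ 2 <= emean (fun i => (u i * z i * r i) ^+ 2) * V.
  rewrite (_ : (fun i => z i * r i) = (fun i => (u i * z i * r i) * (u i)^-1)).
    exact: emean_cauchy_schwarz.
  apply/funext => i; have := u0 i; rewrite lt_neqAle eq_sym => /andP[ui _].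
  by field.
have h2 : emean (fun i => (u i * z i * r i) ^+ 2) <= rho ^+ 2 * e ^+ 2 * (N%:R * (C2 * H * S)).
  apply: le_trans (_ : emean (fun i => rho ^+ 2 * e ^+ 2 * (\sum_k `|b k * A i k|) ^+ 2) <= _).
    apply: emean_le => i; rewrite -exprMn -exprMn -real_normK ?num_real//.
    have rho0 : 0 <= rho by exact: le_trans (normr_ge0 _) (rrho i).
    rewrite ler_sqr ?nnegrE//; last first.
      by rewrite !mulr_ge0// sumr_ge0.
    rewrite normrM mulrC -mulrA ler_pM// mulr_sumr.
    rewrite /z mulr_sumr; apply: le_trans (ler_norm_sum _ _ _) _.
    apply: ler_sum => k _.
    have [->|Ak] := eqVneq (A i k) 0; first by rewrite !mulr0 normr0 mulr0.
    rewrite /b !normrM !mulrA ler_wpM2r// ler_wpM2r//.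
    by rewrite (gtr0_norm (u0 i)) (gtr0_norm (w0 k)); exact: uw.
  by rewrite emeanZ ler_wpM2l// mulr_ge0// sqr_ge0.
have h3 := weighted_solution_bound.
have G0 : 0 <= \sum_k g k ^+ 2 by apply: sumr_ge0 => k _; exact: sqr_ge0.
have h4 := le_trans h1 (ler_wpM2r V0 h2).
have cH : 0 <= c ^+ 2 * H by rewrite mulr_ge0// ?sqr_ge0// ltW.
apply: le_trans (ler_wpM2r cH h4) _.
have -> : rho ^+ 2 * e ^+ 2 * (N%:R * (C2 * H * S)) * V * (c ^+ 2 * H) =
  (rho ^+ 2 * e ^+ 2 * N%:R * C2 * V) * ((c * H) ^+ 2 * S) by ring.
have -> : 4 * e ^+ 4 * N%:R * C2 * rho ^+ 2 * (\sum_k g k ^+ 2) * V =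
  (rho ^+ 2 * e ^+ 2 * N%:R * C2 * V) * (4 * e ^+ 2 * \sum_k g k ^+ 2) by ring.
apply: ler_wpM2l => //; do 4?[apply: mulr_ge0 => //]; exact: sqr_ge0.
Qed.

End weighted_gram.

(** * Extent of active regions *)

Section diameters.
Context (R : realType) (d : nat).
Local Notation pt := 'rV[R]_d.

Lemma coord_le_enorm (v : pt) j : `|v ord0 j| <= enorm v.
Proof.
rewrite /enorm -sqrtr_sqr ler_sqrt; last first.
  by apply: sumr_ge0 => i _; apply: sumr_ge0 => l _; exact: sqr_ge0.
rewrite big_ord1 (bigD1 j)//= lerDl.
by apply: sumr_ge0 => i _; exact: sqr_ge0.
Qed.

Lemma enorm_le (v : pt) (M : R) : 0 <= M -> (forall j, `|v ord0 j| <= M) ->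
  enorm v <= Num.sqrt (\sum_(j < d) M ^+ 2).
Proof.
move=> M0 vM; rewrite /enorm big_ord1 ler_sqrt; last first.
  by apply: sumr_ge0 => i _; exact: sqr_ge0.
apply: ler_sum => j _; rewrite -real_normK ?num_real//.
by rewrite ler_sqr ?nnegrE.
Qed.

Lemma compact_coord_bounded (X : set pt) : compact X ->
  exists2 M, 0 <= M & forall v j, X v -> `|v ord0 j| <= M.
Proof.
move=> /compact_bounded [M [_ HM]]; exists (`|M| + 1); first exact: addr_ge0.
move=> v j Xv; have := HM (`|M| + 1) _ v Xv.
have h : M < `|M| + 1 by rewrite ltr_pwDr// ler_norm.
move=> /(_ h); apply: le_trans.
rewrite [leRHS](mx_normrE v).
exact: (le_bigmax _ (fun ij => `|v ij.1 ij.2|) (ord0, j)).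
Qed.

(** The compact set bounds the distances whose supremum is the diameter; of an
    unbounded set, sup would be the default value 0. *)
Lemma coord_le_diam (X A : set pt) u v j : compact X -> A `<=` X -> A u -> A v ->
  `|u ord0 j - v ord0 j| <= diam A.
Proof.
move=> cX AX Au Av.
have [M M0 HM] := compact_coord_bounded cX.
have ub : ubound [set enorm (x - y) | x in A & y in A]
    (Num.sqrt (\sum_(j < d) (M + M) ^+ 2)).
  move=> _ [x Ax [y Ay <-]]; apply: enorm_le; first exact: addr_ge0.
  move=> i; rewrite !mxE; apply: le_trans (ler_normB _ _) _.
  by apply: lerD; apply: HM; exact: AX.
apply: le_trans (_ : enorm (u - v) <= _).
  by have := coord_le_enorm (u - v) j; rewrite !mxE.
apply: ub_le_sup; first by eexists; exact: ub.
by exists u => //; exists v.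
Qed.

Lemma closure_coord_le (A : set pt) (c : R) : (forall u v j, A u -> A v ->
    `|u ord0 j - v ord0 j| <= c) ->
  forall u v j, closure A u -> closure A v -> `|u ord0 j - v ord0 j| <= c.
Proof.
move=> Ac u v j clu clv; apply/ler_addgt0Pr => e e0.
have e2 : 0 < e / 2 by rewrite divr_gt0.
have [u' [Au' /(rV_ballP _ _ e2)/(_ j) uu']] := clu _ (nbhsx_ballx u _ e2).
have [v' [Av' /(rV_ballP _ _ e2)/(_ j) vv']] := clv _ (nbhsx_ballx v _ e2).
rewrite (_ : u ord0 j - v ord0 j = (u' ord0 j - v' ord0 j) +
  ((u ord0 j - u' ord0 j) - (v ord0 j - v' ord0 j))); last by ring.
apply: le_trans (ler_normD _ _) _; apply: lerD; first exact: Ac.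
apply: le_trans (ler_normB _ _) _; lra.
Qed.

Lemma diam_gt0 (X A : set pt) : (0 < d)%N -> compact X -> A `<=` X -> open A ->
  A !=set0 -> 0 < diam A.
Proof.
move=> d0 cX AX oA [v Av]; pose j := Ordinal d0.
have /nbhs_ballP[e /= e0 eA] : nbhs v A by exact: open_nbhs_nbhs.
pose u : pt := v + (e / 2) *: delta_mx ord0 j.
have e2 : 0 < e / 2 by rewrite divr_gt0.
have Au : A u.
  apply: eA; apply/rV_ballP => // i.
  rewrite !mxE opprD addrA subrr add0r normrN eqxx /=.
  case: (i == j); rewrite ?mulr1 ?mulr0 ?normr0// gtr0_norm//; lra.
have := coord_le_diam j cX AX Au Av; apply: lt_le_trans.
by rewrite !mxE !eqxx mulr1 (addrC (v ord0 j)) addrK gtr0_norm.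
Qed.

End diameters.

Section region_extent.
Context (R : realType) (d k : nat) (X : set 'rV[R]_d) (D : 'I_k -> set 'rV[R]_d).
Local Notation pt := 'rV[R]_d.
Hypothesis HD : polyhedral_partition X D.
Hypothesis cX : compact X.

Lemma coord_le_mesh l u v j : closure (D l) u -> closure (D l) v ->
  `|u ord0 j - v ord0 j| <= mesh D.
Proof.
apply: closure_coord_le => {}u {}v {}j Du Dv.
apply: le_trans (coord_le_diam j cX (cell_sub HD (l:=l)) Du Dv) _.
exact: (le_bigmax _ (fun l => diam (D l)) l).
Qed.

Lemma closure_active_region (g : pt -> R) :
  closure (active_region D g) =
  \bigcup_(l in [set l | active g (D l)]) closure (D l).
Proof.
apply/seteqP; split.
  have cl : closed (\bigcup_(l in [set l | active g (D l)]) closure (D l)).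
    apply: closed_bigcup => [|l _]; last exact: closed_closure.
    by apply: (sub_finite_set (B := setT)) => //; exact: finite_finset.
  rewrite ((closure_id _).1 cl); apply: closure_subset => v [l al Dv].
  by exists l => //; exact: subset_closure.
by move=> v [l al]; apply: closure_subset => u Du; exists l.
Qed.

(** If the extent exceeded N mesh sizes, connectedness would provide N + 1
    points of the region whose j-th coordinates are more than one mesh size
    apart, and no two of them could share a cell. *)
Lemma active_region_extent (g : pt -> R) (N : nat) u v j :
  connected (closure (active_region D g)) ->
  (#|[pred l | active g (D l)]| <= N)%N ->
  closure (active_region D g) u -> closure (active_region D g) v ->
  `|u ord0 j - v ord0 j| <= N%:R * mesh D.
Proof.
move=> con cN.
wlog uv : u v / u ord0 j <= v ord0 j.
  move=> H clu clv; have [uv|vu] := leP (u ord0 j) (v ord0 j); first exact: H.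
  by rewrite distrC; apply: H => //; exact: ltW.
move=> clu clv; rewrite distrC ger0_norm ?subr_ge0// leNgt; apply/negP => big.
have N0 : (0 < N)%N.
  move: clu; rewrite closure_active_region => -[l al _].
  by apply: leq_trans cN; apply/card_gt0P; exists l; exact: al.
pose I := (fun w : pt => w ord0 j) @` closure (active_region D g).
have int : is_interval I.
  apply/connected_intervalP; apply: connected_continuous_connected => //.
  apply: continuous_subspaceT => w; exact: coord_continuous.
pose s := (v ord0 j - u ord0 j) / N%:R.
have hs : mesh D < s by rewrite /s ltr_pdivlMr ?ltr0n// mulrC.
have mesh0 : 0 <= mesh D by rewrite /mesh; apply: bigmax_ge_id.
have s0 : 0 < s by exact: le_lt_trans hs.
pose t (i : nat) := u ord0 j + i%:R * s.
have It (i : 'I_N.+1) : I (t i).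
  apply: (int (u ord0 j) (v ord0 j)); [by exists u|by exists v|].
  rewrite /t lerDl (mulr_ge0 (ler0n _ i) (ltW s0)) /= -lerBrDl.
  apply: le_trans (_ : N%:R * s <= _).
    by rewrite ler_pM2r// ler_nat -ltnS.
  by rewrite /s mulrC divfK// pnatr_eq0 -lt0n.
have /choice[f Hf] : forall i : 'I_N.+1, exists l, active g (D l) /\
    exists2 w, closure (D l) w & w ord0 j = t i.
  move=> i; have [w + wt] := It i; rewrite closure_active_region => -[l al clw].
  by exists l; split => //; exists w.
have neq (a b : 'I_N.+1) : (a < b)%N -> f a <> f b.
  move=> ab fab.
  have [_ [wa cla wta]] := Hf a; have [_ [wb clb wtb]] := Hf b.
  rewrite -fab in clb; have := coord_le_mesh j clb cla.
  rewrite wta wtb /t opprD addrACA subrr add0r -mulrBl -natrB 1?ltnW//.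
  rewrite ger0_norm ?(mulr_ge0 (ler0n _ _) (ltW s0))// => h1.
  have h2 : 1 * s <= (b - a)%:R * s by rewrite ler_pM2r// ler1n subn_gt0.
  by rewrite mul1r in h2; have := lt_le_trans hs h2; rewrite ltNge h1.
have injf : injective f.
  move=> a b fab; apply/val_inj; case: (ltngtP a b) => // ab.
    by exfalso; exact: neq ab fab.
  by exfalso; exact: neq ab (esym fab).
have : (#|codom f| <= N)%N.
  apply: leq_trans cN; apply: subset_leq_card; apply/fintype.subsetP => l.
  by move=> /codomP[i ->]; exact: (Hf i).1.
by rewrite card_codom// card_ord ltnn.
Qed.

End region_extent.

(** * Law of a regressor with bounded density *)

Section law.
Context (R : realType) d0 (Omega : measurableType d0) (P : probability Omega R).
Context (d : nat) (X : set 'rV[R]_d) (Z : Omega -> 'rV[R]_d) (f : 'rV[R]_d -> R).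
Local Notation pt := 'rV[R]_d.
Hypothesis mX : measurable X.
Hypothesis mZ : measurable_fun setT Z.
Hypothesis ZX : forall w, X (Z w).
Hypothesis mf : measurable_fun setT f.
Hypothesis f0 : forall v, 0 <= f v.
Hypothesis dens : forall A, measurable A ->
  P (Z @^-1` A) = (\int[lebesgue_rV R d]_(v in A) (f v)%:E)%E.
Let lam := lebesgue_rV R d.

Lemma law_le (F : R) A : (forall v, X v -> f v <= F) -> measurable A ->
  (P (Z @^-1` A) <= F%:E * lam A)%E.
Proof.
move=> fF mA.
have -> : Z @^-1` A = Z @^-1` (A `&` X).
  by apply/seteqP; split => w => [Aw|[]//]; split => //; exact: ZX.
have mAX := measurableI _ _ mA mX.
have F0 : (0 <= F) by apply: le_trans (f0 _) (fF _ (ZX point)).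
rewrite dens//; apply: (@le_trans _ _ (F%:E * lam (A `&` X))%E); last first.
  apply: lee_wpmul2l; first by rewrite lee_fin.
  by apply: le_measure; rewrite ?inE //; exact: subIsetl.
rewrite -(integral_cst lam mAX F%:E); apply: ge0_le_integral => //.
- by move=> v _; rewrite lee_fin.
- by apply/measurable_EFinP; exact: measurable_funTS.
- by move=> v [_ Xv]; rewrite lee_fin; exact: fF.
Qed.

Lemma law_ge (c : R) A : 0 <= c -> (forall v, X v -> c <= f v) ->
  measurable A -> A `<=` X -> (c%:E * lam A <= P (Z @^-1` A))%E.
Proof.
move=> c0 cf mA AX.
rewrite dens// -(integral_cst lam mA c%:E); apply: ge0_le_integral => //.
- by apply/measurable_EFinP; exact: measurable_funTS.
- by move=> v Av; rewrite lee_fin; apply: cf; exact: AX.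
Qed.

Lemma law_integral_ge (c : R) A (g : pt -> R) : 0 <= c ->
  (forall v, X v -> c <= f v) -> measurable A -> A `<=` X ->
  measurable_fun setT g -> (forall v, 0 <= g v) ->
  (c%:E * \int[lam]_(v in A) (g v)%:E <= \int[P]_(w in Z @^-1` A) (g (Z w))%:E)%E.
Proof.
move=> c0 cf mA AX mg g0.
have mgE : measurable_fun setT (EFin \o g) by exact/measurable_EFinP.
pose m1 := mscale (NngNum c0) (mrestr lam mA).
have -> : (\int[P]_(w in Z @^-1` A) (g (Z w))%:E =
    \int[pushforward P Z]_(v in A) (g v)%:E)%E.
  rewrite ge0_integral_pushforward//; first exact: measurable_funTS.
  by move=> v _; rewrite lee_fin.
have -> : (c%:E * \int[lam]_(v in A) (g v)%:E = \int[m1]_(v in A) (g v)%:E)%E.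
  rewrite ge0_integral_mscale//; last 2 first.
  - exact: measurable_funTS.
  - by move=> v _; rewrite lee_fin.
  congr (_ * _)%E; apply: eq_measure_integral => B mB BA.
  by rewrite /= /mrestr setIidl.
apply: ge0_le_measure_integral => // B mB.
rewrite /m1 /= /mscale /= /mrestr.
have mBA := measurableI _ _ mB mA.
apply: le_trans (law_ge c0 cf mBA _) _; first by move=> v [_ /AX].
by apply: le_measure => [||w []//]; rewrite inE -[X in measurable X]setTI; exact: mZ.
Qed.

Definition cube (c : pt) (r : R) : set pt :=
  [set v | forall i, v ord0 i \in `]c ord0 i - r, c ord0 i + r]].

Lemma measurable_cube c r : measurable (cube c r).
Proof.
rewrite [X in measurable X](_ : _ = \bigcap_(i in [set: 'I_d])
   (rV_coord i @^-1` [set` `]c ord0 i - r, c ord0 i + r]])).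
  apply: fin_bigcap_measurable => // i _.
  by rewrite -[X in measurable X]setTI; exact: measurable_coord.
by apply/seteqP; split => v /= H i => [_|]; exact: H.
Qed.

Lemma lebesgue_cube c r : 0 <= r -> lam (cube c r) = ((2 * r) ^+ d)%:E.
Proof.
move=> r0; have h := @lebesgue_rV_box R d (fun i => c ord0 i - r) (fun i => c ord0 i + r).
rewrite /lam /cube h; last by move=> i; lra.
congr EFin; rewrite (eq_bigr (fun=> 2 * r)); last by move=> i _; ring.
by rewrite prodr_const card_ord.
Qed.

End law.

(** Half of the exponential decay absorbs the polynomial factor, through x^d /
    d! <= exp x, and the other half leaves a geometric series. *)
Lemma geometric_shell_bound (R : realType) (d : nat) (t : R) : 0 < t ->
  exists2 C : R, 0 <= C & forall J, \sum_(j < J) expR (- (t * j%:R)) * j.+1%:R ^+ d <= C.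
Proof.
move=> t0.
pose z := expR (- (t / 2)).
have z1 : z < 1 by rewrite /z expR_lt1 oppr_lt0 divr_gt0.
have z0 : 0 < z by exact: expR_gt0.
have poly (j : nat) : j.+1%:R ^+ d <= d`!%:R * (2 / t) ^+ d * expR (t / 2 * j.+1%:R).
  case: d => [|d'].
    by rewrite !expr0 fact0 !mul1r -[leLHS]expR0 ler_expR mulr_ge0// divr_ge0// ltW.
  have u0 : 0 <= t / 2 * j.+1%:R by rewrite mulr_ge0// divr_ge0// ltW.
  have := expR_ge1Dxn d' u0 => H.
  have : (t / 2 * j.+1%:R) ^+ d'.+1 / d'.+1`!%:R <= expR (t / 2 * j.+1%:R).
    by apply: le_trans H; rewrite lerDr.
  rewrite ler_pdivrMr ?ltr0n ?fact_gt0// => {}H.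
  have : (2 / t) ^+ d'.+1 * (t / 2 * j.+1%:R) ^+ d'.+1 <=
         (2 / t) ^+ d'.+1 * (expR (t / 2 * j.+1%:R) * d'.+1`!%:R).
    by rewrite ler_wpM2l// exprn_ge0// divr_ge0// ltW.
  rewrite -exprMn (_ : 2 / t * (t / 2 * j.+1%:R) = j.+1%:R); last first.
    by field; apply: lt0r_neq0.
  move=> /le_trans; apply; rewrite le_eqVlt; apply/orP; left; apply/eqP; ring.
pose A := d`!%:R * (2 / t) ^+ d * expR (t / 2).
have A0 : 0 <= A by rewrite !mulr_ge0// ?expR_ge0// exprn_ge0// divr_ge0// ltW.
exists (A / (1 - z)); first by rewrite divr_ge0// subr_ge0 ltW.
move=> J; apply: le_trans (_ : \sum_(j < J) A * z ^+ j <= _).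
  apply: ler_sum => j _.
  apply: le_trans (ler_wpM2l (expR_ge0 _) (poly j)) _.
  rewrite le_eqVlt; apply/orP; left; apply/eqP.
  rewrite /A /z -expRM_natl mulrCA -!mulrA; congr (_ * (_ * _)).
  rewrite -!expRD; congr expR; rewrite -natr1; by field.
rewrite -mulr_sumr ler_wpM2l//.
rewrite -[leRHS]mul1r ler_pdivlMr ?subr_gt0//.
rewrite mulrC (_ : (1 - z) * _ = 1 - z ^+ J); last first.
  by rewrite -opprB mulNr -subrX1 opprB.
by rewrite gerBl exprn_ge0// ltW.
Qed.

Section exponential_moment.
Context (R : realType) d0 (Omega : measurableType d0) (P : probability Omega R).
Context (d : nat) (X : set 'rV[R]_d) (Z : Omega -> 'rV[R]_d) (f : 'rV[R]_d -> R).
Local Notation pt := 'rV[R]_d.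
Hypothesis cX : compact X.
Hypothesis mX : measurable X.
Hypothesis mZ : measurable_fun setT Z.
Hypothesis ZX : forall w, X (Z w).
Hypothesis mf : measurable_fun setT f.
Hypothesis f0 : forall v, 0 <= f v.
Hypothesis dens : forall A, measurable A ->
  P (Z @^-1` A) = (\int[lebesgue_rV R d]_(v in A) (f v)%:E)%E.

(** The l1 distance is controlled by extents in the coordinate directions, and
    its balls lie in cubes of known volume. *)
Definition dist1 (u v : pt) : R := \sum_j `|u ord0 j - v ord0 j|.

Lemma measurable_dist1 (c : pt) : measurable_fun setT (fun v => dist1 v c).
Proof.
apply: measurable_sum => j; apply: measurableT_comp => //.
by apply: measurable_funB => //; exact: measurable_coord.
Qed.

Lemma dist1_ge0 u v : 0 <= dist1 u v. Proof. exact: sumr_ge0. Qed.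

(** On the shell j <= dist / h < j + 1 the weight is at most exp (- t j), and
    the shell lies in a cube of side 2 (j + 1) h, whose probability is at most
    F (2 (j + 1) h)^d. Summing over the shells keeps the order h^d of a single
    cell. *)
Lemma exponential_moment (F t h C : R) (c : pt) : (forall v, X v -> f v <= F) ->
  0 < t -> 0 < h -> X c ->
  (forall J, \sum_(j < J) expR (- (t * j%:R)) * j.+1%:R ^+ d <= C) ->
  (\int[P]_w (expR (- (t * (dist1 (Z w) c / h))))%:E <= (F * (2 * h) ^+ d * C)%:E)%E.
Proof.
move=> fF t0 h0 Xc HC.
have [M M0 HM] := compact_coord_bounded cX.
pose J := (Num.truncn (d%:R * (M + M) / h)).+1.
have F0 : 0 <= F by apply: le_trans (f0 _) (fF _ (ZX point)).
have mcube j : measurable (Z @^-1` cube c (j.+1%:R * h)).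
  by rewrite -[X in measurable X]setTI; apply: mZ => //; exact: measurable_cube.
pose g j w : R := expR (- (t * j%:R)) * \1_(Z @^-1` cube c (j.+1%:R * h)) w.
have mg j : measurable_fun setT (g j).
  by apply: measurable_funM => //; exact: measurable_indic.
have g0 j w : 0 <= g j w by rewrite mulr_ge0// expR_ge0.
have step1 w : expR (- (t * (dist1 (Z w) c / h))) <= \sum_(j < J) g j w.
  set s := dist1 (Z w) c / h.
  have s0 : 0 <= s by rewrite divr_ge0 ?dist1_ge0 ?ltW.
  have /andP[sl sr] := truncn_itv s0.
  have sJ : (Num.truncn s < J)%N.
    rewrite ltnS; apply: le_truncn; rewrite ler_pM2r ?invr_gt0//.
    rewrite mulr_natl -[in leRHS](card_ord d) -sumr_const.
    apply: ler_sum => j _; apply: le_trans (ler_normB _ _) _.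
    by apply: lerD; apply: HM.
  rewrite (bigD1 (Ordinal sJ))//=.
  apply: (@le_trans _ _ (g (Num.truncn s) w)); last first.
    by rewrite lerDl; apply: sumr_ge0.
  rewrite /g indicE mem_set ?mulr1 ?ler_expR ?lerN2 ?ler_pM2l//.
  move=> j; rewrite in_itv /=.
  have : `|Z w ord0 j - c ord0 j| < (Num.truncn s).+1%:R * h.
    apply: le_lt_trans (_ : s * h < _); last by rewrite ltr_pM2r.
    rewrite /s divfK ?lt0r_neq0// /dist1 (bigD1 j)//= lerDl.
    exact: sumr_ge0.
  rewrite ltr_norml => /andP[h1 h2]; apply/andP; split; lra.
apply: (@le_trans _ _ (\int[P]_w (\sum_(j < J) g j w)%:E)%E).
  apply: ge0_le_integral => //.
  - rewrite (_ : (fun w => _) =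
        EFin \o (expR \o (fun w => (- t / h) * dist1 (Z w) c))); last first.
      by apply/funext => w /=; congr (expR _)%:E; ring.
    apply/measurable_EFinP; apply: measurableT_comp => //.
    apply: measurable_funM => //.
    exact: (measurableT_comp (measurable_dist1 c) mZ).
  - by apply/measurable_EFinP; apply: measurable_sum => j.
  - by move=> w _; rewrite lee_fin.
under eq_integral do rewrite -sumEFin.
rewrite ge0_integral_sum//; last 2 first.
- by move=> j; exact/measurable_EFinP.
- by move=> j w _; rewrite lee_fin.
apply: (@le_trans _ _ (\sum_(j < J) (expR (- (t * j%:R)) * (F * (2 * (j.+1%:R * h)) ^+ d))%:E)%E).
  apply: lee_sum => j _; rewrite /g.
  under eq_integral do rewrite EFinM.
  rewrite ge0_integralZl//; last first.
  - by apply/measurable_EFinP; exact: measurable_indic.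
  rewrite integral_indic// setIT EFinM lee_wpmul2l ?lee_fin ?expR_ge0//.
  apply: le_trans (law_le mX ZX mf f0 dens fF (measurable_cube c _)) _.
  by rewrite lebesgue_cube ?EFinM// mulr_ge0// ltW.
rewrite sumEFin lee_fin.
rewrite (eq_bigr (fun j : 'I_J => F * (2 * h) ^+ d * (expR (- (t * j%:R)) * j.+1%:R ^+ d))).
  rewrite -mulr_sumr; apply: ler_wpM2l; last exact: HC.
  by rewrite mulr_ge0// exprn_ge0// mulr_ge0// ltW.
move=> j _; rewrite [2 * (_ * h)]mulrCA [(_ * (2 * h)) ^+ d]exprMn; ring.
Qed.

End exponential_moment.

(** * Population Gram matrix *)

Section Rintegral_quadratic.
Context d (T : measurableType d) (R : realType) (m : {measure set T -> \bar R}).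
Variables (A : set T) (mA : measurable A).

Lemma integrable_Rsum (I : Type) (s : seq I) (f : I -> T -> R) :
  (forall i, m.-integrable A (EFin \o f i)) ->
  m.-integrable A (EFin \o (fun t => \sum_(i <- s) f i t)).
Proof.
move=> fi; rewrite (_ : _ \o _ = (fun t => (\sum_(i <- s) (EFin \o f i) t)%E)).
  exact: integrable_sum.
by apply/funext => t /=; rewrite sumEFin.
Qed.

Lemma integrable_RZ (c : R) (f : T -> R) : m.-integrable A (EFin \o f) ->
  m.-integrable A (EFin \o (fun t => c * f t)).
Proof. by move=> fi; exact: (integrableZl mA c fi). Qed.

Lemma Rintegral_sum (I : Type) (s : seq I) (f : I -> T -> R) :
  (forall i, m.-integrable A (EFin \o f i)) ->
  \int[m]_(t in A) (\sum_(i <- s) f i t) = \sum_(i <- s) \int[m]_(t in A) f i t.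
Proof.
move=> fi; elim: s => [|i s IH].
  rewrite big_nil; under eq_Rintegral do rewrite big_nil.
  by rewrite Rintegral_cst// mul0r.
rewrite big_cons -IH -RintegralD//; last exact: integrable_Rsum.
by apply: eq_Rintegral => t _; rewrite big_cons.
Qed.

(** Expands a square under the integral, which turns the quadratic form of a
    Gram matrix into a second moment. *)
Lemma Rintegral_quadratic (K : nat) (f : 'I_K -> T -> R) (b : 'I_K -> R) :
  (forall i j, m.-integrable A (EFin \o (fun t => f i t * f j t))) ->
  m.-integrable A (EFin \o (fun t => (\sum_i b i * f i t) ^+ 2)) /\
  \int[m]_(t in A) ((\sum_i b i * f i t) ^+ 2) =
  \sum_i \sum_j b i * (\int[m]_(t in A) (f i t * f j t)) * b j.
Proof.
move=> fi.
have E t : (\sum_i b i * f i t) ^+ 2 = \sum_i \sum_j (b i * b j) * (f i t * f j t).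
  rewrite expr2 big_distrlr /=; apply: eq_bigr => i _; apply: eq_bigr => j _.
  by ring.
have -> : (fun t => (\sum_i b i * f i t) ^+ 2) =
    (fun t => \sum_i \sum_j (b i * b j) * (f i t * f j t)) by apply/funext.
split.
  by apply: integrable_Rsum => i; apply: integrable_Rsum => j; exact: integrable_RZ.
rewrite Rintegral_sum; last first.
  by move=> i; apply: integrable_Rsum => j; exact: integrable_RZ.
apply: eq_bigr => i _; rewrite Rintegral_sum; last by move=> j; exact: integrable_RZ.
apply: eq_bigr => j _; rewrite RintegralZl//; ring.
Qed.

End Rintegral_quadratic.

Section cell_basis.
Context (R : realType) (d : nat) (X : set 'rV[R]_d) (k K : nat).
Local Notation pt := 'rV[R]_d.
Context (D : 'I_k -> set pt) (p : 'I_K -> pt -> R).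
Hypothesis HD : polyhedral_partition X D.
Hypothesis cX : compact X.
Variable r : nat.
Hypothesis Cp : forall l j, Ck_closure r (D l) (p j).
Variable N : nat.
Hypothesis Ncells : forall j, (#|[pred l | active (p j) (D l)]| <= N)%N.
Hypothesis Ncoact : forall j, (#|[pred i | [exists l, active (p j) (D l) &&
                            active (p i) (D l)]]| <= N)%N.
Hypothesis conn : forall j, connected (closure (active_region D (p j))).

(** Extension by 0 outside the support makes the basis measurable on the whole
    space, without changing it at the regressors. *)
Definition cbasis (j : 'I_K) : pt -> R := dcell D (mi0 d) (p j) \_ X.

Lemma cbasisE j v : X v -> cbasis j v = dcell D (mi0 d) (p j) v.
Proof. by move=> Xv; rewrite /cbasis patchE mem_set. Qed.

Lemma measurable_cbasis j : measurable_fun setT (cbasis j).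
Proof.
apply/(measurable_restrictT _ (measurable_rV_closed (support_closed HD))).
by apply: (measurable_dcell HD (r := r)) => //; rewrite mdeg0.
Qed.

Lemma cbasis_cell j l v : D l v -> cbasis j v = p j v.
Proof.
move=> Dv; rewrite cbasisE; last exact: (cell_sub HD Dv).
by rewrite /dcell (cell_in HD Dv) (dlim0_interior _ _ (Cp l j))//; exact: (cell_open HD).
Qed.

Lemma dcell_inactive alpha j l v : cell D v = D l -> closure (D l) v ->
  ~~ active (p j) (D l) -> dcell D alpha (p j) v = 0.
Proof.
move=> cv clv /asboolPn nact; rewrite /dcell cv; apply: dlim_eq0 => //.
  exact: (cell_open HD).
by move=> u Du; apply/eqP/negPn/negP => pu; apply: nact; exists u.
Qed.

Lemma dcell_neq0 alpha j v : X v -> dcell D alpha (p j) v != 0 ->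
  closure (active_region D (p j)) v.
Proof.
move=> Xv pv; have [l clv cv] := cellP HD Xv.
rewrite closure_active_region; exists l => //=; apply/negPn/negP => na.
by move: pv; rewrite (dcell_inactive alpha cv clv na) eqxx.
Qed.

Lemma dcell_coactive alpha beta i j v : X v -> dcell D alpha (p i) v != 0 ->
  dcell D beta (p j) v != 0 -> [exists l, active (p i) (D l) && active (p j) (D l)].
Proof.
move=> Xv pi pj; have [l clv cv] := cellP HD Xv.
apply/existsP; exists l; apply/andP; split; apply/negPn/negP => na.
  by move: pi; rewrite (dcell_inactive alpha cv clv na) eqxx.
by move: pj; rewrite (dcell_inactive beta cv clv na) eqxx.
Qed.

Lemma cbasis_neq0 j v : cbasis j v != 0 ->
  X v /\ dcell D (mi0 d) (p j) v != 0.
Proof.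
rewrite /cbasis patchE; case: ifPn => [|_]; last by rewrite eqxx.
by rewrite inE.
Qed.

Lemma cbasis_region j v : cbasis j v != 0 -> closure (active_region D (p j)) v.
Proof. by move=> /cbasis_neq0[Xv]; exact: dcell_neq0. Qed.

Lemma cbasis_coactive i j v : cbasis i v != 0 -> cbasis j v != 0 ->
  [exists l, active (p i) (D l) && active (p j) (D l)].
Proof. by move=> /cbasis_neq0[Xv pi] /cbasis_neq0[_ pj]; exact: dcell_coactive pi pj. Qed.

(** All functions that do not vanish at v share a cell with any one of them. *)
Lemma cbasis_count v : (#|[pred j | cbasis j v != 0%R]| <= N)%N.
Proof.
have [/existsP[i pi]|/existsPn none] := boolP [exists j, cbasis j v != 0%R].
  apply: leq_trans (Ncoact i); apply: subset_leq_card.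
  by apply/fintype.subsetP => j pj; exact: cbasis_coactive pi pj.
rewrite eq_card0// => j; apply/negbTE; exact: none.
Qed.

Lemma region_count v : (\sum_j (v \in active_region D (p j)) <= N)%N.
Proof.
have [/existsP[i vi]|/existsPn none] :=
    boolP [exists j, v \in active_region D (p j)].
  apply: leq_trans (Ncoact i); rewrite -sum1_card [leqRHS]big_mkcond /=.
  apply: leq_sum => j _; case: (boolP (v \in active_region D (p j))) => // vj.
  rewrite [_ \in _](_ : _ = true)//.
  move: vi vj; rewrite !inE => -[l al Dv] [l' al' Dv'].
  have ll' := closure_cell_disjoint HD Dv (subset_closure Dv').
  by apply/existsP; exists l; apply/andP; split; [exact: al|rewrite ll'; exact: al'].
by rewrite big1// => j _; rewrite (negbTE (none j)).
Qed.

Lemma region_extent j u v i : closure (active_region D (p j)) u ->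
  closure (active_region D (p j)) v -> `|u ord0 i - v ord0 i| <= N%:R * mesh D.
Proof. exact: (active_region_extent HD cX i (@conn j) (Ncells j)). Qed.

Variable Cb : R.
Hypothesis Cb_bound : forall l v j, closure (D l) v ->
  `|dlim (D l) (mi0 d) (p j) v| <= Cb.

Lemma cbasis_bound j v : 0 <= Cb -> `|cbasis j v| <= Cb.
Proof.
move=> Cb0; rewrite /cbasis patchE; case: ifPn => [|_]; last by rewrite normr0.
rewrite inE => Xv; have [l clv cv] := cellP HD Xv.
by rewrite /dcell cv; exact: Cb_bound.
Qed.

End cell_basis.

Section population_gram.
Context (R : realType) (d : nat) (X : set 'rV[R]_d) (k K : nat).
Local Notation pt := 'rV[R]_d.
Context (D : 'I_k -> set pt) (p : 'I_K -> pt -> R).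
Hypothesis HD : polyhedral_partition X D.
Hypothesis cX : compact X.
Variable r : nat.
Hypothesis Cp : forall l j, Ck_closure r (D l) (p j).
Variable N : nat.
Hypothesis N0 : (0 < N)%N.
Hypothesis Ncells : forall j, (#|[pred l | active (p j) (D l)]| <= N)%N.
Hypothesis Ncoact : forall j, (#|[pred i | [exists l, active (p j) (D l) &&
                            active (p i) (D l)]]| <= N)%N.
Hypothesis conn : forall j, connected (closure (active_region D (p j))).
Variable Cb : R.
Hypothesis Cb0 : 0 <= Cb.
Hypothesis Cb_bound : forall l v j, closure (D l) v ->
  `|dlim (D l) (mi0 d) (p j) v| <= Cb.
Context d0 (Omega : measurableType d0) (P : probability Omega R).
Variables (Z : Omega -> pt) (f : pt -> R).
Hypothesis mZ : measurable_fun setT Z.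
Hypothesis ZX : forall w, X (Z w).
Hypothesis mf : measurable_fun setT f.
Hypothesis f0 : forall v, 0 <= f v.
Hypothesis dens : forall A, measurable A ->
  P (Z @^-1` A) = (\int[lebesgue_rV R d]_(v in A) (f v)%:E)%E.
Let lam := lebesgue_rV R d.
Let mX : measurable X := measurable_rV_closed (support_closed HD).
Local Notation pt_ := (cbasis X D p).
Local Notation h := (mesh D).
Hypothesis h0 : 0 < h.

Definition popgram i j : R := \int[P]_w (pt_ i (Z w) * pt_ j (Z w)).

Let mcb j : measurable_fun setT (fun w => pt_ j (Z w)).
Proof. by apply: measurableT_comp => //; exact: (measurable_cbasis HD Cp). Qed.

Let cbb j v : `|pt_ j v| <= Cb.
Proof. exact: (cbasis_bound HD Cb_bound). Qed.

Let iprod i j : P.-integrable setT (EFin \o (fun w => pt_ i (Z w) * pt_ j (Z w))).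
Proof.
apply: (@integrable_bounded _ _ _ P _ (Cb * Cb)); first exact: measurable_funM.
by move=> w; rewrite normrM; apply: ler_pM.
Qed.

(** The active region lies in a cube of side 4 N h around any of its points,
    whose probability is of the order h^d. *)
Lemma popgram_diag (F : R) j : (forall v, X v -> f v <= F) ->
  popgram j j <= Cb ^+ 2 * (F * (4 * N%:R * h) ^+ d).
Proof.
move=> fF; set C := closure (active_region D (p j)).
have F0 : 0 <= F by apply: le_trans (f0 _) (fF _ (ZX point)).
have rhs0 : 0 <= Cb ^+ 2 * (F * (4 * N%:R * h) ^+ d).
  apply: mulr_ge0; first exact: sqr_ge0.
  by apply: mulr_ge0 => //; apply: exprn_ge0; rewrite !mulr_ge0// ltW.
have [[c Cc]|C0] := pselect (C !=set0); last first.
  rewrite (_ : popgram j j = 0)//.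
  rewrite /popgram -[RHS](mul0r (fine (P setT))) -Rintegral_cst//.
  apply: eq_Rintegral => w _.
  apply/eqP; rewrite mulf_eq0 orbb; apply/negPn/negP => pn.
  by apply: C0; exists (Z w); exact: (cbasis_region HD pn).
pose A := cube c (2 * N%:R * h).
have CA : C `<=` A.
  move=> v Cv i; rewrite in_itv /=.
  have := region_extent HD cX Ncells conn i Cv Cc.
  rewrite ler_norml => /andP[h1 h2].
  have Nh : 0 < N%:R * h by rewrite mulr_gt0// ltr0n.
  apply/andP; split; lra.
have mA : measurable A := measurable_cube c _.
have mZA : measurable (Z @^-1` A) by rewrite -[X in measurable X]setTI; exact: mZ.
rewrite /popgram; apply: (@le_trans _ _ (\int[P]_w (Cb ^+ 2 * \1_(Z @^-1` A) w))).
  apply: le_Rintegral => //.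
  - apply: (@integrable_bounded _ _ _ P _ (Cb ^+ 2)).
      by apply: measurable_funM => //; exact: measurable_indic.
    move=> w; rewrite normrM ger0_norm ?sqr_ge0// indicE normr_nat.
    by rewrite -[leRHS]mulr1 ler_wpM2l ?sqr_ge0//; case: (_ \in _).
  - move=> w _; have [->|pn] := eqVneq (pt_ j (Z w)) 0.
      by rewrite mul0r mulr_ge0 ?sqr_ge0.
    rewrite indicE mem_set; last first.
      by apply: CA; exact: (cbasis_region HD pn).
    rewrite mulr1 -expr2 -real_normK ?num_real// ler_sqr ?nnegrE//.
rewrite RintegralZl//; last first.
  exact: integrable_indic.
rewrite ler_wpM2l ?sqr_ge0// /Rintegral integral_indic// setIT.
have PA := law_le mX ZX mf f0 dens fF mA.
rewrite lebesgue_cube in PA; last by rewrite !mulr_ge0// ltW.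
rewrite -lee_fin fineK ?fin_num_measure//.
apply: le_trans PA _; rewrite -EFinM lee_fin ler_wpM2l//.
by rewrite (_ : 2 * (2 * N%:R * h) = 4 * N%:R * h)//; ring.
Qed.

(** One factor is bounded by Cb and the other one keeps its second moment, so
    this is of the order h^d as well. *)
Lemma pop_second_moment i j :
  \int[P]_w ((pt_ i (Z w) * pt_ j (Z w)) ^+ 2) <= Cb ^+ 2 * popgram i i.
Proof.
rewrite -RintegralZl//; apply: le_Rintegral => //.
- apply: (@integrable_bounded _ _ _ P _ ((Cb * Cb) ^+ 2)).
    by apply: measurable_funX; exact: measurable_funM.
  move=> w; rewrite normrX normrM ler_sqr ?nnegrE ?mulr_ge0//.
  by apply: ler_pM.
- exact: integrable_RZ.
- move=> w _; rewrite exprMn mulrC -expr2 ler_wpM2r ?sqr_ge0//.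
  by rewrite -real_normK ?num_real// ler_sqr ?nnegrE.
Qed.

Lemma popgram_quadratic (b : 'I_K -> R) :
  \int[P]_w ((\sum_i b i * pt_ i (Z w)) ^+ 2) =
  \sum_i \sum_j b i * popgram i j * b j.
Proof.
exact: (Rintegral_quadratic measurableT b (f := fun i w => pt_ i (Z w)) iprod).2.
Qed.

Variables (cl cf : R).
Hypothesis cf0 : 0 < cf.
Hypothesis cff : forall v, X v -> cf <= f v.
Hypothesis lower : forall j (a : 'cV[R]_K),
  cl * (a j ord0 ^+ 2 * h ^+ d) <=
  (a^T *m (\matrix_(i, j') \int[lam]_(v in active_region D (p j)) (p i v * p j' v)) *m a)
    ord0 ord0.

Let mregion j : measurable (active_region D (p j)).
Proof.
apply: fin_bigcup_measurable => [|l _].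
  by apply: (sub_finite_set (B := setT)) => //; exact: finite_finset.
by apply: measurable_rV_open; exact: (cell_open HD).
Qed.

Let region_sub j : active_region D (p j) `<=` X.
Proof. by move=> v [l _ Dv]; exact: (cell_sub HD Dv). Qed.

Let region_fin j : (lam (active_region D (p j)) < +oo)%E.
Proof.
have [M M0 HM] := compact_coord_bounded cX.
have sub : active_region D (p j) `<=` cube (0 : pt) (M + 1).
  move=> v /region_sub Xv i; rewrite in_itv /= mxE.
  have := HM v i Xv; rewrite ler_norml => /andP[h1 h2]; apply/andP; split; lra.
apply: (@le_lt_trans _ _ (lam (cube (0 : pt) (M + 1)))).
  by apply: le_measure; rewrite ?inE//; exact: measurable_cube.
by rewrite lebesgue_cube ?ltry// addr_ge0.
Qed.

(** The density is at least cf on the active region, so the lower bound for the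
    local Lebesgue integrals carries over to the law of Z. *)
Lemma popgram_region_lower j (b : 'I_K -> R) :
  cf * cl * (b j ^+ 2 * h ^+ d) <=
  \int[P]_w (\1_(active_region D (p j)) (Z w) * (\sum_i b i * pt_ i (Z w)) ^+ 2).
Proof.
set H := active_region D (p j).
have mH : measurable H by exact: mregion.
have mZH : measurable (Z @^-1` H) by rewrite -[X in measurable X]setTI; exact: mZ.
pose g v := (\sum_i b i * pt_ i v) ^+ 2.
have mpt i : measurable_fun setT (pt_ i) by exact: (measurable_cbasis HD Cp).
have mg : measurable_fun setT g.
  by apply: measurable_funX; apply: measurable_sum => i; exact: measurable_funM.
have g0 v : 0 <= g v by exact: sqr_ge0.
have iH i i' : lam.-integrable H (EFin \o (fun v => pt_ i v * pt_ i' v)).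
  apply: measurable_bounded_integrable => //; first exact: region_fin.
    by apply: measurable_funTS; exact: measurable_funM.
  exists (Cb * Cb); split; first by rewrite num_real.
  move=> M hM v _ /=; apply: le_trans (ltW hM); rewrite normrM.
  by apply: ler_pM.
have [ig quad] := Rintegral_quadratic mH b iH.
have low : cl * (b j ^+ 2 * h ^+ d) <= \int[lam]_(v in H) g v.
  have := lower j (\col_i b i); rewrite mxE => /le_trans; apply.
  rewrite /g quad le_eqVlt; apply/orP; left; apply/eqP.
  rewrite mxE exchange_big /=; apply: eq_bigr => i' _.
  rewrite !mxE mulr_suml; apply: eq_bigr => i _; rewrite !mxE; congr (_ * _ * _).
  apply: eq_Rintegral => v; rewrite inE => -[l _ Dv].
  by rewrite !(cbasis_cell HD Cp _ Dv).
have up := law_integral_ge mZ mf dens (ltW cf0) cff mH (@region_sub j) mg g0.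
rewrite -mulrA; apply: le_trans (ler_wpM2l (ltW cf0) low) _.
have iZ : P.-integrable setT (EFin \o (fun w => \1_H (Z w) * g (Z w))).
  have [iq _] := Rintegral_quadratic measurableT b (f := fun i w => pt_ i (Z w)) iprod.
  apply: (le_integrable measurableT _ _ iq).
    apply/measurable_EFinP; apply: measurable_funM.
      by apply: measurableT_comp => //; exact: measurable_indic.
    exact: measurableT_comp.
  move=> w _ /=; rewrite lee_fin normrM ler_piMl// indicE normr_nat.
  by case: (_ \in _).
rewrite -lee_fin; rewrite EFinM.
have -> : ((\int[lam]_(v in H) g v)%:E = \int[lam]_(v in H) (g v)%:E)%E.
  by rewrite /Rintegral fineK//; exact: (integrable_fin_num mH ig).
apply: le_trans up _; rewrite /Rintegral fineK; last exact: (integrable_fin_num measurableT iZ).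
rewrite [leLHS]integral_mkcond le_eqVlt; apply/orP; left; apply/eqP.
apply: eq_integral => w _; rewrite /patch indicE.
rewrite (_ : (w \in Z @^-1` H) = (Z w \in H)); last by apply/idP/idP; rewrite !inE.
by case: ifPn; rewrite ?mul1r ?mul0r.
Qed.

(** Summing the local lower bounds over j counts each point at most N times,
    since at most N active regions contain it. *)
Lemma popgram_coercive (b : 'I_K -> R) :
  cf * cl / N%:R * h ^+ d * (\sum_i b i ^+ 2) <=
  \sum_i \sum_j b i * popgram i j * b j.
Proof.
have N0R : 0 < N%:R :> R by rewrite ltr0n.
rewrite -popgram_quadratic.
set I := \int[P]_w _.
suff : cf * cl * h ^+ d * (\sum_i b i ^+ 2) <= N%:R * I.
  move=> H; rewrite -(ler_pM2l N0R); apply: le_trans H.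
  by rewrite le_eqVlt; apply/orP; left; apply/eqP; field; rewrite lt0r_neq0.
rewrite mulr_sumr; apply: (@le_trans _ _ (\sum_j
    \int[P]_w (\1_(active_region D (p j)) (Z w) * (\sum_i b i * pt_ i (Z w)) ^+ 2))).
  apply: ler_sum => j _; apply: le_trans (popgram_region_lower j b).
  by rewrite le_eqVlt; apply/orP; left; apply/eqP; ring.
have [iq _] := Rintegral_quadratic measurableT b (f := fun i w => pt_ i (Z w)) iprod.
have iZ j : P.-integrable setT (EFin \o (fun w =>
    \1_(active_region D (p j)) (Z w) * (\sum_i b i * pt_ i (Z w)) ^+ 2)).
  apply: (le_integrable measurableT _ _ iq).
    apply/measurable_EFinP; apply: measurable_funM.
      by apply: measurableT_comp => //; exact: measurable_indic.
    by apply: measurable_funX; apply: measurable_sum => i; exact: measurable_funM.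
  move=> w _ /=; rewrite lee_fin normrM ler_piMl// indicE normr_nat.
  by case: (_ \in _).
rewrite -Rintegral_sum// -RintegralZl//; apply: le_Rintegral => //.
- exact: integrable_Rsum.
- exact: integrable_RZ.
- move=> w _; rewrite -mulr_suml ler_wpM2r ?sqr_ge0//.
  under eq_bigr do rewrite indicE.
  by rewrite -natr_sum ler_nat; exact: (region_count HD Ncoact).
Qed.

(** The trace of the Gram matrix is at least K times its coercivity constant,
    and at most N Cb^2 because at most N basis functions are nonzero at a
    point. Hence K is O(h^(-d)). *)
Lemma basis_dimension : K%:R * (cf * cl * h ^+ d) <= N%:R ^+ 2 * Cb ^+ 2.
Proof.
have N0R : 0 < N%:R :> R by rewrite ltr0n.
have diag j : cf * cl / N%:R * h ^+ d <= popgram j j.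
  have := popgram_coercive (fun i => (i == j)%:R).
  rewrite (bigD1 j)//= eqxx expr1n big1 ?addr0 ?mulr1; last first.
    by move=> i /negbTE ->; rewrite expr0n.
  move=> /le_trans; apply; rewrite (bigD1 j)//= [X in _ + X]big1 ?addr0; last first.
    by move=> i /negbTE ->; rewrite big1// => l _; rewrite !mul0r.
  rewrite (bigD1 j)//= [X in _ + X]big1 ?addr0 ?eqxx ?mul1r ?mulr1//.
  by move=> i /negbTE ->; rewrite mulr0.
have tr : \sum_(j < K) popgram j j <= N%:R * Cb ^+ 2.
  rewrite -Rintegral_sum//.
  have cstE : \int[P]_w (N%:R * Cb ^+ 2) = N%:R * Cb ^+ 2.
    rewrite Rintegral_cst//.
    have -> : fine (P setT) = 1 by have -> := @probability_setT _ _ _ P.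
    by rewrite mulr1.
  rewrite -[leRHS]cstE; apply: le_Rintegral => //.
  - exact: integrable_Rsum.
  - exact: finite_measure_integrable_cst.
  - move=> w _; apply: (@le_trans _ _ (\sum_(j < K) (pt_ j (Z w) != 0)%:R * Cb ^+ 2)).
      apply: ler_sum => j _; have [->|pn] := eqVneq (pt_ j (Z w)) 0.
        by rewrite !mul0r.
      by rewrite mul1r -expr2 -real_normK ?num_real// ler_sqr ?nnegrE.
    rewrite -mulr_suml ler_wpM2r ?sqr_ge0// -natr_sum ler_nat.
    apply: leq_trans (cbasis_count HD Ncoact (Z w)).
    by rewrite -sum1_card [leqRHS]big_mkcond leq_sum.
have : \sum_(j < K) (cf * cl / N%:R * h ^+ d) <= N%:R * Cb ^+ 2.
  by apply: le_trans tr; apply: ler_sum => j _; exact: diag.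
rewrite sumr_const card_ord -[leLHS]mulr_natl => H.
have -> : K%:R * (cf * cl * h ^+ d) = N%:R * (K%:R * (cf * cl / N%:R * h ^+ d)).
  by field; rewrite lt0r_neq0.
have -> : N%:R ^+ 2 * Cb ^+ 2 = N%:R * (N%:R * Cb ^+ 2) by ring.
by rewrite ler_pM2l.
Qed.

End population_gram.

(** * Empirical Gram matrix *)

(** Each product |b i| |b j| is at most the half-sum of squares, and a row has
    at most N entries, so no power of the dimension K is lost. *)
Lemma sparse_form_bound (R : realFieldType) (K N : nat) (adj : rel 'I_K)
    (E : 'I_K -> 'I_K -> R) (tau : R) (b : 'I_K -> R) : 0 <= tau ->
  symmetric adj -> (forall i, (#|[pred j | adj i j]| <= N)%N) ->
  (forall i j, ~~ adj i j -> E i j = 0) -> (forall i j, `|E i j| <= tau) ->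
  `|\sum_i \sum_j b i * E i j * b j| <= tau * N%:R * \sum_i b i ^+ 2.
Proof.
move=> tau0 sym cnt E0 Et.
pose a i j : R := (adj i j)%:R.
have cntR i : \sum_j a i j <= N%:R.
  rewrite -natr_sum ler_nat; apply: leq_trans (cnt i).
  by rewrite -sum1_card [leqRHS]big_mkcond leq_sum.
apply: (@le_trans _ _ (\sum_i \sum_j tau / 2 * (a i j * b i ^+ 2 + a j i * b j ^+ 2))).
  apply: le_trans (ler_norm_sum _ _ _) _; apply: ler_sum => i _.
  apply: le_trans (ler_norm_sum _ _ _) _; apply: ler_sum => j _.
  rewrite /a [adj j i]sym; have [ij|ij] := boolP (adj i j); last first.
    by rewrite E0// !(mulr0, mul0r) normr0 addr0 mulr0.
  rewrite !mul1r !normrM mulrAC [leLHS]mulrC.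
  apply: le_trans (ler_wpM2r _ (Et i j)) _; first by rewrite mulr_ge0.
  rewrite mulrAC -mulrA ler_wpM2l//.
  rewrite ler_pdivlMr// -[b i ^+ 2]real_normK ?num_real// -[b j ^+ 2]real_normK ?num_real//.
  have : 0 <= (`|b i| - `|b j|) ^+ 2 by exact: sqr_ge0.
  rewrite sqrrB; lra.
under eq_bigr do rewrite -mulr_sumr big_split /=.
rewrite -mulr_sumr big_split /= [X in _ + X]exchange_big /=.
have S : \sum_i \sum_j a i j * b i ^+ 2 <= N%:R * \sum_i b i ^+ 2.
  rewrite mulr_sumr; apply: ler_sum => i _; rewrite -mulr_suml.
  by rewrite ler_wpM2r ?sqr_ge0.
set S' := \sum_i \sum_j a i j * b i ^+ 2 in S *.
have : tau * S' <= tau * (N%:R * \sum_i b i ^+ 2) by rewrite ler_wpM2l.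
rewrite mulrA; lra.
Qed.

Section empirical_matrix.
Context (R : realType) (d k K n : nat) (D : 'I_k -> set 'rV[R]_d)
  (p : 'I_K -> 'rV[R]_d -> R) (q : mindex d) (xs : nat -> 'rV[R]_d).

Let A (i : 'I_n) (j : 'I_K) : R := dcell D (mi0 d) (p j) (xs i).

Definition emp_gram : 'M[R]_K :=
  emp_mean n (fun i => Pi0 D p (xs i) *m (Pi0 D p (xs i))^T).

Lemma emp_gramE i j : emp_gram i j = gram A i j.
Proof.
rewrite /emp_gram /emp_mean mxE summxE /gram /emean; congr (_ * _).
by apply: eq_bigr => l _; rewrite mxE big_ord1 !mxE.
Qed.

Hypothesis pos : forall b : 'I_K -> R, (exists i, b i != 0) ->
  0 < \sum_i \sum_j b i * gram A i j * b j.

Lemma emp_gram_unit : emp_gram \in unitmx.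
Proof.
rewrite -row_free_unit; apply/inj_row_free => v v0.
apply/rowP => i; rewrite mxE; apply/eqP/negPn/negP => vi.
have := pos (ex_intro (fun i => v ord0 i != 0) i vi).
rewrite (_ : \sum_i _ = (v *m emp_gram *m v^T) ord0 ord0).
  by rewrite v0 mul0mx mxE ltxx.
rewrite mxE exchange_big; apply: eq_bigr => j _ /=.
rewrite !mxE mulr_suml; apply: eq_bigr => l _.
by rewrite emp_gramE.
Qed.

Lemma gamma_hat0_solves v l :
  \sum_j gamma_hat0 D p q n xs v ord0 j * gram A j l = dcell D q (p l) v.
Proof.
have : gamma_hat0 D p q n xs v *m emp_gram = (basis_vec D p q v)^T.
  by rewrite /gamma_hat0 mulmxKV// emp_gram_unit.
move/rowP/(_ l); rewrite !mxE => <-.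
by apply: eq_bigr => j _; rewrite emp_gramE.
Qed.

Lemma series_fit0_emean v g : series_fit0 D p q n xs v g =
  \sum_j gamma_hat0 D p q n xs v ord0 j * emean (fun i : 'I_n => A i j * g i).
Proof.
rewrite /series_fit0 mxE; apply: eq_bigr => j _; congr (_ * _).
rewrite /emp_mean mxE summxE /emean; congr (_ * _).
by apply: eq_bigr => i _; rewrite !mxE mulrC.
Qed.

(** The functional gamma_hat0 applied to the Gram matrix returns the
    derivatives of the basis, so the exact coefficients b come out. *)
Lemma series_fit0_span v (b : 'I_K -> R) :
  series_fit0 D p q n xs v (fun i => \sum_j b j * dcell D (mi0 d) (p j) (xs i)) =
  \sum_j b j * dcell D q (p j) v.
Proof.
rewrite series_fit0_emean.
transitivity (\sum_j \sum_l gamma_hat0 D p q n xs v ord0 j * gram A j l * b l).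
  apply: eq_bigr => j _.
  rewrite (_ : (fun i => _) = (fun i => \sum_l b l * (A i j * A i l))); last first.
    by apply/funext => i; rewrite mulr_sumr; apply: eq_bigr => l _; rewrite mulrCA.
  rewrite emean_sum mulr_sumr; apply: eq_bigr => l _.
  by rewrite emeanZ -mulrA [_ * b l]mulrC.
rewrite exchange_big; apply: eq_bigr => l _ /=.
by rewrite -mulr_suml gamma_hat0_solves mulrC.
Qed.

Lemma series_fit0D v g1 g2 : series_fit0 D p q n xs v (fun i => g1 i + g2 i) =
  series_fit0 D p q n xs v g1 + series_fit0 D p q n xs v g2.
Proof.
rewrite !series_fit0_emean -big_split; apply: eq_bigr => j _ /=.
rewrite -mulrDr; congr (_ * _); rewrite /emean -mulrDr -big_split; congr (_ * _).
by apply: eq_bigr => i _ /=; rewrite mulrDr.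
Qed.

End empirical_matrix.

Section concentration.
Context (R : realType) d0 (Omega : measurableType d0) (P : probability Omega R).

Lemma measure_union_le (I : Type) (s : seq I) (B : I -> set Omega) :
  (forall i, measurable (B i)) ->
  (P (\big[setU/set0]_(i <- s) B i) <= \sum_(i <- s) P (B i))%E.
Proof.
move=> mB; elim: s => [|i s IH]; first by rewrite !big_nil measure0.
rewrite !big_cons; apply: le_trans (measureU2 _ _ _) _ => //.
  by apply: bigsetU_measurable.
by rewrite leeD2l.
Qed.

Context d' (T' : measurableType d') (x : nat -> Omega -> T').
Hypothesis mx : forall i, measurable_fun setT (x i).
Hypothesis iidx : iid P x.

(** Both tails are instances of the one-sided inequality, for phi and for -
    phi. *)
Lemma mean_deviation (phi : T' -> R) (M v s tau : R) (n : nat) : (0 < n)%N ->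
  measurable_fun setT phi -> (forall u, `|phi u| <= M) ->
  \int[P]_w (phi (x 0%N w) ^+ 2) <= v -> 0 <= s -> s * M <= 2^-1 ->
  (P [set w | (tau <= `|emean (fun i : 'I_n => phi (x i w)) - \int[P]_w phi (x 0%N w)|)%R]
   <= (2 * expR (- (n%:R * (s * tau - 2 * s ^+ 2 * v))))%:E)%E.
Proof.
move=> n0 mphi phiM hv s0 sM.
have nR : 0 < n%:R :> R by rewrite ltr0n.
set e := \int[P]_w phi (x 0%N w).
have mphix i : measurable_fun setT (fun w => phi (x i w)) by exact: measurableT_comp.
have msum : measurable_fun setT (fun w => \sum_(i < n) phi (x i w)).
  by apply: measurable_sum => i.
pose B1 := [set w | n%:R * (e + tau) <= \sum_(i < n) phi (x i w)].
pose B2 := [set w | n%:R * (\int[P]_w - phi (x 0%N w) + tau) <= \sum_(i < n) - phi (x i w)].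
have mB1 : measurable B1.
  rewrite -[X in measurable X]setTI.
  exact: (measurable_fun_le measurableT (measurable_cst _) msum).
have mB2 : measurable B2.
  rewrite -[X in measurable X]setTI.
  apply: (measurable_fun_le measurableT (measurable_cst _)).
  by apply: measurable_sum => i; exact: measurableT_comp.
have iphi : P.-integrable setT (EFin \o (fun w => phi (x 0%N w))).
  exact: (integrable_bounded P (mphix 0%N) (fun w => phiM (x 0%N w))).
have eN : \int[P]_w - phi (x 0%N w) = - e.
  rewrite /e -[RHS]mulN1r -RintegralZl//.
  by apply: eq_Rintegral => w _; rewrite mulN1r.
have b1 := @bernstein _ _ _ P _ _ x mx iidx phi M v s tau n mphi phiM hv s0 sM.
have b2 : (P B2 <= (expR (- (n%:R * (s * tau - 2 * s ^+ 2 * v))))%:E)%E.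
  apply: (@bernstein _ _ _ P _ _ x mx iidx (fun u => - phi u) M) => //.
  - exact: measurableT_comp.
  - by move=> u; rewrite normrN.
  - by under eq_Rintegral do rewrite sqrrN.
apply: (@le_trans _ _ (P (B1 `|` B2))).
  apply: le_measure; rewrite ?inE.
  - rewrite -[X in measurable X]setTI.
    apply: (measurable_fun_le measurableT (measurable_cst _)).
    apply: measurableT_comp => //; apply: measurable_funB => //.
    by apply: measurable_funM.
  - exact: measurableU.
  - move=> w /=; rewrite ler_normr /emean => /orP[H|H]; [left|right].
    + rewrite /B1 /= -ler_pdivlMl// addrC -lerBrDr; exact: H.
    + rewrite /B2 /= eN sumrN -ler_pdivlMl// mulrN; lra.
apply: le_trans (measureU2 _ _ _) _ => //.
rewrite mulr_natl mulr2n EFinD; exact: leeD.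
Qed.

End concentration.

Lemma expR_sub1_le (R : realType) (y T : R) : `|y| <= T ->
  `|expR y - 1| <= expR T - 1.
Proof.
rewrite ler_norml => /andP[y1 y2].
rewrite ler_norml; apply/andP; split; last by rewrite lerD2r ler_expR.
have := expR_ge1Dx y; have := expR_ge1Dx T; lra.
Qed.

Section sample_gram.
Context (R : realType) (d : nat) (X : set 'rV[R]_d) (k K : nat).
Local Notation pt := 'rV[R]_d.
Context (D : 'I_k -> set pt) (p : 'I_K -> pt -> R).
Hypothesis HD : polyhedral_partition X D.
Hypothesis cX : compact X.
Variable r : nat.
Hypothesis Cp : forall l j, Ck_closure r (D l) (p j).
Variable N : nat.
Hypothesis N0 : (0 < N)%N.
Hypothesis Ncells : forall j, (#|[pred l | active (p j) (D l)]| <= N)%N.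
Hypothesis Ncoact : forall j, (#|[pred i | [exists l, active (p j) (D l) &&
                            active (p i) (D l)]]| <= N)%N.
Hypothesis conn : forall j, connected (closure (active_region D (p j))).
Variable Cb : R.
Hypothesis Cb0 : 0 <= Cb.
Hypothesis Cb_bound : forall l v j, closure (D l) v ->
  `|dlim (D l) (mi0 d) (p j) v| <= Cb.
Context d0 (Omega : measurableType d0) (P : probability Omega R).
Variables (x : nat -> Omega -> pt).
Hypothesis mx : forall i, measurable_fun setT (x i).
Hypothesis xX : forall i w, X (x i w).
Hypothesis iidx : iid P x.
Local Notation pt_ := (cbasis X D p).
Local Notation h := (mesh D).
Hypothesis h0 : 0 < h.
Local Notation G := (popgram X D p P (x 0%N)).

Definition sample n w (i j : 'I_K) : R :=
  emean (fun l : 'I_n => pt_ i (x l w) * pt_ j (x l w)).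

Definition entry_deviates n tau (ij : 'I_K * 'I_K) : set Omega :=
  [set w | tau <= `|sample n w ij.1 ij.2 - G ij.1 ij.2|].

Definition gram_deviates n tau : set Omega := \big[setU/set0]_ij entry_deviates n tau ij.

Let mpt j : measurable_fun setT (pt_ j).
Proof. exact: (measurable_cbasis HD Cp). Qed.

Let ptb j v : `|pt_ j v| <= Cb.
Proof. exact: (cbasis_bound HD Cb_bound). Qed.

Lemma measurable_entry_deviates n tau ij : measurable (entry_deviates n tau ij).
Proof.
rewrite -[X in measurable X]setTI.
apply: (measurable_fun_le measurableT (measurable_cst _)).
apply: measurableT_comp => //; apply: measurable_funB => //.
apply: measurable_funM => //; apply: measurable_sum => l.
by apply: measurable_funM; exact: (measurableT_comp (mpt _) (mx l)).
Qed.

Lemma measurable_gram_deviates n tau : measurable (gram_deviates n tau).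
Proof. by apply: bigsetU_measurable => ij _; exact: measurable_entry_deviates. Qed.

(** Union bound over the entries, each of which is a mean of n independent
    products of two basis functions. *)
Lemma gram_deviates_prob n tau s v : (0 < n)%N -> (forall i, G i i <= v) -> 0 <= s ->
  s * Cb ^+ 2 <= 2^-1 ->
  (P (gram_deviates n tau) <= ((K * K)%:R * (2 * expR (- (n%:R * (s * tau - 2 * s ^+ 2 * (Cb ^+ 2 * v))))))%:E)%E.
Proof.
move=> n0 Gv s0 sC.
apply: le_trans (measure_union_le P _ (measurable_entry_deviates n tau)) _.
apply: (@le_trans _ _ (\sum_(ij : 'I_K * 'I_K)
   (2 * expR (- (n%:R * (s * tau - 2 * s ^+ 2 * (Cb ^+ 2 * v)))))%:E)%E).
  apply: lee_sum => -[i j] _.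
  apply: (mean_deviation mx iidx (phi := fun u => pt_ i u * pt_ j u) (M := Cb ^+ 2)) => //.
  - exact: measurable_funM.
  - by move=> u; rewrite normrM expr2; apply: ler_pM.
  - apply: le_trans (pop_second_moment HD Cp Cb0 Cb_bound P (mx 0%N) i j) _.
    by rewrite ler_wpM2l ?sqr_ge0.
by rewrite sumEFin sumr_const card_prod !card_ord lee_fin -[leLHS]mulr_natl.
Qed.

Lemma gram_deviates_notin n tau w : ~ gram_deviates n tau w ->
  forall i j, `|sample n w i j - G i j| < tau.
Proof.
move=> nb i j; rewrite ltNge; apply/negP => H; apply: nb.
rewrite /gram_deviates -bigcup_seq; exists (i, j) => //=.
by rewrite mem_index_enum.
Qed.

Lemma sample_coactive n w i j :
  ~~ [exists l, active (p i) (D l) && active (p j) (D l)] -> sample n w i j = 0.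
Proof.
move=> nij; rewrite /sample /emean big1 ?mulr0// => l _.
apply/eqP; rewrite mulf_eq0; apply/negPn/negP; rewrite negb_or => /andP[pi pj].
by move: nij; rewrite (cbasis_coactive HD pi pj).
Qed.

Lemma popgram_coactive i j :
  ~~ [exists l, active (p i) (D l) && active (p j) (D l)] -> G i j = 0.
Proof.
move=> nij; rewrite /popgram -[RHS](mul0r (fine (P setT))) -Rintegral_cst//.
apply: eq_Rintegral => w _.
apply/eqP; rewrite mulf_eq0; apply/negPn/negP; rewrite negb_or => /andP[pi pj].
by move: nij; rewrite (cbasis_coactive HD pi pj).
Qed.

(** Entries of both matrices vanish unless the two basis functions share a
    cell, so deviations of eps h^d in the entries perturb the form by at most N
    eps h^d per unit of the sum of the b i ^+ 2. *)
Lemma sample_coercive n w c eps : 0 <= eps -> ~ gram_deviates n (eps * h ^+ d) w ->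
  (forall b : 'I_K -> R, c * h ^+ d * (\sum_i b i ^+ 2) <=
     \sum_i \sum_j b i * G i j * b j) ->
  forall b : 'I_K -> R, (c - N%:R * eps) * h ^+ d * (\sum_i b i ^+ 2) <=
     \sum_i \sum_j b i * sample n w i j * b j.
Proof.
move=> eps0 nb Gc b.
have hd0 : 0 < h ^+ d by exact: exprn_gt0.
pose adj : rel 'I_K := fun i j => [exists l, active (p i) (D l) && active (p j) (D l)].
have := @sparse_form_bound R K N adj (fun i j => sample n w i j - G i j)
  (eps * h ^+ d) b.
have t0 : 0 <= eps * h ^+ d by rewrite mulr_ge0// ltW.
have sym : symmetric adj.
  by move=> i j; apply/existsP/existsP => -[l]; rewrite andbC => Hl; exists l.
have E0 i j : ~~ adj i j -> sample n w i j - G i j = 0.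
  by move=> nij; rewrite sample_coactive// popgram_coactive// subrr.
have Et i j : `|sample n w i j - G i j| <= eps * h ^+ d.
  by apply: ltW; exact: gram_deviates_notin.
move=> /(_ t0 sym Ncoact E0 Et); rewrite ler_norml => /andP[H _].
have := Gc b.
have -> : \sum_i \sum_j b i * sample n w i j * b j =
  \sum_i \sum_j b i * G i j * b j +
  \sum_i \sum_j b i * (sample n w i j - G i j) * b j.
  rewrite -big_split; apply: eq_bigr => i _ /=; rewrite -big_split.
  by apply: eq_bigr => j _ /=; ring.
set s2 := \sum_i b i ^+ 2 in H *.
set g2 := \sum_i \sum_j b i * G i j * b j.
move: H; set e2 := (\sum_i \sum_j _) => H H2.
rewrite !mulrBl; lra.
Qed.

Lemma sample_diag n w eps v : ~ gram_deviates n (eps * h ^+ d) w ->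
  (forall i, G i i <= v * h ^+ d) ->
  forall i, sample n w i i <= (v + eps) * h ^+ d.
Proof.
move=> nb Gv i; have := gram_deviates_notin nb i i; have := Gv i.
rewrite ltr_norml mulrDl => H1 /andP[_ H2]; lra.
Qed.

Lemma dist1_triangle (u v c : pt) : dist1 u c <= dist1 u v + dist1 v c.
Proof.
rewrite /dist1 -big_split; apply: ler_sum => j _ /=.
by rewrite (_ : u ord0 j - c ord0 j = (u ord0 j - v ord0 j) + (v ord0 j - c ord0 j)) ?ler_normD//; ring.
Qed.

Lemma dist1_sym (u v : pt) : dist1 u v = dist1 v u.
Proof. by apply: eq_bigr => j _; rewrite distrC. Qed.

Lemma dist1_region j u v : closure (active_region D (p j)) u ->
  closure (active_region D (p j)) v -> dist1 u v <= d%:R * (N%:R * h).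
Proof.
move=> cu cv; apply: (@le_trans _ _ (\sum_(i < d) N%:R * h)).
  by apply: ler_sum => i _; exact: (region_extent HD cX Ncells conn i cu cv).
by rewrite sumr_const card_ord -[leLHS]mulr_natl.
Qed.

Variables (q : mindex d) (n : nat) (w : Omega) (x0 : pt).
Hypothesis Xx0 : X x0.
Variables (c C2 theta : R).
Hypothesis c0 : 0 < c.
Hypothesis C20 : 0 <= C2.
Hypothesis theta0 : 0 < theta.
Hypothesis coercive : forall b : 'I_K -> R, c * h ^+ d * (\sum_i b i ^+ 2) <=
     \sum_i \sum_j b i * sample n w i j * b j.
Hypothesis diag : forall i, sample n w i i <= C2 * h ^+ d.
Hypothesis small : 2 * ((expR (2 * (theta * (d%:R * N%:R))) - 1) * N%:R * C2) <= c.

Let A (i : 'I_n) (j : 'I_K) : R := dcell D (mi0 d) (p j) (x i w).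

Let AE i j : A i j = pt_ j (x i w).
Proof. by rewrite /A cbasisE. Qed.

Let gramE i j : gram A i j = sample n w i j.
Proof.
rewrite /gram /sample; congr emean; apply/funext => l; by rewrite !AE.
Qed.

Let T := theta * (d%:R * N%:R).
(* The default value 0 is taken for an empty region only, and then p j vanishes
   at every point of the support. *)
Let ref j : pt := xget 0 (closure (active_region D (p j))).
Let wt (v : pt) : R := expR (theta * (dist1 v x0 / h)).

Let refP j v : closure (active_region D (p j)) v ->
  closure (active_region D (p j)) (ref j).
Proof. by move=> cv; apply: (xgetPex 0); exists v. Qed.

Let wt_ratio u v b : dist1 u v <= b * h -> wt u <= expR (theta * b) * wt v.
Proof.
move=> uv; rewrite /wt -expRD ler_expR -mulrDr ler_pM2l// -(ler_pM2r h0).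
rewrite mulrDl !divfK ?lt0r_neq0//.
by apply: le_trans (dist1_triangle u v x0) _; rewrite lerD2r.
Qed.

Lemma sample_gram_pos (b : 'I_K -> R) : (exists i, b i != 0) ->
  0 < \sum_i \sum_j b i * gram A i j * b j.
Proof.
have hd0 : 0 < h ^+ d by exact: exprn_gt0.
move=> [i bi]; under eq_bigr do under eq_bigr do rewrite gramE.
apply: lt_le_trans (coercive b); rewrite mulr_gt0//; first exact: mulr_gt0.
rewrite (bigD1 i)//= ltr_pwDl ?exprn_even_gt0//.
by apply: sumr_ge0 => j _; exact: sqr_ge0.
Qed.

(** With weights exp (theta dist / h), two weights taken in one active region,
    whose l1 extent is at most d N h, have a ratio within exp (theta d N). For
    small theta this ratio is close to 1, as the weighted estimate requires;
    and since the derivatives of the basis at x0 vanish unless x0 lies in the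
    closure of the region, where the weights are bounded, they enter without
    loss. *)
Lemma series_fit_bound (g : nat -> R) (rho : R) :
  (forall i, (i < n)%N -> `|g i| <= rho) ->
  (series_fit0 D p q n (fun i => x i w) x0 g) ^+ 2 * (c ^+ 2 * h ^+ d) <=
  4 * expR T ^+ 4 * N%:R * C2 * rho ^+ 2 *
  (\sum_j dcell D q (p j) x0 ^+ 2) *
  emean (fun i : 'I_n => expR (- (2 * theta * (dist1 (x i w) x0 / h)))).
Proof.
move=> grho.
have hd0 : 0 < h ^+ d by exact: exprn_gt0.
rewrite series_fit0_emean.
have -> : emean (fun i : 'I_n => expR (- (2 * theta * (dist1 (x i w) x0 / h)))) =
    emean (fun i : 'I_n => (wt (x i w))^-1 ^+ 2).
  congr emean; apply/funext => i; rewrite /wt -expRN -expRM_natl; congr expR; ring.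
have T0 : 0 <= T by exact: (mulr_ge0 (ltW theta0) (mulr_ge0 (ler0n _ _) (ler0n _ _))).
have near j u v : closure (active_region D (p j)) u ->
    closure (active_region D (p j)) v -> dist1 u v <= (d%:R * N%:R) * h.
  by move=> cu cv; rewrite -mulrA; exact: dist1_region cu cv.
apply: (@weighted_fit_bound R n K N A _ c (h ^+ d) C2 (expR (2 * T) - 1)
  (expR T) (fun j => wt (ref j)) (fun i => wt (x i w))
  (fun j => gamma_hat0 D p q n (fun i => x i w) x0 ord0 j)
  (fun j => dcell D q (p j) x0)) => //.
- move=> i; rewrite (@eq_card _ _ [pred j | pt_ j (x i w) != 0%R]).
    exact: (cbasis_count HD Ncoact).
  by move=> j; rewrite !inE AE.
- by rewrite subr_ge0 -[leLHS]expR0 ler_expR mulr_ge0.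
- by move=> b; under [leRHS]eq_bigr do under eq_bigr do rewrite gramE; exact: coercive.
- by move=> j; rewrite gramE.
- by move=> j; exact: expR_gt0.
- move=> i j l; rewrite !AE => /(cbasis_region HD) cj /(cbasis_region HD) cl.
  have dj := near j _ _ (refP cj) cj; have dl := near l _ _ (refP cl) cl.
  rewrite /wt -expRB; apply: expR_sub1_le; rewrite -mulrBr -mulrBl.
  rewrite normrM (gtr0_norm theta0) /T mulrCA ler_pM2l// normrM.
  rewrite (@gtr0_norm _ h^-1) ?invr_gt0// ler_pdivrMr//.
  have t1 := dist1_triangle (ref l) (x i w) x0.
  have t2 := dist1_triangle (x i w) (ref j) x0.
  have t3 := dist1_triangle (ref j) (x i w) x0.
  have t4 := dist1_triangle (x i w) (ref l) x0.
  rewrite (dist1_sym (x i w) (ref j)) in t2; rewrite (dist1_sym (x i w) (ref l)) in t4.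
  move: dj dl; rewrite -mulrA; set bd := d%:R * N%:R * h => dj dl.
  rewrite ler_norml; apply/andP; split; lra.
- by move=> i; exact: expR_gt0.
- move=> i j; rewrite AE => /(cbasis_region HD) cj.
  by apply: wt_ratio; rewrite dist1_sym; exact: near (refP cj) cj.
- move=> j gj; have cj := dcell_neq0 HD Xx0 gj.
  have := wt_ratio (near j _ _ (refP cj) cj).
  by rewrite {2}/wt /dist1 big1 ?mul0r ?mulr0 ?expR0 ?mulr1// => i _; rewrite subrr normr0.
- by move=> l; apply: gamma_hat0_solves; exact: sample_gram_pos.
- by move=> i; exact: grho.
Qed.

End sample_gram.

(** * Stochastic order of the remainder *)

Lemma enorm_colE (R : realType) (K : nat) (A : 'cV[R]_K) :
  \sum_j A j ord0 ^+ 2 = enorm A ^+ 2.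
Proof.
rewrite /enorm sqr_sqrtr; last first.
  by apply: sumr_ge0 => i _; apply: sumr_ge0 => l _; exact: sqr_ge0.
by apply: eq_bigr => j _; rewrite big_ord1.
Qed.

Section one_step.
Context (R : realType) (d : nat) (X : set 'rV[R]_d) (k K : nat).
Local Notation pt := 'rV[R]_d.
Context (D : 'I_k -> set pt) (p : 'I_K -> pt -> R).
Hypothesis HD : polyhedral_partition X D.
Variable r : nat.
Hypothesis Cp : forall l j, Ck_closure r (D l) (p j).

Lemma dcell_span alpha (b : 'I_K -> R) v : (mdeg alpha <= r)%N -> X v ->
  dcell D alpha (fun u => \sum_j b j * p j u) v =
  \sum_j b j * dcell D alpha (p j) v.
Proof.
move=> ar Xv; have [l clv cv] := cellP HD Xv.
by rewrite /dcell cv; apply: (dlim_lin (r := r)) => //; exact: (cell_open HD).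
Qed.

(** The approximant s is reproduced by the fit, so that it can be subtracted
    from the data and from the target: what remains are the approximation
    errors, of order 0 at the regressors and of order q at x0. *)
Lemma oracle_decomposition (q : mindex d) (n : nat) (xs : nat -> pt) (x0 : pt)
    (mu s bias0 : pt -> R) (biasq dq : R) :
  (forall i, X (xs i)) -> X x0 -> (mdeg q <= r)%N -> in_span p s ->
  (forall b : 'I_K -> R, (exists i, b i != 0) ->
   0 < \sum_i \sum_j b i *
     gram (fun (i : 'I_n) j => dcell D (mi0 d) (p j) (xs i)) i j * b j) ->
  (series_fit0 D p q n xs x0 (fun i => mu (xs i)) - dq) -
  (biasq - series_fit0 D p q n xs x0 (fun i => bias0 (xs i))) =
  series_fit0 D p q n xs x0
    (fun i => mu (xs i) - dcell D (mi0 d) s (xs i) + bias0 (xs i)) -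
  (dq - dcell D q s x0 + biasq).
Proof.
move=> Xxs Xx0 qr [b ->] pos.
rewrite (dcell_span b qr Xx0).
have m0r : (mdeg (mi0 d) <= r)%N by rewrite mdeg0.
have -> : (fun i => mu (xs i) - dcell D (mi0 d) (fun v => \sum_j b j * p j v) (xs i) +
    bias0 (xs i)) =
  (fun i => (mu (xs i) + bias0 (xs i)) +
    (\sum_j (- b j) * dcell D (mi0 d) (p j) (xs i))).
  apply/funext => i; rewrite (dcell_span b m0r (Xxs i)).
  under [in RHS]eq_bigr do rewrite mulNr.
  by rewrite sumrN addrAC.
rewrite !series_fit0D (series_fit0_span q pos x0 (fun j => - b j)).
have -> : \sum_j - b j * dcell D q (p j) x0 = - \sum_j b j * dcell D q (p j) x0.
  by rewrite -sumrN; apply: eq_bigr => j _; rewrite mulNr.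
ring.
Qed.

End one_step.

Section limsup.
Context (R : realType).

Lemma limf_esup_le (T : choiceType) (Y : filteredType T) (F : set_system Y)
    (u : Y -> \bar R) (c : \bar R) :
  F [set t | (u t <= c)%E] -> (limf_esup u F <= c)%E.
Proof.
move=> Fu; apply: ereal_inf_le; exists (ereal_sup (u @` [set t | (u t <= c)%E])).
  by exists [set t | (u t <= c)%E].
by apply: ge_ereal_sup => _ [t ut <-].
Qed.

(** The limit superior in e of quantities that are eventually at most eta, for
    every eta > 0. *)
Lemma bigO_in_prob_of_tail d0 (Omega : measurableType d0) (P : probability Omega R)
    (a : nat -> Omega -> R) (b : nat -> R) :
  (forall eta : R, 0 < eta -> exists e0 : R, forall e, e0 < e ->
     \forall n \near \oo, (P [set w | (e <= `|a n w / b n|)%R] <= eta%:E)%E) ->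
  bigO_in_prob P a b.
Proof.
move=> H; rewrite /bigO_in_prob.
apply/eqP; rewrite eq_le; apply/andP; split; last first.
  apply: limf_esup_ge0 => [|e]; first exact: filter_not_empty.
  apply: limf_esup_ge0 => [|n]; first exact: filter_not_empty.
  exact: measure_ge0.
apply/lee_addgt0Pr => eta eta0; rewrite add0e.
have [e0 He] := H _ eta0.
apply: limf_esup_le; near=> e; apply: limf_esup_le; apply: He.
by near: e; apply: nbhs_pinfty_gt; rewrite num_real.
Unshelve. all: by end_near. Qed.

End limsup.

Lemma markov_emean (R : realType) d0 (Omega : measurableType d0)
    (P : probability Omega R) n (g : 'I_n -> Omega -> R) (b a : R) :
  (0 < n)%N -> (forall i, measurable_fun setT (g i)) -> (forall i w, 0 <= g i w) ->
  (forall i, (\int[P]_w (g i w)%:E <= b%:E)%E) -> 0 < a ->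
  (P [set w | (a <= emean (fun i => g i w))%R] <= (b / a)%:E)%E.
Proof.
move=> n0 mg g0 gb a0.
have nR : 0 < n%:R :> R by rewrite ltr0n.
have me : measurable_fun setT (fun w => emean (fun i => g i w)).
  by apply: measurable_funM => //; exact: measurable_sum.
have e0 w : 0 <= emean (fun i => g i w).
  by apply: mulr_ge0; [rewrite invr_ge0 ltW|apply: sumr_ge0 => i _; exact: g0].
rewrite EFinM muleC lee_pdivlMl//; apply: le_trans (markov_nonneg P me e0 (ltW a0)) _.
rewrite /emean; under eq_integral do rewrite EFinM -sumEFin.
rewrite ge0_integralZl//; last 2 first.
- by apply: emeasurable_sum => i; exact/measurable_EFinP.
- by move=> w _; apply: sume_ge0 => i _; rewrite lee_fin.
rewrite ge0_integral_sum//; last 2 first.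
- by move=> i; exact/measurable_EFinP.
- by move=> i w _; rewrite lee_fin.
apply: (@le_trans _ _ ((n%:R^-1)%:E * \sum_(i < n) b%:E)%E).
  apply: lee_wpmul2l; first by rewrite lee_fin invr_ge0 ltW.
  by apply: lee_sum => i _; exact: gb.
by rewrite sumEFin sumr_const card_ord -EFinM -(mulr_natl b) mulKf ?lt0r_neq0.
Qed.

Lemma measurable_series_fit (R : realType) (d : nat) d0 (Omega : measurableType d0)
    (X : set 'rV[R]_d) (k K r : nat) (D : 'I_k -> set 'rV[R]_d)
    (p : 'I_K -> 'rV[R]_d -> R) (x : nat -> Omega -> 'rV[R]_d) q n v
    (g : 'rV[R]_d -> R) :
  polyhedral_partition X D -> (forall l j, Ck_closure r (D l) (p j)) ->
  (forall i, measurable_fun setT (x i)) -> (forall i w, X (x i w)) ->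
  measurable_fun X g ->
  measurable_fun setT
    (fun w => series_fit0 D p q n (fun i => x i w) v (fun i => g (x i w))).
Proof.
move=> HD Cp mx xX mg; under eq_fun do rewrite series_fit0E.
apply: measurable_sum => i; apply: measurable_funM.
  have mw := measurable_fit_weight HD Cp xX q v (ltn_ord i).
  exact: (measurable_fun_firstType mx mw).
apply: (@measurable_comp _ _ _ _ _ _ X g) => //.
- exact: measurable_rV_closed (support_closed HD).
- by move=> _ [w _ <-]; exact: xX.
Qed.

Lemma fit_error_ratio (R : realType) (t c hd E Cr Cq hm hq S2 e M : R) :
  0 < c -> 0 < hd -> 0 < hm -> 0 < hq -> 0 <= E -> 0 <= M ->
  0 <= S2 -> S2 <= (Cq / hq) ^+ 2 -> 0 <= e -> e <= M * hd ->
  t ^+ 2 * (c ^+ 2 * hd) <= E * (`|Cr| * hm) ^+ 2 * S2 * e ->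
  `|t / (hm / hq)| <= Num.sqrt (E * Cr ^+ 2 * Cq ^+ 2 / c ^+ 2 * M).
Proof.
move=> c0 hd0 hm0 hq0 E0 M0 S0 S2l e0 eM H.
rewrite -[leLHS]sqrtr_sqr ler_wsqrtr//.
have c20 : 0 < c ^+ 2 by exact: exprn_gt0.
have H1 : t ^+ 2 * (c ^+ 2 * hd) <=
    E * (`|Cr| * hm) ^+ 2 * (Cq / hq) ^+ 2 * (M * hd).
  apply: le_trans H _; apply: ler_pM => //.
    by apply: mulr_ge0 => //; apply: mulr_ge0 => //; exact: sqr_ge0.
  by apply: ler_wpM2l => //; apply: mulr_ge0 => //; exact: sqr_ge0.
rewrite -(ler_pM2r (mulr_gt0 c20 hd0)) -(ler_pM2r (exprn_gt0 2 hm0)).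
rewrite (_ : (t / (hm / hq)) ^+ 2 * (c ^+ 2 * hd) * hm ^+ 2 =
  t ^+ 2 * (c ^+ 2 * hd) * hq ^+ 2); last by field; rewrite !lt0r_neq0.
apply: le_trans (ler_wpM2r (sqr_ge0 hq) H1) _.
rewrite le_eqVlt; apply/orP; left; apply/eqP.
by rewrite !exprMn real_normK ?num_real//; field; rewrite !lt0r_neq0.
Qed.

Lemma iid_snd (R : realType) d0 (Omega : measurableType d0) (P : probability Omega R)
  d1 d2 (T1 : measurableType d1) (T2 : measurableType d2)
  (y : nat -> Omega -> T1) (x : nat -> Omega -> T2) :
  iid P (fun i w => (y i w, x i w)) -> iid P x.
Proof.
have pre i (A : set T2) : x i @^-1` A = (fun w => (y i w, x i w)) @^-1` ([set: T1] `*` A).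
  by apply/seteqP; split => w; [split|case].
move=> [ind idd]; split.
  move=> s A us mA.
  have := ind s (fun i => [set: T1] `*` A i) us (fun i => measurableX measurableT (mA i)).
  under eq_bigcapr do rewrite -pre.
  by under [in RHS]eq_bigr do rewrite -pre.
by move=> i j A mA; rewrite !pre; apply: idd; exact: measurableX.
Qed.

(** The K^2 entries are at most Ck^2 n^2 in number, because K h^d <= Ck and n
    h^d >= 1, whereas each exponential is at most n^(-3) since n h^d s >= 3 ln
    n. *)
Lemma union_bound_rate (R : realType) (K Ck hd n s eta : R) :
  0 <= K -> 0 < hd -> 0 <= Ck -> 0 < s -> K * hd <= Ck ->
  expR 1 <= n -> ln n / (n * hd) <= 1 -> ln n / (n * hd) <= s / 3 ->
  4 * Ck ^+ 2 <= eta * n ->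
  K * K * (2 * expR (- (n * hd * s))) <= eta / 2.
Proof.
move=> K0 hd0 Ck0 s0 KC en l1 l2 Cn.
have n0 : 0 < n by apply: lt_le_trans en; exact: expR_gt0.
have nh : 0 < n * hd by exact: mulr_gt0.
have ln1 : 1 <= ln n by rewrite -[leLHS]expRK ler_ln ?posrE ?expR_gt0.
have nh1 : 1 <= n * hd.
  by apply: le_trans ln1 _; move: l1; rewrite ler_pdivrMr// mul1r.
have Kn : K <= Ck * n.
  rewrite -(ler_pM2r hd0); apply: le_trans KC _.
  by rewrite -mulrA -[leLHS]mulr1 ler_wpM2l.
have e3 : expR (- (n * hd * s)) <= n^-1 ^+ 3.
  rewrite -{2}(@lnK _ n) ?posrE// -expRN -expRM_natl ler_expR.
  move: l2; rewrite ler_pdivrMr// => l2; lra.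
apply: (@le_trans _ _ ((Ck * n) * (Ck * n) * (2 * n^-1 ^+ 3))).
  apply: ler_pM.
  - exact: mulr_ge0.
  - by rewrite mulr_ge0// expR_ge0.
  - exact: ler_pM.
  - by rewrite ler_pM2l.
rewrite (_ : _ * (2 * _) = (2 * Ck ^+ 2) / n); last by field; rewrite lt0r_neq0.
rewrite ler_pdivrMr//; lra.
Qed.

Lemma chernoff_scale (R : realType) (a b g : R) : 0 <= a -> 0 <= b -> 0 < g ->
  exists2 s : R, 0 < s & s * a <= 2^-1 /\ 2 * s * b <= g / 2.
Proof.
move=> a0 b0 g0.
have bg : 0 <= 4 * b / g by rewrite divr_ge0 ?mulr_ge0// ltW.
have den0 : 0 < 2 * (a + 1) + 4 * b / g by lra.
exists (2 * (a + 1) + 4 * b / g)^-1; first by rewrite invr_gt0.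
split; first by rewrite ler_pdivrMl//; lra.
rewrite mulrAC ler_pdivrMr//.
have -> : g / 2 * (2 * (a + 1) + 4 * b / g) = g * (a + 1) + 2 * b.
  by field; rewrite lt0r_neq0.
have : 0 <= g * (a + 1) by rewrite mulr_ge0 ?addr_ge0// ltW.
lra.
Qed.

Lemma measurable_error_tail (R : realType) d0 (Omega : measurableType d0)
    (F G : Omega -> R) (a b c e : R) :
  measurable_fun setT F -> measurable_fun setT G ->
  measurable [set w | e <= `|((F w - a) - (b - G w)) / c|].
Proof.
move=> mF mG; rewrite -[X in measurable X]setTI.
apply: (measurable_fun_le measurableT (measurable_cst _)).
apply: measurableT_comp => //; apply: measurable_funM => //.
by apply: measurable_funB; apply: measurable_funB.
Qed.

Lemma deviation_exponent (R : realType) (s g a hd : R) : 0 < s -> 0 < hd ->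
  2 * s * a <= g / 2 -> hd * (s * g / 2) <= s * (g * hd) - 2 * s ^+ 2 * (a * hd).
Proof.
move=> s0 hd0 H.
rewrite (_ : _ - _ = hd * (s * (g - 2 * s * a))); last by ring.
rewrite ler_pM2l// -mulrA ler_pM2l//; lra.
Qed.

Lemma markov_budget (R : realType) (F a hd c eta : R) : 0 < eta -> 0 < hd ->
  F * (a * hd) * c <= eta / 2 * ((2 * (F * a * c) / eta + 1) * hd).
Proof.
move=> eta0 hd0.
rewrite (_ : eta / 2 * _ = F * (a * hd) * c + eta / 2 * hd); last first.
  by field; rewrite lt0r_neq0.
by rewrite lerDl mulr_ge0// ?divr_ge0// ltW.
Qed.

(** Off two events of small probability, a deviation of the empirical Gram
    matrix and an excess of the exponentially weighted sample mean over M h^d,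
    the fit of the approximation error is at most sqrt (C5 M) times the rate.
    The first probability vanishes because ln n / (n h^d) does; the second one
    is made small by the choice of M, with Markov's inequality. The factors of
    h cancel: coercivity contributes h^(-d), the weighted mean h^d, the
    derivatives of the basis at x0 contribute h^(-[q]), and the error itself
    h^(m + rho). *)
Lemma series_fit_bias_rate (R : realType) (d0 : measure_display)
    (Omega : measurableType d0) (P : probability Omega R)
    (d : nat) (d_gt0 : (0 < d)%N) (q : mindex d)
    (X : set 'rV[R]_d) (mu sigma2 f : 'rV[R]_d -> R) (S : nat) (rho : R)
    (x : nat -> {RV P >-> 'rV[R]_d}) (y eps : nat -> {RV P >-> R})
    (kappa : nat -> nat) (Delta : forall n, 'I_(kappa n) -> set 'rV[R]_d)
    (m varsigma : nat) (K : nat -> nat)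
    (p : forall n, 'I_(K n) -> 'rV[R]_d -> R)
    (Lambda : nat -> {fset mindex d})
    (B : nat -> mindex d -> mindex d -> 'rV[R]_d -> R)
    (h := fun n => mesh (Delta n))
    (bias := fun n => lead_bias X mu m (Delta n) (Lambda n) (B n))
    (fit := fun n w => series_fit0 (Delta n) (p n) q n (fun i => x i w)) :
  data_generating_process X mu sigma2 f S rho q x y eps ->
  (forall n, polyhedral_partition X (Delta n)) ->
  local_basis Delta m varsigma p q ->
  approximation_error X mu S rho Delta m varsigma p Lambda B ->
  (fun n => ln n%:R / (n%:R * h n ^+ d)) @ \oo --> (0 : R) ->
  forall x0, X x0 ->
  bigO_in_prob P
    (fun n w =>
       (fit n w x0 (fun i => mu (x i w)) - dlim X° q mu x0) -
       (bias n q x0 - fit n w x0 (fun i => bias n (mi0 d) (x i w))))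
    (fun n => h n `^ (m%:R + rho - (mdeg q)%:R)).
Proof.
move=> dgp HP lb ae lnh x0 Xx0.
have cX := dgp_compact dgp.
have mX n : measurable X := measurable_rV_closed (support_closed (HP n)).
have mx i : measurable_fun setT (x i : Omega -> 'rV[R]_d) by exact: measurable_funPT.
have xX i w : X (x i w) := dgp_regressor dgp i w.
have iidx : iid P (fun i => (x i : Omega -> 'rV[R]_d)) := iid_snd (dgp_iid dgp).
have mf := dgp_density_measurable dgp; have f0 := dgp_density_ge0 dgp.
have dens := dgp_density dgp.
have [cf cf0 cff] := dgp_density_bound dgp.
have [F HF] : exists F, forall v, X v -> f v <= F.
  have [c _ HC] := compact_EVT_max (ex_intro _ x0 Xx0) cX (dgp_density_continuous dgp).
  by exists (f c) => v Xv; apply: HC; rewrite inE.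
have F0 : 0 <= F by apply: le_trans (f0 _) (HF _ Xx0).
have h0 n : 0 < h n.
  have [l _ _] := cellP (HP n) Xx0.
  apply: lt_le_trans (le_bigmax _ (fun l => diam (Delta n l)) l).
  apply: (diam_gt0 d_gt0 cX (cell_sub (HP n) (l := l)) (@cell_open _ _ _ _ _ (HP n) l)).
  by have [] := cells_polyhedral (HP n) l.
have hd0 n : 0 < h n ^+ d by exact: exprn_gt0.
have Cp := lb_smooth lb.
have [N' HN'] := lb_count lb; pose N := N'.+1.
have HN1 n j : (#|[pred l | active (p n j) (Delta n l)]| <= N)%N.
  by apply: leq_trans (HN' n j).1 _; exact: leqnSn.
have HN2 n j : (#|[pred i | [exists l, active (p n j) (Delta n l) &&
    active (p n i) (Delta n l)]]| <= N)%N.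
  by apply: leq_trans (HN' n j).2 _; exact: leqnSn.
have [cl cl0 nlow] := lb_gram lb.
have /andP[qv vm] := lb_varsigma lb.
have m0v : (mdeg (mi0 d) <= varsigma.+1)%N by rewrite mdeg0.
have [Cb' nub] := lb_upper lb m0v; pose Cb := `|Cb'|.
have [Cq nuq] := lb_upper lb (leqW qv).
have [s [sspan sapp]] := ae_approx ae.
have m0v' : (mdeg (mi0 d) <= varsigma)%N by rewrite mdeg0.
have [Cr nr] := sapp _ m0v'.
have [Crq nrq] := sapp _ qv.
have NR : 0 < N%:R :> R by rewrite ltr0n.
have dR : 0 < d%:R :> R by rewrite ltr0n.
(* a deviation of the empirical Gram matrix by eg still leaves half of the
   population coercivity constant *)
pose cG := cf * cl / N%:R.
have cG0 : 0 < cG by rewrite divr_gt0// mulr_gt0.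
pose eg := cG / (2 * N%:R).
have eg0 : 0 < eg by rewrite divr_gt0// mulr_gt0.
pose c1 := cG - N%:R * eg.
have c1E : c1 = cG / 2 by rewrite /c1 /eg; field; rewrite lt0r_neq0.
have c10 : 0 < c1 by rewrite c1E divr_gt0.
pose v := Cb ^+ 2 * (F * (4 * N%:R) ^+ d).
have v0 : 0 <= v.
  by rewrite /v mulr_ge0 ?sqr_ge0// mulr_ge0// exprn_ge0// mulr_ge0.
pose C2 := v + eg.
have C20 : 0 < C2 by rewrite ltr_wpDl.
(* theta is chosen so that exp (2 theta d N) = 1 + eta1, where eta1 makes the
   smallness condition on the weights an equality *)
pose eta1 := c1 / (2 * N%:R * C2).
have eta10 : 0 < eta1 by rewrite divr_gt0// mulr_gt0// mulr_gt0.
pose theta := ln (1 + eta1) / (2 * (d%:R * N%:R)).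
have theta0 : 0 < theta.
  by rewrite divr_gt0 ?ln_gt0 ?ltrDl// mulr_gt0// mulr_gt0.
have small : 2 * ((expR (2 * (theta * (d%:R * N%:R))) - 1) * N%:R * C2) <= c1.
  have -> : 2 * (theta * (d%:R * N%:R)) = ln (1 + eta1).
    by rewrite /theta; field; rewrite !lt0r_neq0.
  rewrite lnK ?posrE ?addr_gt0// le_eqVlt; apply/orP; left; apply/eqP.
  by rewrite /eta1; field; rewrite !lt0r_neq0.
pose T := theta * (d%:R * N%:R).
have theta2 : 0 < 2 * theta by rewrite mulr_gt0.
have [CS CS0 HCS] := geometric_shell_bound d theta2.
pose C6 := F * 2 ^+ d * CS.
have C60 : 0 <= C6 by rewrite mulr_ge0// mulr_ge0// exprn_ge0.
pose C5 := 4 * expR T ^+ 4 * N%:R * C2 * Cr ^+ 2 * Cq ^+ 2 / c1 ^+ 2.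
have Cb20 : 0 <= Cb ^+ 2 by exact: sqr_ge0.
(* sB is the scale of the exponential inequality: small enough for its validity
   and for the quadratic term to be at most half of the linear one *)
have [sB sB0 [sBC sBv]] := chernoff_scale Cb20 (mulr_ge0 Cb20 v0) eg0.
pose sx := sB * eg / 2.
have sx0 : 0 < sx by rewrite divr_gt0// mulr_gt0.
pose Ck := N%:R ^+ 2 * Cb ^+ 2 / (cf * cl).
have Ck0 : 0 <= Ck.
  by apply: divr_ge0; [exact: (mulr_ge0 (sqr_ge0 _) Cb20)|exact: ltW (mulr_gt0 cf0 cl0)].
apply: bigO_in_prob_of_tail => eta eta0.
(* C6 h^d bounds the mean of the exponential weights, so that Markov's
   inequality at level M h^d gives probability at most eta / 2 *)
pose M := 2 * C6 / eta + 1.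
have M0 : 0 < M.
  by rewrite ltr_wpDl//; apply: divr_ge0; [rewrite mulr_ge0|exact: ltW].
exists (`|Crq| + Num.sqrt (C5 * M)) => e he.
near=> n.
have n_gt0 : (0 < n)%N by near: n; exists 1%N.
have n_e : expR 1 <= n%:R :> R by near: n; exact: nbhs_infty_ger.
have n_Ck : 4 * Ck ^+ 2 <= eta * n%:R.
  rewrite -ler_pdivrMl//; near: n; exact: nbhs_infty_ger.
have ln_1 : ln n%:R / (n%:R * h n ^+ d) <= 1.
  by near: n; exact: (cvgr_le _ lnh _ ltr01).
have ln_sx : ln n%:R / (n%:R * h n ^+ d) <= sx / 3.
  by near: n; apply: (cvgr_le _ lnh); rewrite divr_gt0.
have nub_n : forall l u, closure (Delta n l) u ->
  enorm (\col_j dlim (Delta n l) (mi0 d) (p n j) u) <= Cb' * mesh (Delta n) ^- mdeg (mi0 d).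
  by near: n.
have nuq_n : forall l u, closure (Delta n l) u ->
  enorm (\col_j dlim (Delta n l) q (p n j) u) <= Cq * mesh (Delta n) ^- mdeg q.
  by near: n.
have nlow_n : forall j (a : 'cV[R]_(K n)),
    cl * (a j ord0 ^+ 2 * mesh (Delta n) ^+ d) <=
    (a^T *m (\matrix_(i, j') \int[lebesgue_rV R d]_(u in
        active_region (Delta n) (p n j)) (p n i u * p n j' u)) *m a) ord0 ord0.
  by near: n.
have nr_n : forall u, X u ->
    `|dlim X° (mi0 d) mu u - dcell (Delta n) (mi0 d) (s n) u +
      lead_bias X mu m (Delta n) (Lambda n) (B n) (mi0 d) u| <=
    Cr * mesh (Delta n) `^ (m%:R + rho - (mdeg (mi0 d))%:R).
  by near: n.
have nrq_n : forall u, X u ->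
    `|dlim X° q mu u - dcell (Delta n) q (s n) u +
      lead_bias X mu m (Delta n) (Lambda n) (B n) q u| <=
    Crq * mesh (Delta n) `^ (m%:R + rho - (mdeg q)%:R).
  by near: n.
have Cb0 : 0 <= Cb by exact: normr_ge0.
(* one coordinate is at most the Euclidean norm *)
have Cb_bound l u j : closure (Delta n l) u ->
    `|dlim (Delta n l) (mi0 d) (p n j) u| <= Cb.
  move=> clu; apply: le_trans (ler_norm Cb').
  have := nub_n l u clu; rewrite mdeg0 expr0 invr1 mulr1; apply: le_trans.
  rewrite -[leRHS]ger0_norm ?sqrtr_ge0// -ler_sqr ?nnegrE// !real_normK ?num_real//.
  rewrite -enorm_colE (bigD1 j)//= mxE lerDl.
  by apply: sumr_ge0 => i _; exact: sqr_ge0.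
have mZ0 := mx 0%N; have ZX0 := xX 0%N; have dens0 := dens 0%N.
pose tau := eg * h n ^+ d.
pose Bad := gram_deviates X (Delta n) (p n) P (fun i => x i : Omega -> 'rV[R]_d) n tau.
have mBad : measurable Bad.
  exact: (measurable_gram_deviates (HP n) (Cp n) P mx n tau).
have Gdiag i : popgram X (Delta n) (p n) P (x 0%N) i i <= v * h n ^+ d.
  apply: le_trans (popgram_diag (HP n) cX (Cp n) (isT : (0 < N)%N) (HN1 n)
    (lb_connected lb (n := n)) Cb0 Cb_bound mZ0 ZX0 mf f0 dens0 (h0 n) i HF) _.
  by rewrite -/(h n) exprMn le_eqVlt; apply/orP; left; apply/eqP; rewrite /v; ring.
have PBad : (P Bad <= (eta / 2)%:E)%E.
  apply: le_trans (gram_deviates_prob (HP n) (Cp n) Cb0 Cb_bound mx iidx tau n_gt0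
    Gdiag (ltW sB0) sBC) _.
  rewrite lee_fin.
  apply: le_trans (@union_bound_rate R (K n)%:R Ck (h n ^+ d) n%:R sx eta _ _ _ _ _ _ _ _ _).
  - rewrite natrM ler_wpM2l ?mulr_ge0// ler_wpM2l// ler_expR lerN2 -mulrA ler_wpM2l//.
    by rewrite /tau /sx [Cb ^+ 2 * _]mulrA; exact: deviation_exponent.
  - exact: ler0n.
  - exact: hd0.
  - exact: Ck0.
  - exact: sx0.
  - have := basis_dimension (HP n) cX (Cp n) (isT : (0 < N)%N) (HN2 n) Cb0 Cb_bound
      mZ0 mf dens0 cf0 cff nlow_n.
    rewrite /Ck ler_pdivlMr ?mulr_gt0// => H.
    by rewrite -mulrA [h n ^+ d * _]mulrC.
  - exact: n_e.
  - exact: ln_1.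
  - exact: ln_sx.
  - exact: n_Ck.
pose decay (i : 'I_n) w := expR (- (2 * theta * (dist1 (x i w) x0 / h n))).
pose Far := [set w | M * h n ^+ d <= emean (fun i => decay i w)].
have mdecay i : measurable_fun setT (decay i).
  apply: measurableT_comp => //; apply: measurableT_comp => //.
  apply: measurable_funM => //; apply: measurable_funM => //.
  exact: (measurableT_comp (measurable_dist1 x0) (mx i)).
have mFar : measurable Far.
  rewrite -[X in measurable X]setTI.
  apply: (measurable_fun_le measurableT (measurable_cst _)).
  by apply: measurable_funM => //; exact: measurable_sum.
have PFar : (P Far <= (eta / 2)%:E)%E.
  apply: le_trans (@markov_emean _ _ _ P n decay (F * (2 * h n) ^+ d * CS) (M * h n ^+ d)
    n_gt0 mdecay _ _ _) _.
  - by move=> i w; exact: expR_ge0.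
  - move=> i; exact: (exponential_moment cX (mX 0%N) (mx i) (xX i) mf f0 (dens i)
      HF theta2 (h0 n) Xx0 HCS).
  - exact: mulr_gt0.
  - rewrite lee_fin ler_pdivrMr ?mulr_gt0// exprMn.
    exact: markov_budget.
pose hm := h n `^ (m%:R + rho); pose hq := h n ^+ mdeg q.
have hm0 : 0 < hm by exact: powR_gt0.
have hq0 : 0 < hq by exact: exprn_gt0.
have bE : h n `^ (m%:R + rho - (mdeg q)%:R) = hm / hq.
  by rewrite powRB ?lt0r_neq0 ?implybT// powR_mulrn// ltW.
set A := [set w | _].
have mA : measurable A.
  have mb : measurable_fun X (bias n (mi0 d)).
    apply: (measurable_lead_bias (HP n) (dgp_mu_smooth dgp) (ae_smoothness ae)).
      by move=> u; exact: (ae_Lambda ae).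
    by move=> u uL l; exact: (ae_B_continuous ae uL m0v').
  have mmu : measurable_fun X mu.
    exact: measurable_fun_within_continuous (support_closed (HP n)) (dgp_mu_continuous dgp).
  exact: (measurable_error_tail _ _ _ _
    (measurable_series_fit q n x0 (HP n) (Cp n) mx xX mmu)
    (measurable_series_fit q n x0 (HP n) (Cp n) mx xX mb)).
suff AB : A `<=` Bad `|` Far.
  apply: (@le_trans _ _ (P (Bad `|` Far))).
    by apply: le_measure => //; rewrite inE//; exact: measurableU.
  apply: (@le_trans _ _ (P Bad + P Far)%E); first exact: measureU2.
  by rewrite [eta in leRHS]splitr EFinD; exact: leeD.
move=> w Aw; apply: contrapT => /not_orP[nb nf].
have {nf}nf : emean (fun i => decay i w) <= M * h n ^+ d.
  by rewrite leNgt; apply/negP => H; apply: nf; exact: ltW.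
have coer := sample_coercive (HP n) (HN2 n) (h0 n) (ltW eg0) nb
  (popgram_coercive (HP n) cX (Cp n) (isT : (0 < N)%N) (HN2 n) Cb0 Cb_bound
      mZ0 mf dens0 cf0 cff nlow_n).
have diag := sample_diag nb Gdiag.
have pos := sample_gram_pos xX (h0 n) c10 coer.
pose g i := mu (x i w) - dcell (Delta n) (mi0 d) (s n) (x i w) + bias n (mi0 d) (x i w).
have gr i : (i < n)%N -> `|g i| <= `|Cr| * hm.
  move=> _; have := nr_n _ (xX i w).
  rewrite mdeg0 subr0 (dlim0_within (dgp_mu_continuous dgp)) => //; last 2 first.
  - exact: interior_subset.
  - by apply: (support_closure_interior (HP n)).
  move=> H; rewrite /g /bias; apply: (le_trans H).
  by rewrite ler_wpM2r ?ler_norm// ltW.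
have S2l : \sum_j dcell (Delta n) q (p n j) x0 ^+ 2 <= (Cq / hq) ^+ 2.
  have [l clx cx] := cellP (HP n) Xx0.
  under eq_bigr do rewrite /dcell cx.
  have := nuq_n l x0 clx; rewrite -/(h n) -/hq => H.
  have <- : enorm (\col_j dlim (Delta n l) q (p n j) x0) ^+ 2 =
      \sum_j dlim (Delta n l) q (p n j) x0 ^+ 2.
    by rewrite -enorm_colE; apply: eq_bigr => j _; rewrite mxE.
  by rewrite ler_pXn2r// nnegrE ?sqrtr_ge0//; apply: le_trans H; exact: sqrtr_ge0.
have fb := series_fit_bound (HP n) cX (HN1 n) (HN2 n) (lb_connected lb (n := n)) xX (h0 n)
  q Xx0 c10 (ltW C20) theta0 coer diag small gr.
have := Aw; rewrite /A /= /fit.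
rewrite (oracle_decomposition (HP n) (Cp n) mu (bias n (mi0 d)) _ _ _ Xx0 (leqW qv) (sspan n)) //.
apply/negP; rewrite -ltNge bE mulrBl.
apply: le_lt_trans (ler_normB _ _) _; apply: le_lt_trans he; rewrite addrC.
apply: lerD.
  rewrite normrM normfV (gtr0_norm (divr_gt0 hm0 hq0)) ler_pdivrMr ?divr_gt0//.
  have H := nrq_n _ Xx0; rewrite -/(h n) bE in H.
  by apply: (le_trans H); rewrite ler_wpM2r ?ler_norm// ltW// divr_gt0.
apply: (fit_error_ratio c10 (hd0 n) hm0 hq0 _ (ltW M0) _ S2l _ nf fb).
- by rewrite !mulr_ge0 ?exprn_ge0 ?expR_ge0// ltW.
- by apply: sumr_ge0 => j _; exact: sqr_ge0.
- by apply: mulr_ge0; [rewrite invr_ge0|apply: sumr_ge0 => i _; exact: expR_ge0].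
Unshelve. all: by end_near. Qed.

Theorem lemma3p1 (R : realType) (d0 : measure_display)
    (Omega : measurableType d0) (P : probability Omega R)
    (d : nat) (d_gt0 : (0 < d)%N) (q : mindex d)
    (X : set 'rV[R]_d) (mu sigma2 f : 'rV[R]_d -> R) (S : nat) (rho : R)
    (x : nat -> {RV P >-> 'rV[R]_d}) (y eps : nat -> {RV P >-> R})
    (kappa : nat -> nat) (Delta : forall n, 'I_(kappa n) -> set 'rV[R]_d)
    (m varsigma : nat) (K : nat -> nat)
    (p : forall n, 'I_(K n) -> 'rV[R]_d -> R)
    (Lambda : nat -> {fset mindex d})
    (B : nat -> mindex d -> mindex d -> 'rV[R]_d -> R)
    (h := fun n => mesh (Delta n))
    (bias := fun n => lead_bias X mu m (Delta n) (Lambda n) (B n))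
    (fit := fun n w => series_fit0 (Delta n) (p n) q n (fun i => x i w)) :
  data_generating_process X mu sigma2 f S rho q x y eps ->
  (forall n, polyhedral_partition X (Delta n)) ->
  quasi_uniform Delta ->
  local_basis Delta m varsigma p q ->
  approximation_error X mu S rho Delta m varsigma p Lambda B ->
  (fun n => ln n%:R / (n%:R * h n ^+ d)) @ \oo --> (0 : R) ->
  forall x0, X x0 ->
  (forall n, cond_expectation P (sigma_first x n)
     (fun w => fit n w x0 (fun i => y i w))
     (fun w => fit n w x0 (fun i => mu (x i w)))) /\
  bigO_in_prob P
    (fun n w =>
       (fit n w x0 (fun i => mu (x i w)) - dlim X° q mu x0) -
       (bias n q x0 - fit n w x0 (fun i => bias n (mi0 d) (x i w))))
    (fun n => h n `^ (m%:R + rho - (mdeg q)%:R)).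
Proof.
move=> dgp HP _ lb ae lnh x0 Xx0; split.
  by move=> n; exact: (series_fit_cond_expectation dgp (HP n) (lb_smooth lb (n := n))).
exact: (series_fit_bias_rate d_gt0 dgp HP lb ae lnh Xx0).
Qed.
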